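(* Let $G$ be a simple graph with $m$ edges and $\Gamma$ a straight-line drawing of $G$. If the intersection graph $C$ of $\Gamma$ is a tree with maximum degree $k\in\mathbb{N}$, then the problem MaxSPED on input $\Gamma$ can be solved (i.e., a symmetric partial edge drawing of $\Gamma$ with maximum ink can be computed) in $O(mk+m\log m)$ time and space.
   Context: A straight-line drawing $\Gamma$ of a simple graph $G$ maps vertices to distinct points of the plane and each edge $s=uv$ to the straight-line segment between its endpoints (of length $|s|$), no vertex lying in the interior of an edge not incident to it; edges and their segments are identified. Two edges cross (intersect) if their segments meet in a point other than a common end-vertex. The intersection graph $C$ of $\Gamma$ has one vertex for each edge of $G$, and two vertices of $C$ are adjacent if and only if the corresponding segments intersect. A partial edge drawing (PED) $D$ of $\Gamma$ replaces every edge $s=uv$ by two stubs of positive length contained in the segment of $s$: one of length $f_u|s|$ starting at $u$ and one of length $f_v|s|$ starting at $v$, where $f_u+f_v=f_s$ and $0<f_s\le 1$, such that no stubs of different edges cross. Stubs are regarded as not containing their inner endpoints (the endpoint that is not a vertex), so a stub may end exactly at a crossing point of $\Gamma$ and gaps of infinitesimal size are not charged. The ink of $D$ is the total stub length $I(D)=\sum_{s\in E(G)} f_s|s|$. A symmetric partial edge drawing (SPED) is a PED with $f_u=f_v=f_s/2$ for every edge $s=uv$. MaxSPED: given $\Gamma$, find a SPED $D^*$ of $\Gamma$ such that $I(D^* )$ is maximum over all SPEDs of $\Gamma$. Running times count elementary operations, with arithmetic and comparisons on coordinates and lengths at unit cost, as usual in computational geometry. *)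

(* Defs.v *)
From HB Require Import structures.
From mathcomp Require Import all_boot all_order all_algebra.
From mathcomp Require Import boolp reals.

Set Implicit Arguments.
Unset Strict Implicit.
Unset Printing Implicit Defensive.

Import Order.TTheory GRing.Theory Num.Theory.
Local Open Scope ring_scope.

Section Plane.
Variable R : realType.

Definition point : Type := (R * R)%type.

Definition dist (p q : point) : R :=
  Num.sqrt ((q.1 - p.1) ^+ 2 + (q.2 - p.2) ^+ 2).

Definition pt_at (p q : point) (t : R) : point :=
  (p.1 + t * (q.1 - p.1), p.2 + t * (q.2 - p.2)).

Definition on_segment (p q z : point) : Prop :=
  exists2 t, 0 <= t <= 1 & z = pt_at p q t.

Definition in_segment_interior (p q z : point) : Prop :=
  exists2 t, 0 < t < 1 & z = pt_at p q t.

(* The stub of length a |pq| starting at p on the segment pq, without its inner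
   endpoint. *)
Definition on_stub (p q : point) (a : R) (z : point) : Prop :=
  exists2 t, 0 <= t < a & z = pt_at p q t.

End Plane.

(* A simple graph with vertex set 'I_n, presented by the list of its m edges;
   the order of the edges and of the two ends of an edge only matters for the
   encoding of the graph in the memory of the machine below. *)
Record sgraph (n m : nat) := SGraph {
  tail : 'I_m -> 'I_n;
  head : 'I_m -> 'I_n;
  loopless : forall s, tail s != head s;
  no_multi_edge : injective (fun s => [set tail s; head s])
}.

Definition incident n m (G : sgraph n m) (w : 'I_n) (s : 'I_m) : bool :=
  (w == tail G s) || (w == head G s).

Record drawing (R : realType) n m (G : sgraph n m) := Drawing {
  pos : 'I_n -> point R;
  pos_inj : injective pos;
  no_vertex_inside : forall w s, ~~ incident G w s ->
    ~ in_segment_interior (pos (tail G s)) (pos (head G s)) (pos w)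
}.

Section Drawings.
Variables (R : realType) (n m : nat) (G : sgraph n m) (D : drawing R G).

Definition ptail (s : 'I_m) : point R := pos D (tail G s).
Definition phead (s : 'I_m) : point R := pos D (head G s).
Definition len (s : 'I_m) : R := dist (ptail s) (phead s).

Definition common_end (s t : 'I_m) (z : point R) : Prop :=
  exists w, [/\ incident G w s, incident G w t & z = pos D w].

(* The parts A of the edge s and B of the edge t meet in a point other than the
   position of a common end-vertex of s and t. *)
Definition crossing_parts (s t : 'I_m) (A B : point R -> Prop) : Prop :=
  exists z, [/\ A z, B z & ~ common_end s t z].

Definition segment (s : 'I_m) : point R -> Prop :=
  on_segment (ptail s) (phead s).

Definition crossing (s t : 'I_m) : Prop :=
  crossing_parts s t (segment s) (segment t).

(* Adjacency in the intersection graph, whose vertex set is 'I_m. *)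
Definition intersection_graph : rel 'I_m :=
  [rel s t | (s != t) && `[< crossing s t >]].

(* (f s).1 and (f s).2 are the fractions at the tail and at the head of s. *)
Definition stub_tail (f : 'I_m -> R * R) (s : 'I_m) : point R -> Prop :=
  on_stub (ptail s) (phead s) (f s).1.
Definition stub_head (f : 'I_m -> R * R) (s : 'I_m) : point R -> Prop :=
  on_stub (phead s) (ptail s) (f s).2.

Definition is_PED (f : 'I_m -> R * R) : Prop :=
  (forall s, [/\ 0 < (f s).1, 0 < (f s).2 & (f s).1 + (f s).2 <= 1]) /\
  (forall s t, s != t ->
     [/\ ~ crossing_parts s t (stub_tail f s) (stub_tail f t),
         ~ crossing_parts s t (stub_tail f s) (stub_head f t),
         ~ crossing_parts s t (stub_head f s) (stub_tail f t) &
         ~ crossing_parts s t (stub_head f s) (stub_head f t)]).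

Definition PED_ink (f : 'I_m -> R * R) : R :=
  \sum_s ((f s).1 + (f s).2) * len s.

Definition is_SPED (f : 'I_m -> R * R) : Prop :=
  is_PED f /\ (forall s, (f s).1 = (f s).2).

Definition is_MaxSPED (f : 'I_m -> R * R) : Prop :=
  is_SPED f /\ (forall g, is_SPED g -> PED_ink g <= PED_ink f).

End Drawings.

Section FiniteGraphs.
Variables (T : finType) (e : rel T).

(* [ucycle] also accepts [:: x; y] for an edge xy, whence the bound on the size:
   a cycle of a simple graph has at least three vertices. *)
Definition is_tree : Prop :=
  [/\ (0 < #|T|)%N,
      symmetric e,
      irreflexive e,
      (forall x y, connect e x y) &
      (forall c : seq T, ucycle e c -> (size c <= 2)%N)].

Definition max_degree : nat := \max_(x : T) #|[set y | e x y]|.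

End FiniteGraphs.

(* Real RAM with structured control. The memory consists of natural-number
   arrays and real arrays; array names are literals in the program, so that a
   program uses a fixed number of arrays, and cell 0 of an array serves as a
   scalar variable. Natural numbers are used for indices, with
   addition and truncated subtraction only. The real operations are the four arithmetic
   operations, square root (for lengths) and comparisons, and there is no
   conversion between the two sorts. Constants are natural numbers, so that a
   program cannot contain real data. *)
Inductive nexp :=
  | NConst of nat
  | NGet of nat & nexp                 (* NGet a i : cell i of nat array a *)
  | NAdd of nexp & nexp
  | NSub of nexp & nexp.

Inductive rexp :=
  | RConst of nat
  | RGet of nat & nexp                 (* RGet a i : cell i of real array a *)
  | RAdd of rexp & rexp
  | RSub of rexp & rexp
  | RMul of rexp & rexp
  | RDiv of rexp & rexp
  | RSqrt of rexp.

Inductive test :=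
  | NLe of nexp & nexp
  | RLe of rexp & rexp.

Inductive prog :=
  | Skip
  | NSet of nat & nexp & nexp          (* NSet a i e : a[i] := e *)
  | RSet of nat & nexp & rexp
  | Seq of prog & prog
  | If of test & prog & prog
  | While of test & prog.

(* Number of elementary operations of an expression (one per node). *)
Fixpoint ncost (e : nexp) : nat :=
  match e with
  | NConst _ => 1
  | NGet _ i => (ncost i).+1
  | NAdd e1 e2 | NSub e1 e2 => (ncost e1 + ncost e2).+1
  end.

Fixpoint rcost (e : rexp) : nat :=
  match e with
  | RConst _ => 1
  | RGet _ i => (ncost i).+1
  | RAdd e1 e2 | RSub e1 e2 | RMul e1 e2 | RDiv e1 e2 =>
      (rcost e1 + rcost e2).+1
  | RSqrt e1 => (rcost e1).+1
  end.

Definition tcost (b : test) : nat :=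
  match b with
  | NLe e1 e2 => (ncost e1 + ncost e2).+1
  | RLe e1 e2 => (rcost e1 + rcost e2).+1
  end.

Section Semantics.
Variable R : realType.

Record memory := Memory {
  nmem : nat -> nat -> nat;
  rmem : nat -> nat -> R
}.

Definition write (A : Type) (mem : nat -> nat -> A) (a i : nat) (v : A) :
    nat -> nat -> A :=
  fun b j => if (b == a) && (j == i) then v else mem b j.

Fixpoint neval (M : memory) (e : nexp) : nat :=
  match e with
  | NConst c => c
  | NGet a i => nmem M a (neval M i)
  | NAdd e1 e2 => (neval M e1 + neval M e2)%N
  | NSub e1 e2 => (neval M e1 - neval M e2)%N
  end.

Fixpoint reval (M : memory) (e : rexp) : R :=
  match e with
  | RConst c => c%:R
  | RGet a i => rmem M a (neval M i)
  | RAdd e1 e2 => reval M e1 + reval M e2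
  | RSub e1 e2 => reval M e1 - reval M e2
  | RMul e1 e2 => reval M e1 * reval M e2
  | RDiv e1 e2 => reval M e1 / reval M e2
  | RSqrt e1 => Num.sqrt (reval M e1)
  end.

Definition teval (M : memory) (b : test) : bool :=
  match b with
  | NLe e1 e2 => (neval M e1 <= neval M e2)%N
  | RLe e1 e2 => reval M e1 <= reval M e2
  end.

(* exec p M M' t s : started in memory M, p halts in memory M' after t
   elementary operations, and s is one more than the largest index at which it
   writes to some array (0 if it writes nothing). As the number of arrays is
   fixed by p, the number of cells p uses besides the input is O(s). *)
Inductive exec : prog -> memory -> memory -> nat -> nat -> Prop :=
  | ExecSkip M : exec Skip M M 1 0
  | ExecNSet M a i e :
      exec (NSet a i e) M
        (Memory (write (nmem M) a (neval M i) (neval M e)) (rmem M))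
        (ncost i + ncost e).+1 (neval M i).+1
  | ExecRSet M a i e :
      exec (RSet a i e) M
        (Memory (nmem M) (write (rmem M) a (neval M i) (reval M e)))
        (ncost i + rcost e).+1 (neval M i).+1
  | ExecSeq M1 M2 M3 p q t1 t2 s1 s2 :
      exec p M1 M2 t1 s1 -> exec q M2 M3 t2 s2 ->
      exec (Seq p q) M1 M3 (t1 + t2) (maxn s1 s2)
  | ExecIfTrue M M' b p q t s :
      teval M b -> exec p M M' t s ->
      exec (If b p q) M M' (tcost b + t) s
  | ExecIfFalse M M' b p q t s :
      ~~ teval M b -> exec q M M' t s ->
      exec (If b p q) M M' (tcost b + t) s
  | ExecWhileFalse M b p :
      ~~ teval M b -> exec (While b p) M M (tcost b) 0
  | ExecWhileTrue M1 M2 M3 b p t1 t2 s1 s2 :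
      teval M1 b -> exec p M1 M2 t1 s1 -> exec (While b p) M2 M3 t2 s2 ->
      exec (While b p) M1 M3 (tcost b + t1 + t2) (maxn s1 s2).

(* v extended to nat by the default value d. *)
Definition tabulate (A : Type) (d : A) (k : nat) (v : 'I_k -> A) (i : nat) : A :=
  if insub i is Some j then v j else d.

(* Nat array 0 holds n and m, nat arrays 1 and 2 the tails and heads of the
   edges, real arrays 0 and 1 the coordinates of the vertices; every other cell
   holds 0. *)
Definition input_memory n m (G : sgraph n m) (D : drawing R G) : memory :=
  Memory
    (fun a => match a with
       | 0 => nth 0%N [:: n; m]
       | 1 => tabulate 0%N (fun s => nat_of_ord (tail G s))
       | 2 => tabulate 0%N (fun s => nat_of_ord (head G s))
       | _ => fun=> 0%N
       end)
    (fun a => match a with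
       | 0 => tabulate 0 (fun v => (pos D v).1)
       | 1 => tabulate 0 (fun v => (pos D v).2)
       | _ => fun=> 0
       end).

(* On halting, the fractions at the tail and at the head of the edges are read
   off from the real arrays 2 and 3. *)
Definition output_stubs m (M : memory) (s : 'I_m) : R * R :=
  (rmem M 2 s, rmem M 3 s).

End Semantics.

(* Main.v *)
(* Two crossing edges s and t of a symmetric drawing with stub ratios g_s and g_t
   do not interfere iff g_s or g_t is at most the smaller of the two fractions
   into which the crossing point divides the edge. So a SPED is an assignment
   of ratios g_s in (0, 1/2] with one disjunctive constraint per edge of the
   intersection graph. If this graph is a tree, rooted anywhere, then a node
   with c children has an optimal ratio among its upper bound and the c
   thresholds set by its children, and evaluating each candidate takes O(c)
   time; the numbers of children are at most k and sum up to m - 1, whence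
   O(m k). The m - 1 crossings are found by a Bentley-Ottmann sweep in
   O(m log m), after a shear that leaves no edge vertical; as the tree has no
   triangle, no three edges cross in one point.

   The algorithm is a functional program, which the combinators of [Comp]
   translate into a program of the real RAM together with a time bound. *)
Require Import Defs.
From mathcomp Require Import all_boot all_order all_algebra.
From mathcomp Require Import boolp reals.
From mathcomp Require Import zify ring lra.

Set Implicit Arguments.
Unset Strict Implicit.
Unset Printing Implicit Defensive.

Import Order.TTheory GRing.Theory Num.Theory.

(** * Values in the memory of the real RAM *)

Section Heap.
Variable R : realType.

(** Values are immutable and a cell is never reclaimed, but the heap pointer advances by at most one
    per operation, so the bound on time is also a bound on space. The cost function of a program has
    to be valid on every input, also on trees that are not balanced and on lists that come from no
    drawing. Costs are therefore stated through tree depths and list lengths, and become O(m k + m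
    log m) only at the end, along the run on an actual drawing. The outer loops run over a list that
    serves as fuel; potentials show that it suffices, and surplus steps change nothing. A maximum
    exists although ratios range over a half-open interval: crossings are interior to both edges, so
    all thresholds are positive, and stubs without their inner ends may reach a threshold exactly.
    The intersection graph is explored without visited marks, since in a forest an unexplored edge
    cannot lead back to a vertex already reached. *)

Inductive value := VN of nat | VR of R | VP of value & value.

Local Notation mem := (memory R).

(* Values are immutable and live in a heap whose cell i consists of the cells i
   of the nat arrays 3 and 4 and of the real array 4. Nat array 5 holds
   registers: 0 is the first free heap cell, 1 the address of the current value,
   2 to 4 are temporary. *)
Definition hp (M : mem) := nmem M 5 0.
Definition acc (M : mem) := nmem M 5 1.

(** The bound [a < hp M] at every node makes a representation survive later allocations, which write
    at [hp M] and above. Sharing of cells is allowed. *)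
Fixpoint rep (M : mem) (v : value) (a : nat) : Prop :=
  (a < hp M)%N /\
  match v with
  | VN n => nmem M 3 a = n
  | VR x => rmem M 4 a = x
  | VP v w => rep M v (nmem M 3 a) /\ rep M w (nmem M 4 a)
  end.

Definition heap_ext (M M' : mem) : Prop :=
  [/\ (hp M <= hp M')%N,
      forall a, (a < hp M)%N -> nmem M' 3 a = nmem M 3 a,
      forall a, (a < hp M)%N -> nmem M' 4 a = nmem M 4 a &
      forall a, (a < hp M)%N -> rmem M' 4 a = rmem M 4 a].

Lemma rep_ext M M' v a : heap_ext M M' -> rep M v a -> rep M' v a.
Proof.
case=> hle h3 h4 hr; elim: v a => [n|x|v IHv w IHw] a /= [ha].
- by move=> <-; rewrite h3 //; split=> //; apply: leq_trans hle.
- by move=> <-; rewrite hr //; split=> //; apply: leq_trans hle.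
- case=> /IHv hv /IHw hw; rewrite h3 // h4 //; split=> //.
  exact: leq_trans hle.
Qed.

Definition top (M : mem) (v : value) := rep M v (acc M).

(** Space needs no parameter of its own: writes go to heap cells below the final pointer or to a few
    low indices, for which the slack 9 is ample, and the pointer advances by at most the running
    time. *)
Definition runs_from (M : mem) (p : prog) (w : value) (T : nat) : Prop :=
  exists M' t s,
    [/\ exec p M M' t s, top M' w, (t <= T)%N, (s <= hp M' + 9)%N &
        (hp M <= hp M' <= hp M + t)%N].

Definition runs (p : prog) (v w : value) (T : nat) : Prop :=
  forall M, top M v -> runs_from M p w T.

Lemma runs_seq p q u v w T1 T2 :
  runs p u v T1 -> runs q v w T2 -> runs (Seq p q) u w (T1 + T2).
Proof.
move=> hp1 hq M /hp1 [M1 [t1 [s1 [e1 r1 l1 b1 c1]]]].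
have [M2 [t2 [s2 [e2 r2 l2 b2 c2]]]] := hq _ r1.
exists M2, (t1 + t2)%N, (maxn s1 s2); split=> //; try lia.
exact: ExecSeq e1 e2.
Qed.

Lemma runs_le p u v T T' : (T <= T')%N -> runs p u v T -> runs p u v T'.
Proof.
move=> h hr M /hr [M1 [t1 [s1 [e1 r1 l1 b1 c1]]]].
by exists M1, t1, s1; split=> //; apply: leq_trans h.
Qed.

Definition HP := NGet 5 (NConst 0).
Definition ACC := NGet 5 (NConst 1).
Definition FST e := NGet 3 e.
Definition SND e := NGet 4 e.

(* Loads registers before writing the heap, so that all operands are read in
   the initial memory. *)
Definition cons2 (e1 e2 : nexp) : prog :=
  Seq (NSet 5 (NConst 2) e1) (Seq (NSet 5 (NConst 3) e2)
  (Seq (NSet 3 HP (NGet 5 (NConst 2))) (Seq (NSet 4 HP (NGet 5 (NConst 3)))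
  (Seq (NSet 5 (NConst 1) HP) (NSet 5 (NConst 0) (NAdd HP (NConst 1))))))).

Definition consl (e1 e2 e3 : nexp) : prog :=
  Seq (NSet 5 (NConst 4) e3)
   (Seq (cons2 e1 e2) (cons2 ACC (NGet 5 (NConst 4)))).

Definition consr (e1 e2 e3 : nexp) : prog :=
  Seq (NSet 5 (NConst 4) e1)
   (Seq (cons2 e2 e3) (cons2 (NGet 5 (NConst 4)) ACC)).

(** Addresses that depend only on registers 1 and 4 and on the nat arrays of the heap. The second
    operand of [cons2] keeps its value when the first one is saved in register 2. *)
Inductive stable : nexp -> Prop :=
  | stable_acc : stable ACC
  | stable_r4 : stable (NGet 5 (NConst 4))
  | stable_fst e : stable e -> stable (FST e)
  | stable_snd e : stable e -> stable (SND e).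

Lemma stable_eval (M M' : mem) e : stable e ->
  acc M = acc M' -> nmem M 5 4 = nmem M' 5 4 ->
  nmem M 3 = nmem M' 3 -> nmem M 4 = nmem M' 4 -> neval M e = neval M' e.
Proof. by move=> + h1 h2 h3 h4; elim=> //= {}e _ ->; rewrite ?h3 ?h4. Qed.

Lemma cons2_spec (M : mem) e1 e2 v1 v2 : stable e1 -> stable e2 ->
  rep M v1 (neval M e1) -> rep M v2 (neval M e2) ->
  exists M' t s,
   [/\ exec (cons2 e1 e2) M M' t s, top M' (VP v1 v2),
       (t <= ncost e1 + ncost e2 + 30)%N, (s <= hp M' + 9)%N &
       [/\ hp M' = (hp M).+1, (1 < t)%N, heap_ext M M' & nmem M' 5 4 = nmem M 5 4]].
Proof.
move=> st1 st2 r1 r2.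
set M1 := Memory (write (nmem M) 5 2 (neval M e1)) (rmem M).
have ev2 : neval M1 e2 = neval M e2 by apply: stable_eval.
set b1 := neval M e1; set b2 := neval M e2; set h := hp M.
pose M' := Memory (fun a i =>
  if (a == 5) && (i == 0) then h.+1 else
  if (a == 5) && (i == 1) then h else
  if (a == 5) && (i == 2) then b1 else
  if (a == 5) && (i == 3) then b2 else
  if (a == 3) && (i == h) then b1 else
  if (a == 4) && (i == h) then b2 else nmem M a i) (rmem M).
have xt : heap_ext M M'.
  by split=> //= a ha; rewrite /hp /= (ltn_eqF ha).
have := rep_ext xt r1; have := rep_ext xt r2 => q2 q1.
exists M'; do 2 eexists; split.
- do 5 (apply: ExecSeq; first exact: ExecNSet).
  set M5 := Memory _ _.
  have -> : M' = Memory (write (nmem M5) 5 (neval M5 (NConst 0)) (neval M5 (NAdd HP (NConst 1)))) (rmem M5).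
    congr Memory; apply/funext => a; apply/funext => i.
    rewrite /M5 /= /write /= -/M1 ev2 /hp -/h addn1.
    case: a => [|[|[|[|[|[|a]]]]]] //=; case: i => [|[|[|[|i]]]] //=.
  exact: ExecNSet.
- rewrite /top /= /acc /hp /= eqxx /=; split; first exact: ltnSn.
  by split.
- rewrite /=; lia.
- rewrite /= /write /= /hp /= /h /hp; lia.
- split=> //=; lia.
Qed.

Lemma cons2_runs e1 e2 v w T1 T2 : stable e1 -> stable e2 ->
  (forall M, top M v -> rep M T1 (neval M e1)) ->
  (forall M, top M v -> rep M T2 (neval M e2)) -> w = VP T1 T2 ->
  runs (cons2 e1 e2) v w (ncost e1 + ncost e2 + 30).
Proof.
move=> s1 s2 h1 h2 -> M tM.
have [M' [t [s [a b c d [e e' f g]]]]] := cons2_spec s1 s2 (h1 _ tM) (h2 _ tM).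
exists M', t, s; split=> //; lia.
Qed.

Lemma setr4_spec (M : mem) e v : top M v ->
  exists M' t s, [/\ exec (NSet 5 (NConst 4) e) M M' t s, top M' v,
   t = (ncost e).+2, s = 5 &
   [/\ hp M' = hp M, acc M' = acc M, nmem M' 5 4 = neval M e & 
     [/\ heap_ext M M', nmem M' 3 = nmem M 3 & nmem M' 4 = nmem M 4]]].
Proof.
move=> tM; set M' := Memory (write (nmem M) 5 4 (neval M e)) (rmem M).
have xt : heap_ext M M' by split.
exists M'; do 2 eexists; split; first exact: ExecNSet.
- exact: (rep_ext xt tM).
- by rewrite /= add1n.
- by [].
- by split.
Qed.

(** Paths that start at the accumulator. Register 4 is excluded because the composite allocations
    overwrite it first. *)
Inductive pathexp : nexp -> Prop :=
  | path_acc : pathexp ACC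
  | path_fst e : pathexp e -> pathexp (FST e)
  | path_snd e : pathexp e -> pathexp (SND e).

Lemma path_stable e : pathexp e -> stable e.
Proof. by elim=> *; constructor. Qed.

Lemma consl_runs e1 e2 e3 v w v1 v2 v3 :
  pathexp e1 -> pathexp e2 -> pathexp e3 ->
  (forall M, top M v -> rep M v1 (neval M e1)) ->
  (forall M, top M v -> rep M v2 (neval M e2)) ->
  (forall M, top M v -> rep M v3 (neval M e3)) ->
  w = VP (VP v1 v2) v3 ->
  runs (consl e1 e2 e3) v w (ncost e1 + ncost e2 + ncost e3 + 70).
Proof.
move=> p1 p2 p3 h1 h2 h3 -> M tM.
have [M1 [t1 [s1 [x1 tM1 et1 es1 [ehp ea er [xt e3' e4']]]]]] := setr4_spec e3 tM.
have [M2 [t2 [s2 [x2 tM2 et2 es2 [ehp2 lt2 xt2 er2]]]]] :=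
  cons2_spec (path_stable p1) (path_stable p2) (h1 _ tM1) (h2 _ tM1).
have r3 : rep M2 v3 (neval M2 (NGet 5 (NConst 4))).
  by rewrite /= er2 er; apply: rep_ext xt2 _; apply: rep_ext xt _; apply: h3.
have [M3 [t3 [s3 [x3 tM3 et3 es3 [ehp3 lt3 xt3 er3]]]]] :=
  cons2_spec stable_acc stable_r4 tM2 r3.
exists M3; do 2 eexists; split.
- exact: ExecSeq x1 (ExecSeq x2 x3).
- exact: tM3.
- by rewrite et1; move: et2 et3 => /=; lia.
- lia.
- by rewrite ehp3 ehp2 ehp; lia.
Qed.

Lemma consr_runs e1 e2 e3 v w v1 v2 v3 :
  pathexp e1 -> pathexp e2 -> pathexp e3 ->
  (forall M, top M v -> rep M v1 (neval M e1)) ->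
  (forall M, top M v -> rep M v2 (neval M e2)) ->
  (forall M, top M v -> rep M v3 (neval M e3)) ->
  w = VP v1 (VP v2 v3) ->
  runs (consr e1 e2 e3) v w (ncost e1 + ncost e2 + ncost e3 + 70).
Proof.
move=> p1 p2 p3 h1 h2 h3 -> M tM.
have [M1 [t1 [s1 [x1 tM1 et1 es1 [ehp ea er [xt e3' e4']]]]]] := setr4_spec e1 tM.
have [M2 [t2 [s2 [x2 tM2 et2 es2 [ehp2 lt2 xt2 er2]]]]] :=
  cons2_spec (path_stable p2) (path_stable p3) (h2 _ tM1) (h3 _ tM1).
have r3 : rep M2 v1 (neval M2 (NGet 5 (NConst 4))).
  by rewrite /= er2 er; apply: rep_ext xt2 _; apply: rep_ext xt _; apply: h1.
have [M3 [t3 [s3 [x3 tM3 et3 es3 [ehp3 lt3 xt3 er3]]]]] :=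
  cons2_spec stable_r4 stable_acc r3 tM2.
exists M3; do 2 eexists; split.
- exact: ExecSeq x1 (ExecSeq x2 x3).
- exact: tM3.
- by rewrite et1; move: et2 et3 => /=; lia.
- lia.
- by rewrite ehp3 ehp2 ehp; lia.
Qed.

(** A frame condition: such programs preserve the input arrays and the counter in nat array 6, so
    that they can run inside the loop that reads the input. *)
Fixpoint heap_only (p : prog) : bool :=
  match p with
  | Skip => true
  | NSet a _ _ => a \in [:: 3; 4; 5]
  | RSet a _ _ => a == 4
  | Seq p q | If _ p q => heap_only p && heap_only q
  | While _ p => heap_only p
  end.

Definition same_outside (M M' : mem) : Prop :=
  (forall a i, a \notin [:: 3; 4; 5] -> nmem M' a i = nmem M a i) /\
  (forall a i, a != 4 -> rmem M' a i = rmem M a i).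

Lemma heap_only_outside p (M M' : mem) t s :
  exec p M M' t s -> heap_only p -> same_outside M M'.
Proof.
elim=> {p M M' t s} [M|M a i e|M a i e|M1 M2 M3 p q t1 t2 s1 s2 _ IH1 _ IH2|
  M M' b p q t s _ _ IH|M M' b p q t s _ _ IH|M b p _|M1 M2 M3 b p t1 t2 s1 s2 _ _ IH1 _ IH2] /=.
- by [].
- move=> ha; split=> //= b j hb; rewrite /write; case: eqP => [e'|] //=.
  by rewrite e' ha in hb.
- move=> /eqP ->; split=> //= b j hb; rewrite /write (negbTE hb) //.
- move=> /andP[/IH1[a b] /IH2[c d]]; split=> x i h; first by rewrite c // a.
  by rewrite d // b.
- by move=> /andP[/IH].
- by move=> /andP[_ /IH].
- by [].
- move=> h; have [k1 l1] := IH1 h; have [k2 l2] := IH2 h; split=> x i h'.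
    by rewrite k2 // k1.
  by rewrite l2 // l1.
Qed.

Definition newN (e : nexp) (rest : nexp) : prog :=
  Seq (NSet 5 (NConst 4) rest)
  (Seq (NSet 3 HP e) (Seq (NSet 5 (NConst 1) HP)
    (Seq (NSet 5 (NConst 0) (NAdd HP (NConst 1))) (cons2 ACC (NGet 5 (NConst 4)))))).

Definition newR (e : rexp) (rest : nexp) : prog :=
  Seq (NSet 5 (NConst 4) rest)
  (Seq (RSet 4 HP e) (Seq (NSet 5 (NConst 1) HP)
    (Seq (NSet 5 (NConst 0) (NAdd HP (NConst 1))) (cons2 ACC (NGet 5 (NConst 4)))))).

(** The hypothesis on [e] ranges over memories [M'] because [e] is evaluated after register 4 has
    been set; it may still read the input arrays, which agree in [M] and [M']. *)
Lemma newN_spec (M : mem) e rest v n u : pathexp rest -> top M v ->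
  (forall M', top M' v -> same_outside M M' -> neval M' e = n) ->
  (forall M', top M' v -> rep M' u (neval M' rest)) ->
  runs_from M (newN e rest) (VP (VN n) u) (ncost e + ncost rest + 60).
Proof.
move=> p1 tM h1 h2.
have [M1 [t1 [s1 [x1 tM1 et1 es1 [ehp ea er [xt e3' e4']]]]]] := setr4_spec rest tM.
have so := heap_only_outside x1 isT.
set h := hp M1.
pose M2 := Memory (fun a i =>
  if (a == 5) && (i == 0) then h.+1 else
  if (a == 5) && (i == 1) then h else
  if (a == 3) && (i == h) then n else nmem M1 a i) (rmem M1).
have xt2 : heap_ext M1 M2.
  by split=> //= a ha; rewrite /hp /= (ltn_eqF ha).
have tM2 : top M2 (VN n) by rewrite /top /= /acc /hp /= eqxx.
have r3 : rep M2 u (neval M2 (NGet 5 (NConst 4))).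
  by apply: rep_ext xt2 _; rewrite /= er; apply: rep_ext xt _; apply: h2.
have [M3 [t3 [s3 [x3 tM3 et3 es3 [ehp3 lt3 xt3 er3]]]]] :=
  cons2_spec stable_acc stable_r4 tM2 r3.
have ehp2 : hp M2 = h.+1 by [].
exists M3; do 2 eexists; split.
- apply: ExecSeq x1 _.
  apply: (ExecSeq (ExecNSet _ _ _ _)).
  apply: (ExecSeq (ExecNSet _ _ _ _)).
  apply: ExecSeq; last exact: x3.
  set M5 := Memory _ _.
  have -> : M2 = Memory (write (nmem M5) 5 (neval M5 (NConst 0)) (neval M5 (NAdd HP (NConst 1)))) (rmem M5).
    congr Memory; apply/funext => a; apply/funext => i.
    rewrite /M5 /= /write /= h1 // /hp -/h addn1.
    case: a => [|[|[|[|[|[|a]]]]]] //=; case: i => [|[|[|[|i]]]] //=.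
  exact: ExecNSet.
- exact: tM3.
- by rewrite et1 /= /hp; move: et3 => /=; lia.
- move: es3; rewrite ehp3 ehp2 es1 /= /write /= /h /hp; lia.
- by rewrite ehp3 ehp2 /h ehp /=; lia.
Qed.

Lemma newN_runs e rest v n u : pathexp rest ->
  (forall M, top M v -> neval M e = n) ->
  (forall M, top M v -> rep M u (neval M rest)) ->
  runs (newN e rest) v (VP (VN n) u) (ncost e + ncost rest + 60).
Proof. by move=> p h1 h2 M tM; apply: newN_spec p tM _ h2 => M' /h1. Qed.

Lemma newR_spec (M : mem) e rest v x u : pathexp rest -> top M v ->
  (forall M', top M' v -> same_outside M M' -> reval M' e = x) ->
  (forall M', top M' v -> rep M' u (neval M' rest)) ->
  runs_from M (newR e rest) (VP (VR x) u) (rcost e + ncost rest + 60).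
Proof.
move=> p1 tM h1 h2.
have [M1 [t1 [s1 [x1 tM1 et1 es1 [ehp ea er [xt e3' e4']]]]]] := setr4_spec rest tM.
have so := heap_only_outside x1 isT.
set h := hp M1.
pose M2 := Memory (fun a i =>
  if (a == 5) && (i == 0) then h.+1 else
  if (a == 5) && (i == 1) then h else nmem M1 a i)
  (write (rmem M1) 4 h x).
have xt2 : heap_ext M1 M2.
  by split=> //= a ha; rewrite /write /= ?(ltn_eqF ha).
have tM2 : top M2 (VR x) by rewrite /top /= /acc /hp /= /write /= eqxx.
have r3 : rep M2 u (neval M2 (NGet 5 (NConst 4))).
  by apply: rep_ext xt2 _; rewrite /= er; apply: rep_ext xt _; apply: h2.
have [M3 [t3 [s3 [x3 tM3 et3 es3 [ehp3 lt3 xt3 er3]]]]] :=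
  cons2_spec stable_acc stable_r4 tM2 r3.
have ehp2 : hp M2 = h.+1 by [].
exists M3; do 2 eexists; split.
- apply: ExecSeq x1 _.
  apply: (ExecSeq (ExecRSet _ _ _ _)).
  apply: (ExecSeq (ExecNSet _ _ _ _)).
  apply: ExecSeq; last exact: x3.
  set M5 := Memory _ _.
  have -> : M2 = Memory (write (nmem M5) 5 (neval M5 (NConst 0)) (neval M5 (NAdd HP (NConst 1)))) (rmem M5).
    rewrite /M2 /M5 /= h1 //; congr Memory; apply/funext => a; apply/funext => i.
    rewrite /write /= /hp -/h addn1.
    case: a => [|[|[|[|[|[|a]]]]]] //=; case: i => [|[|[|[|i]]]] //=.
  exact: ExecNSet.
- exact: tM3.
- by rewrite et1 /= /hp; move: et3 => /=; lia.
- move: es3; rewrite ehp3 ehp2 es1 /= /write /= /h /hp; lia.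
- by rewrite ehp3 ehp2 /h ehp /=; lia.
Qed.

Lemma newR_runs e rest v x u : pathexp rest ->
  (forall M, top M v -> reval M e = x) ->
  (forall M, top M v -> rep M u (neval M rest)) ->
  runs (newR e rest) v (VP (VR x) u) (rcost e + ncost rest + 60).
Proof. by move=> p h1 h2 M tM; apply: newR_spec p tM _ h2 => M' /h1. Qed.

End Heap.

(** * Combinators for programs with time bounds *)

Section Run.
Variable R : realType.
Local Notation value := (value R).

Lemma runs_if b (beta : bool) p q (v w : value) T :
  (forall M, top M v -> teval M b = beta) ->
  runs (if beta then p else q) v w T -> runs (If b p q) v w (tcost b + T).
Proof.
move=> hb hr M tM; have [M' [t [s [e tM' lt ls lh]]]] := hr M tM.
exists M', (tcost b + t)%N, s; split=> //; try lia.
by case: beta hb e {hr} => hb e; [apply: ExecIfTrue|apply: ExecIfFalse]; rewrite ?hb.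
Qed.

Definition drop := NSet 5 (NConst 1) (SND ACC).

Lemma drop_runs (v r : value) : runs drop (VP v r) r 5.
Proof.
move=> M [_ [_ hr]].
exists (Memory (write (nmem M) 5 1 (nmem M 4 (acc M))) (rmem M)).
do 2 eexists; split; first exact: ExecNSet.
- apply: rep_ext hr; split=> //.
- by [].
- by rewrite /=; lia.
- by rewrite /hp /= /write /=; lia.
Qed.

Arguments drop_runs : clear implicits.

Ltac path_rep := move=> M; rewrite /top /=; intuition.

Lemma swap_runs : exists C, forall v w r : value,
  runs (consr (FST (SND ACC)) (FST ACC) (SND (SND ACC))) (VP v (VP w r)) (VP w (VP v r)) C.
Proof.
eexists=> v w r; apply: consr_runs; last reflexivity; try by repeat constructor.
all: by path_rep.
Qed.

Lemma mkpair_runs : exists C, forall v w r : value,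
  runs (consl (FST (SND ACC)) (FST ACC) (SND (SND ACC))) (VP w (VP v r)) (VP (VP v w) r) C.
Proof.
eexists=> v w r; apply: consl_runs; last reflexivity; try by repeat constructor.
all: by path_rep.
Qed.

(* [Run i o t]: one program turns the code [i a] on top of the stack into
   [o a], in time O(1 + t a), for all a. *)
Definition Run (A : Type) (i o : A -> value) (t : A -> nat) : Prop :=
  exists p C, forall a r, runs p (VP (i a) r) (VP (o a) r) (C * (t a).+1).

Lemma Run_le A (i o : A -> value) (t t' : A -> nat) C :
  (forall a, t a <= C * (t' a).+1)%N -> Run i o t -> Run i o t'.
Proof.
move=> h [p [D hp]]; exists p, (D * C.+1)%N => a r.
apply: runs_le (hp a r); rewrite -mulnA leq_mul2l; apply/orP; right.
by have := h a; nia.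
Qed.

Lemma Run_ext A (i o i' o' : A -> value) t :
  (forall a, i a = i' a) -> (forall a, o a = o' a) -> Run i o t -> Run i' o' t.
Proof. by move=> h1 h2 [p [C h]]; exists p, C => a r; rewrite -h1 -h2. Qed.

Lemma Run_sub A B (g : B -> A) (i o : A -> value) t :
  Run i o t -> Run (i \o g) (o \o g) (t \o g).
Proof. by move=> [p [C h]]; exists p, C => a r; apply: h. Qed.

Lemma Run_const_time A (i o : A -> value) p C t :
  (forall a r, runs p (VP (i a) r) (VP (o a) r) C) -> Run i o t.
Proof. by move=> h; exists p, C => a r; apply: runs_le (h a r); nia. Qed.

Lemma Run_id A (i : A -> value) t : Run i i t.
Proof.
apply: (@Run_const_time _ _ _ Skip 1) => a r M tM.
by exists M, 1%N, 0%N; split=> //; [constructor|lia].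
Qed.

Lemma Run_comp A (i m o : A -> value) t1 t2 :
  Run i m t1 -> Run m o t2 -> Run i o (fun a => t1 a + t2 a)%N.
Proof.
move=> [p [C hp]] [q [D hq]]; exists (Seq p q), (C + D)%N => a r.
apply: runs_le (runs_seq (hp a r) (hq a r)); nia.
Qed.

(** The argument is duplicated on the stack so that each program consumes its own copy. Copying
    duplicates an address only, hence takes constant time whatever the size of the value. *)
Lemma Run_pair A (i o1 o2 : A -> value) t1 t2 :
  Run i o1 t1 -> Run i o2 t2 ->
  Run i (fun a => VP (o1 a) (o2 a)) (fun a => t1 a + t2 a)%N.
Proof.
have [C2 h2] := swap_runs; have [C3 h3] := mkpair_runs.
move=> [p [C hp]] [q [D hq]].
exists (Seq (cons2 (FST ACC) ACC) (Seq p (Seq (consr (FST (SND ACC)) (FST ACC) (SND (SND ACC)))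
  (Seq q (consl (FST (SND ACC)) (FST ACC) (SND (SND ACC))))))), (100 + C2 + C3 + C + D)%N => a r.
have h1 : runs (cons2 (FST ACC) ACC) (VP (i a) r) (VP (i a) (VP (i a) r)) 100.
  by apply: runs_le; last (apply: cons2_runs; last reflexivity);
    [|repeat constructor..|path_rep|path_rep].
apply: runs_le (runs_seq h1 (runs_seq (hp _ _) (runs_seq (h2 _ _ _) (runs_seq (hq _ _) (h3 _ _ _))))).
nia.
Qed.

Lemma Run_fst A (o1 o2 : A -> value) t : Run (fun a => VP (o1 a) (o2 a)) o1 t.
Proof.
apply: Run_const_time => a r.
by apply: (@cons2_runs _ (FST (FST ACC)) (SND ACC)); last reflexivity; [repeat constructor..|path_rep|path_rep].
Qed.

Lemma Run_snd A (o1 o2 : A -> value) t : Run (fun a => VP (o1 a) (o2 a)) o2 t.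
Proof.
apply: Run_const_time => a r.
by apply: (@cons2_runs _ (SND (FST ACC)) (SND ACC)); last reflexivity; [repeat constructor..|path_rep|path_rep].
Qed.

Lemma Run_nat A (i : A -> value) (n : nat) t : Run i (fun a => VN R n) t.
Proof.
apply: Run_const_time => a r.
by apply: (@newN_runs _ (NConst n) (SND ACC)); [repeat constructor| |path_rep].
Qed.

Lemma Run_real A (i : A -> value) (n : nat) t : Run i (fun a => VR n%:R) t.
Proof.
apply: Run_const_time => a r.
by apply: (@newR_runs _ (RConst n) (SND ACC)); [repeat constructor| |path_rep].
Qed.

Lemma Run_addn A (x y : A -> nat) t :
  Run (fun a => VP (VN R (x a)) (VN R (y a))) (fun a => VN R (x a + y a)) t.
Proof.
apply: Run_const_time => a r.
apply: (@newN_runs _ (NAdd (FST (FST (FST ACC))) (FST (SND (FST ACC)))) (SND ACC));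
  [repeat constructor| |path_rep].
by move=> M; rewrite /top /= -/(acc M); case=> _ [[_ [[_ ->] [_ ->]]]].
Qed.

Definition top_r1 := RGet 4 (FST (FST ACC)).
Definition top_r2 := RGet 4 (SND (FST ACC)).

Lemma Run_rop2 (cst : rexp -> rexp -> rexp) (op : R -> R -> R) A (x y : A -> R) t :
  (forall M e f, reval M (cst e f) = op (reval M e) (reval M f)) ->
  Run (fun a => VP (VR (x a)) (VR (y a))) (fun a => VR (op (x a) (y a))) t.
Proof.
move=> h; apply: Run_const_time => a r.
apply: (@newR_runs _ (cst top_r1 top_r2) (SND ACC)); [repeat constructor| |path_rep].
by move=> M; rewrite h /top /= -/(acc M); case=> _ [[_ [[_ ->] [_ ->]]]].
Qed.

Lemma Run_rop1 (cst : rexp -> rexp) (op : R -> R) A (x : A -> R) t :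
  (forall M e, reval M (cst e) = op (reval M e)) ->
  Run (fun a => VR (x a)) (fun a => VR (op (x a))) t.
Proof.
move=> h; apply: Run_const_time => a r.
apply: (@newR_runs _ (cst (RGet 4 (FST ACC))) (SND ACC)); [repeat constructor| |path_rep].
by move=> M; rewrite h /top /= -/(acc M); case=> _ [[_ ->]].
Qed.

Lemma Run_test A (i : A -> value) (b : test) (beta : A -> bool) t :
  (forall a r M, top M (VP (i a) r) -> teval M b = beta a) ->
  Run i (fun a => VN R (beta a)) t.
Proof.
move=> h.
have hc (n : nat) a r : runs (newN (NConst n) (SND ACC)) (VP (i a) r) (VP (VN R n) r) 64.
  by apply: (@newN_runs _ (NConst n) (SND ACC)); [repeat constructor| |path_rep].
apply: (@Run_const_time _ _ _ (If b (newN (NConst 1) (SND ACC)) (newN (NConst 0) (SND ACC))))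
  => a r.
apply: runs_if (h a r) _.
by case: (beta a); apply: hc.
Qed.

Lemma Run_leR A (x y : A -> R) t :
  Run (fun a => VP (VR (x a)) (VR (y a))) (fun a => VN R (x a <= y a)%R) t.
Proof.
apply: (@Run_test _ _ (RLe top_r1 top_r2)) => a r M.
by rewrite /top /= -/(acc M); case=> _ [[_ [[_ ->] [_ ->]]]].
Qed.

Lemma Run_leN A (x y : A -> nat) t :
  Run (fun a => VP (VN R (x a)) (VN R (y a))) (fun a => VN R (x a <= y a)) t.
Proof.
apply: (@Run_test _ _ (NLe (FST (FST (FST ACC))) (FST (SND (FST ACC))))) => a r M.
by rewrite /top /= -/(acc M); case=> _ [[_ [[_ ->] [_ ->]]]].
Qed.

Definition top_bit := NLe (NConst 1) (FST (FST ACC)).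

Lemma top_bitE (b : bool) (r : value) M : top M (VP (VN R b) r) -> teval M top_bit = b.
Proof. by rewrite /top /= -/(acc M); case=> _ [[_ ->] _]; case: b. Qed.

Definition dup := cons2 (FST ACC) ACC.

Lemma dup_runs' (v r : value) : runs dup (VP v r) (VP v (VP v r)) 100.
Proof.
by apply: runs_le; last (apply: cons2_runs; last reflexivity);
  [|repeat constructor..|path_rep|path_rep].
Qed.

Arguments dup_runs' : clear implicits.

(* The two branches only need to be correct on the arguments that reach them. *)
Lemma Run_if A (i o : A -> value) (b : A -> bool) tb t1 t2 :
  Run i (fun a => VN R (b a)) tb ->
  Run (fun a : {a | b a} => i (sval a)) (fun a => o (sval a)) (fun a => t1 (sval a)) ->
  Run (fun a : {a | ~~ b a} => i (sval a)) (fun a => o (sval a)) (fun a => t2 (sval a)) ->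
  Run i o (fun a => tb a + (if b a then t1 a else t2 a))%N.
Proof.
move=> [pb [Cb hb]] [p [C hp]] [q [D hq]].
exists (Seq dup (Seq pb (If top_bit (Seq drop p) (Seq drop q)))), (200 + Cb + C + D)%N => a r.
have H : runs (If top_bit (Seq drop p) (Seq drop q)) (VP (VN R (b a)) (VP (i a) r)) (VP (o a) r)
    (tcost top_bit + (5 + (C + D) * (if b a then t1 a else t2 a).+1)).
  apply: runs_if => [M tM|]; first exact: top_bitE tM.
  case: (boolP (b a)) => hba.
    apply: runs_le (runs_seq (drop_runs _ _) (hp (exist _ a hba) r)).
    by rewrite /=; nia.
  apply: runs_le (runs_seq (drop_runs _ _) (hq (exist _ a hba) r)).
  by rewrite /=; nia.
apply: runs_le (runs_seq (dup_runs' _ _) (runs_seq (hb _ _) H)).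
have -> : tcost top_bit = 6%N by [].
nia.
Qed.

(** The measure [mu] serves termination only; the time [T] is any solution of the recursive
    inequality and need not be related to [mu]. *)
Lemma Run_while A (i : A -> value) (b : A -> bool) (f F : A -> A) (mu : A -> nat)
    (tb tf T : A -> nat) :
  Run i (fun a => VN R (b a)) tb ->
  Run (fun a : {a | b a} => i (sval a)) (fun a => i (f (sval a))) (fun a => tf (sval a)) ->
  (forall a, b a -> (mu (f a) < mu a)%N) ->
  (forall a, F a = if b a then F (f a) else a) ->
  (forall a, (tb a + (if b a then tf a + T (f a) + 1 else 0) <= T a)%N) ->
  Run i (fun a => i (F a)) T.
Proof.
move=> [pb [Cb hb]] [p [C hrun]] hmu hF hT.
pose body := Seq drop (Seq p (Seq dup pb)).
exists (Seq dup (Seq pb (Seq (While top_bit body) drop))), (300 + Cb + (112 + C + Cb))%N => a r.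
set K := (112 + C + Cb)%N.
(* The loop is entered with the test already evaluated on the stack, so the first [tb a] is not
   charged to it. *)
suff H : runs (While top_bit body) (VP (VN R (b a)) (VP (i a) r))
   (VP (VN R false) (VP (i (F a)) r)) (7 + K * (T a - tb a)).
  apply: runs_le (runs_seq (dup_runs' _ _) (runs_seq (hb _ _) (runs_seq H (drop_runs _ _)))).
  by have := hT a; nia.
have [n] := ubnP (mu a); elim: n a => // n IH a ltn M tM.
have e := top_bitE tM.
have tct : tcost top_bit = 6%N by [].
rewrite hF; have := hT a.
case: ifPn => hba hTa; last first.
  rewrite (negbTE hba) in tM e.
  exists M, (tcost top_bit), 0%N; split; [by apply: ExecWhileFalse; rewrite e|exact: tM|rewrite ?tct; nia..].
have [M1 [t1 [s1 [e1 r1 l1 b1 c1]]]] :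
  exists M1 t1 s1, [/\ exec body M M1 t1 s1, top M1 (VP (VN R (b (f a))) (VP (i (f a)) r)),
    (t1 <= 105 + C * (tf a).+1 + Cb * (tb (f a)).+1)%N, (s1 <= hp M1 + 9)%N &
    (hp M <= hp M1 <= hp M + t1)%N].
  have := runs_seq (drop_runs _ _) (runs_seq (hrun (exist _ a hba) r) (runs_seq (dup_runs' _ _) (hb _ _))).
  move/(_ _ _ tM) => [M1 [t1 [s1 [? ? /= ? ? ?]]]]; exists M1, t1, s1; split=> //; lia.
have ltn' : (mu (f a) < n)%N by have := hmu _ hba; lia.
have [M2 [t2 [s2 [e2 r2 l2 b2 c2]]]] := IH _ ltn' _ r1.
exists M2, (tcost top_bit + t1 + t2)%N, (maxn s1 s2); split=> //; try lia.
  by apply: ExecWhileTrue e1 e2; rewrite e hba.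
rewrite tct; have := hT (f a); rewrite /K => hTf.
have {}hTf : (tb (f a) <= T (f a))%N by lia.
apply: (@leq_trans (7 + (112 + C + Cb) * (tf a + tb (f a) + 1 + (T (f a) - tb (f a))))%N).
  by rewrite mulnDr; nia.
by rewrite leq_add2l leq_mul2l; apply/orP; right; lia.
Qed.
End Run.

Class Enc (R : realType) (A : Type) := enc : A -> value R.
Arguments enc {R A _} _.

Section Encodings.
Variable R : realType.

#[export] Instance enc_nat : Enc R nat := @VN R.
#[export] Instance enc_bool : Enc R bool := fun b => VN R b.
#[export] Instance enc_real : Enc R R := @VR R.
#[export] Instance enc_prod A B (ea : Enc R A) (eb : Enc R B) : Enc R (A * B)%type :=
  fun p => VP (ea p.1) (eb p.2).

(** The empty case is a pair as well, so that the tag is always found in the first component. *)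
Definition nonev : value R := VP (VN R 0) (VN R 0).
Definition somev (v : value R) : value R := VP (VN R 1) v.

#[export] Instance enc_option A (ea : Enc R A) : Enc R (option A) :=
  fun o => if o is Some x then somev (ea x) else nonev.
#[export] Instance enc_seq A (ea : Enc R A) : Enc R (seq A) :=
  fix enc_seq s := if s is x :: s' then somev (VP (ea x) (enc_seq s')) else nonev.

Definition Comp A B (ea : Enc R A) (eb : Enc R B) (f : A -> B) (t : A -> nat) : Prop :=
  Run (fun a => ea a) (fun a => eb (f a)) t.

End Encodings.

Arguments Comp {R A B ea eb} f t.

(** A let that stays visible to the syntax-directed tactics below: the shared value is computed and
    charged once. [lcase] and [ocase] play the same part for pattern matching. *)
Definition bind A B (x : A) (f : A -> B) := f x.
Definition lcase A B (l : seq A) (x : B) (f : A -> seq A -> B) :=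
  if l is h :: t then f h t else x.
Definition ocase A B (o : option A) (x : B) (f : A -> B) :=
  if o is Some h then f h else x.

Definition unsome T (o : option T) : o -> T :=
  if o is Some x then fun _ => x else fun h => False_rect T (notF h).

Lemma unsomeK T (o : option T) (h : o) : o = Some (unsome h).
Proof. by case: o h. Qed.

Fixpoint fold_cost S X (f : S -> X -> S) (t : S -> X -> nat) (s : S) (l : seq X) : nat :=
  if l is x :: l' then (t s x + fold_cost f t (f s x) l').+1 else 0.

Section Combinators.
Variable R : realType.
Section Basic.
Context {A B C D : Type} {ea : Enc R A} {eb : Enc R B} {ec : Enc R C} {ed : Enc R D}.

Lemma Comp_le (f : A -> B) (t t' : A -> nat) k :
  (forall a, t a <= k * (t' a).+1)%N -> Comp f t -> Comp f t'.
Proof. exact: Run_le. Qed.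

Lemma Comp_eq (f g : A -> B) t : (forall a, f a = g a) -> Comp f t -> Comp g t.
Proof. by move=> h; apply: Run_ext => // a; rewrite h. Qed.

Lemma Comp_id : Comp (fun a : A => a) (fun=> 0).
Proof. exact: Run_id. Qed.

Lemma Comp_comp (f : A -> B) (g : B -> C) t1 t2 :
  Comp f t1 -> Comp g t2 -> Comp (fun a => g (f a)) (fun a => t1 a + t2 (f a))%N.
Proof. by move=> h1 h2; apply: Run_comp h1 (Run_sub f h2). Qed.

Lemma Comp_pair (f : A -> B) (g : A -> C) t1 t2 :
  Comp f t1 -> Comp g t2 -> Comp (fun a => (f a, g a)) (fun a => t1 a + t2 a)%N.
Proof. exact: Run_pair. Qed.

Lemma Comp_fst (f : A -> B * C) t : Comp f t -> Comp (fun a => (f a).1) t.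
Proof.
move=> h; apply: (@Run_le _ _ _ _ (fun a => t a + 0)%N _ 1); first by move=> a; lia.
by apply: Run_comp h _; apply: Run_fst.
Qed.

Lemma Comp_snd (f : A -> B * C) t : Comp f t -> Comp (fun a => (f a).2) t.
Proof.
move=> h; apply: (@Run_le _ _ _ _ (fun a => t a + 0)%N _ 1); first by move=> a; lia.
by apply: Run_comp h _; apply: Run_snd.
Qed.

End Basic.
Arguments Comp_le {A B ea eb f t t'} k _ _.

Section Derived.
Context {A B C D : Type} {ea : Enc R A} {eb : Enc R B} {ec : Enc R C} {ed : Enc R D}.

Lemma Comp_bind (f : A -> B) (g : A -> B -> C) t1 t2 :
  Comp f t1 -> Comp (fun p : A * B => g p.1 p.2) t2 ->
  Comp (fun a => bind (f a) (g a)) (fun a => t1 a + t2 (a, f a))%N.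
Proof. by move=> h1 h2; exact: (Comp_comp (Comp_pair (Comp_id (A := A)) h1) h2). Qed.

Lemma Comp_fun2 (g : B -> C -> D) (f1 : A -> B) (f2 : A -> C) t t1 t2 :
  Comp (fun p : B * C => g p.1 p.2) t -> Comp f1 t1 -> Comp f2 t2 ->
  Comp (fun a => g (f1 a) (f2 a)) (fun a => t1 a + t2 a + t (f1 a, f2 a))%N.
Proof. by move=> h h1 h2; exact: (Comp_comp (Comp_pair h1 h2) h). Qed.

Lemma Comp_fun3 (E : Type) (ee : Enc R E) (g : B -> C -> D -> E)
    (f1 : A -> B) (f2 : A -> C) (f3 : A -> D) t t1 t2 t3 :
  Comp (fun p : B * (C * D) => g p.1 p.2.1 p.2.2) t ->
  Comp f1 t1 -> Comp f2 t2 -> Comp f3 t3 ->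
  Comp (fun a => g (f1 a) (f2 a) (f3 a))
    (fun a => t1 a + (t2 a + t3 a) + t (f1 a, (f2 a, f3 a)))%N.
Proof.
move=> h h1 h2 h3.
exact: (Comp_comp (Comp_pair h1 (Comp_pair h2 h3)) h).
Qed.

Lemma Comp_if (b : A -> bool) (f g : A -> B) tb tf tg :
  Comp b tb -> Comp f tf -> Comp g tg ->
  Comp (fun a => if b a then f a else g a) (fun a => tb a + if b a then tf a else tg a)%N.
Proof.
move=> hb hf hg; apply: (Run_if hb).
- apply: Run_ext (Run_sub (fun a : {a | b a} => sval a) hf) => // -[a h] /=.
  by rewrite h.
- apply: Run_ext (Run_sub (fun a : {a | ~~ b a} => sval a) hg) => // -[a h] /=.
  by rewrite (negbTE h).
Qed.

(** One case analysis for all types coded by tagged pairs: the view [vw] exposes the payload of a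
    nonempty value. Options, lists and search trees are instances. *)
Lemma Comp_case (P : Type) (ep : Enc R P) (vw : B -> option P) (e : A -> B)
    (f : A -> C) (g : A * P -> C) te tf tg :
  (forall x, eb x = if vw x is Some p then somev (ep p) else nonev R) ->
  Comp e te -> Comp f tf -> Comp g tg ->
  Comp (fun a => if vw (e a) is Some p then g (a, p) else f a)
    (fun a => te a + if vw (e a) is Some p then tg (a, p) else tf a)%N.
Proof.
move=> hv he hf hg.
pose b a : bool := vw (e a).
pose pay a := if vw (e a) is Some p then ep p else VN R 0.
have ee a : eb (e a) = VP (VN R (b a)) (pay a).
  by rewrite hv /b /pay; case: (vw _).
have h1 : Run (fun a => ea a) (fun a => VP (ea a) (VP (VN R (b a)) (pay a))) (fun a => 0 + te a)%N.
  by apply: Run_pair (Run_id _ _) _; apply: Run_ext he.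
pose gc a := if vw (e a) is Some p then g (a, p) else f a.
pose tgc a := if vw (e a) is Some p then tg (a, p) else 0.
apply: (@Run_le _ _ _ _ (fun a => (0 + te a) + (0 + if b a then 0 + tgc a else 0 + tf a))%N _ 1).
  by move=> a; rewrite /b /tgc; case: (vw (e a)) => * /=; lia.
apply: (Run_comp h1); apply: Run_if.
- apply: (@Run_le _ _ _ _ (fun _ => 0 + 0)%N _ 1) => //.
  exact: Run_comp (Run_snd _ _ _) (Run_fst _ _ _).
- pose q (a : {a | b a}) : A * P := (sval a, unsome (svalP a)).
  have hq (a : {a | b a}) : vw (e (sval a)) = Some (unsome (svalP a)).
    exact: unsomeK.
  apply: Run_comp.
    instantiate (1 := fun a => VP (ea (sval a)) (pay (sval a))).
    apply: (@Run_le _ _ _ _ (fun _ => 0 + (0 + 0))%N _ 1) => //.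
    apply: Run_pair; first exact: Run_fst.
    exact: Run_comp (Run_snd _ _ _) (Run_snd _ _ _).
  apply: Run_ext (Run_le (C := 1) _ (Run_sub q hg)) => [a|a|a] /=.
  + by rewrite /pay hq.
  + by rewrite hq.
  + by rewrite /tgc hq mul1n; apply: leqnSn.
- apply: Run_comp; first exact: Run_fst.
  have hq (a : {a | ~~ b a}) : vw (e (sval a)) = None.
    by case: a => a /=; rewrite /b; case: (vw _).
  by apply: Run_ext (Run_sub (fun a : {a | ~~ b a} => sval a) hf) => // a /=; rewrite hq.
Qed.

Lemma Comp_nat (n : nat) : Comp (fun _ : A => n) (fun=> 0).
Proof. exact: Run_nat. Qed.
Lemma Comp_bool (b : bool) : Comp (fun _ : A => b) (fun=> 0).
Proof. exact: Run_nat. Qed.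
Lemma Comp_real (n : nat) : Comp (fun _ : A => n%:R%R : R) (fun=> 0).
Proof. exact: Run_real. Qed.
Lemma Comp_0 : Comp (fun _ : A => 0%R : R) (fun=> 0).
Proof. exact: (Comp_real 0). Qed.
Lemma Comp_1 : Comp (fun _ : A => 1%R : R) (fun=> 0).
Proof. exact: (Comp_real 1). Qed.

Lemma Comp_addn (f g : A -> nat) t1 t2 : Comp f t1 -> Comp g t2 ->
  Comp (fun a => f a + g a)%N (fun a => t1 a + t2 a + 0)%N.
Proof. move=> h1 h2; exact: Run_comp (Run_pair h1 h2) (Run_addn R f g (fun=> 0)). Qed.

Lemma Comp_leq (f g : A -> nat) t1 t2 : Comp f t1 -> Comp g t2 ->
  Comp (fun a => f a <= g a)%N (fun a => t1 a + t2 a + 0)%N.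
Proof. move=> h1 h2; exact: Run_comp (Run_pair h1 h2) (Run_leN R f g (fun=> 0)). Qed.

Lemma Comp_le_real (f g : A -> R) t1 t2 : Comp f t1 -> Comp g t2 ->
  Comp (fun a => f a <= g a)%R (fun a => t1 a + t2 a + 0)%N.
Proof. move=> h1 h2; exact: Run_comp (Run_pair h1 h2) (Run_leR f g (fun=> 0)). Qed.

Lemma Comp_addr (f g : A -> R) t1 t2 : Comp f t1 -> Comp g t2 ->
  Comp (fun a => f a + g a)%R (fun a => t1 a + t2 a + 0)%N.
Proof. move=> h1 h2; exact: Run_comp (Run_pair h1 h2) (@Run_rop2 _ RAdd _ _ f g (fun=> 0) (fun _ _ _ => erefl)). Qed.
Lemma Comp_subr (f g : A -> R) t1 t2 : Comp f t1 -> Comp g t2 ->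
  Comp (fun a => f a - g a)%R (fun a => t1 a + t2 a + 0)%N.
Proof. move=> h1 h2; exact: Run_comp (Run_pair h1 h2) (@Run_rop2 _ RSub (fun x y => x - y)%R _ _ _ _ (fun _ _ _ => erefl)). Qed.
Lemma Comp_mulr (f g : A -> R) t1 t2 : Comp f t1 -> Comp g t2 ->
  Comp (fun a => f a * g a)%R (fun a => t1 a + t2 a + 0)%N.
Proof. move=> h1 h2; exact: Run_comp (Run_pair h1 h2) (@Run_rop2 _ RMul _ _ f g (fun=> 0) (fun _ _ _ => erefl)). Qed.
Lemma Comp_divr (f g : A -> R) t1 t2 : Comp f t1 -> Comp g t2 ->
  Comp (fun a => f a / g a)%R (fun a => t1 a + t2 a + 0)%N.
Proof. move=> h1 h2; exact: Run_comp (Run_pair h1 h2) (@Run_rop2 _ RDiv (fun x y => x / y)%R _ _ _ _ (fun _ _ _ => erefl)). Qed.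
Lemma Comp_sqrt (f : A -> R) t1 : Comp f t1 ->
  Comp (fun a => Num.sqrt (f a)) (fun a => t1 a + 0)%N.
Proof. move=> h1; exact: Run_comp h1 (@Run_rop1 _ RSqrt _ _ f (fun=> 0) (fun _ _ => erefl)). Qed.

Lemma Comp_none : Comp (fun _ : A => None : option B) (fun=> 0).
Proof.
apply: (@Run_le _ _ _ _ (fun _ => 0 + 0)%N _ 1) => //.
by apply: Run_pair; apply: Run_nat.
Qed.
Lemma Comp_some (f : A -> B) t : Comp f t -> Comp (fun a => Some (f a)) (fun a => 0 + t a)%N.
Proof. by move=> h; apply: Run_pair h; apply: Run_nat. Qed.
Lemma Comp_nil : Comp (fun _ : A => [::] : seq B) (fun=> 0).
Proof.
apply: (@Run_le _ _ _ _ (fun _ => 0 + 0)%N _ 1) => //.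
by apply: Run_pair; apply: Run_nat.
Qed.
Lemma Comp_cons (f : A -> B) (g : A -> seq B) t1 t2 : Comp f t1 -> Comp g t2 ->
  Comp (fun a => f a :: g a) (fun a => 0 + (t1 a + t2 a))%N.
Proof. by move=> h1 h2; apply: Run_pair (Run_nat _ _ _) (Run_pair h1 h2). Qed.
End Derived.

Section Cases.
Context {A B C D : Type} {ea : Enc R A} {eb : Enc R B} {ec : Enc R C} {ed : Enc R D}.

Lemma Comp_ocase (e : A -> option B) (f : A -> C) (g : A -> B -> C) te tf tg :
  Comp e te -> Comp f tf -> Comp (fun p : A * B => g p.1 p.2) tg ->
  Comp (fun a => ocase (e a) (f a) (g a))
    (fun a => te a + ocase (e a) (tf a) (fun x => tg (a, x)))%N.
Proof.
move=> h1 h2 h3.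
by apply: (@Comp_case _ _ _ _ _ _ _ _ (fun x => x) e f (fun p => g p.1 p.2)) => // -[].
Qed.

Lemma Comp_lcase (e : A -> seq B) (f : A -> C) (g : A -> B -> seq B -> C) te tf tg :
  Comp e te -> Comp f tf -> Comp (fun p : A * (B * seq B) => g p.1 p.2.1 p.2.2) tg ->
  Comp (fun a => lcase (e a) (f a) (g a))
    (fun a => te a + lcase (e a) (tf a) (fun x l => tg (a, (x, l))))%N.
Proof.
move=> h1 h2 h3; pose vw (l : seq B) := if l is x :: l' then Some (x, l') else None.
have h := @Comp_case _ _ _ _ _ _ _ _ vw e f (fun p => g p.1 p.2.1 p.2.2) te tf tg _ h1 h2 h3.
have {h} := h (fun l => match l with [::] => erefl | _ :: _ => erefl end).
move=> h; apply: Comp_le 1 _ (Comp_eq _ h) => [|a].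
  by move=> a; rewrite /lcase /vw; case: (e a) => [|x l]; rewrite mul1n leqnSn.
by rewrite /lcase /vw; case: (e a).
Qed.
End Cases.

End Combinators.


(** * Functions computable in constant time, and the tactics that compile function bodies *)

Section ZeroCost.
Variable R : realType.
Context {A B C D : Type} {ea : Enc R A} {eb : Enc R B} {ec : Enc R C} {ed : Enc R D}.
Local Notation Comp0 f := (Comp f (fun=> 0)).

Lemma Comp0_pair (f : A -> B) (g : A -> C) : Comp0 f -> Comp0 g -> Comp0 (fun a => (f a, g a)).
Proof. exact: Comp_pair. Qed.
Lemma Comp0_cons (f : A -> B) (g : A -> seq B) : Comp0 f -> Comp0 g -> Comp0 (fun a => f a :: g a).
Proof. exact: Comp_cons. Qed.
Lemma Comp0_some (f : A -> B) : Comp0 f -> Comp0 (fun a => Some (f a)).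
Proof. exact: Comp_some. Qed.
Lemma Comp0_bind (f : A -> B) (g : A -> B -> C) :
  Comp0 f -> Comp0 (fun p : A * B => g p.1 p.2) -> Comp0 (fun a => bind (f a) (g a)).
Proof. exact: Comp_bind. Qed.
Lemma Comp0_fun2 (g : B -> C -> D) (f1 : A -> B) (f2 : A -> C) :
  Comp0 (fun p : B * C => g p.1 p.2) -> Comp0 f1 -> Comp0 f2 ->
  Comp0 (fun a => g (f1 a) (f2 a)).
Proof. exact: Comp_fun2. Qed.
Lemma Comp0_if (b : A -> bool) (f g : A -> B) :
  Comp0 b -> Comp0 f -> Comp0 g -> Comp0 (fun a => if b a then f a else g a).
Proof. by move=> h1 h2 h3; apply: Comp_le 1 _ (Comp_if h1 h2 h3) => a; case: (b a). Qed.
Lemma Comp0_ocase (e : A -> option B) (f : A -> C) (g : A -> B -> C) :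
  Comp0 e -> Comp0 f -> Comp0 (fun p : A * B => g p.1 p.2) ->
  Comp0 (fun a => ocase (e a) (f a) (g a)).
Proof. by move=> h1 h2 h3; apply: Comp_le 1 _ (Comp_ocase h1 h2 h3) => a; case: (e a). Qed.
Lemma Comp0_lcase (e : A -> seq B) (f : A -> C) (g : A -> B -> seq B -> C) :
  Comp0 e -> Comp0 f -> Comp0 (fun p : A * (B * seq B) => g p.1 p.2.1 p.2.2) ->
  Comp0 (fun a => lcase (e a) (f a) (g a)).
Proof. by move=> h1 h2 h3; apply: Comp_le 1 _ (Comp_lcase h1 h2 h3) => a; case: (e a). Qed.
Lemma Comp0_addn (f g : A -> nat) : Comp0 f -> Comp0 g -> Comp0 (fun a => f a + g a)%N.
Proof. exact: Comp_addn. Qed.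
Lemma Comp0_leq (f g : A -> nat) : Comp0 f -> Comp0 g -> Comp0 (fun a => f a <= g a)%N.
Proof. exact: Comp_leq. Qed.
Lemma Comp0_le_real (f g : A -> R) : Comp0 f -> Comp0 g -> Comp0 (fun a => f a <= g a)%R.
Proof. exact: Comp_le_real. Qed.
Lemma Comp0_addr (f g : A -> R) : Comp0 f -> Comp0 g -> Comp0 (fun a => f a + g a)%R.
Proof. exact: Comp_addr. Qed.
Lemma Comp0_subr (f g : A -> R) : Comp0 f -> Comp0 g -> Comp0 (fun a => f a - g a)%R.
Proof. exact: Comp_subr. Qed.
Lemma Comp0_mulr (f g : A -> R) : Comp0 f -> Comp0 g -> Comp0 (fun a => f a * g a)%R.
Proof. exact: Comp_mulr. Qed.
Lemma Comp0_divr (f g : A -> R) : Comp0 f -> Comp0 g -> Comp0 (fun a => f a / g a)%R.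
Proof. exact: Comp_divr. Qed.
Lemma Comp0_sqrt (f : A -> R) : Comp0 f -> Comp0 (fun a => Num.sqrt (f a)).
Proof. exact: Comp_sqrt. Qed.
End ZeroCost.

Arguments Comp_id {R A ea}.
Arguments Comp_nat {R A ea} n.
Arguments Comp_real {R A ea} n.
Arguments Comp_bool {R A ea} b.
Arguments Comp_nil {R A B ea eb}.

(** A hook of [comp0], redefined whenever constructors of a new data type become available. *)
Ltac comp0_user := fail.
Ltac comp0 :=
  lazy beta;
  lazymatch goal with
  | |- Comp (fun a => a) _ => eapply Comp_id
  | |- Comp fst _ => eapply Comp_fst; eapply Comp_id
  | |- Comp snd _ => eapply Comp_snd; eapply Comp_id
  | |- Comp (fun a => fst _) _ => eapply Comp_fst; comp0
  | |- Comp (fun a => snd _) _ => eapply Comp_snd; comp0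
  | |- Comp (fun a => (_, _)) _ => eapply Comp0_pair; [comp0|comp0]
  | |- Comp (fun a => bind _ _) _ => eapply Comp0_bind; [comp0|comp0]
  | |- Comp (fun a => ocase _ _ _) _ => eapply Comp0_ocase; [comp0|comp0|comp0]
  | |- Comp (fun a => lcase _ _ _) _ => eapply Comp0_lcase; [comp0|comp0|comp0]
  | |- Comp (fun a => None) _ => eapply Comp_none
  | |- Comp (fun a => Some _) _ => eapply Comp0_some; comp0
  | |- Comp (fun a => [::]) _ => eapply Comp_nil
  | |- Comp (fun a => _ :: _) _ => eapply Comp0_cons; [comp0|comp0]
  | |- Comp (fun a => true) _ => eapply Comp_bool
  | |- Comp (fun a => false) _ => eapply Comp_bool
  | |- Comp (fun a => 0%R) _ => eapply Comp_0
  | |- Comp (fun a => 1%R) _ => eapply Comp_1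
  | |- Comp (fun a => (_ + _)%N) _ => eapply Comp0_addn; [comp0|comp0]
  | |- Comp (fun a => (_ <= _)%N) _ => eapply Comp0_leq; [comp0|comp0]
  | |- Comp (fun a => (_ <= _)%R) _ => eapply Comp0_le_real; [comp0|comp0]
  | |- Comp (fun a => (_ - _)%R) _ => eapply Comp0_subr; [comp0|comp0]
  | |- Comp (fun a => (_ + _)%R) _ => eapply Comp0_addr; [comp0|comp0]
  | |- Comp (fun a => (_ / _)%R) _ => eapply Comp0_divr; [comp0|comp0]
  | |- Comp (fun a => (_ * _)%R) _ => eapply Comp0_mulr; [comp0|comp0]
  | |- Comp (fun a => Num.sqrt _) _ => eapply Comp0_sqrt; comp0
  | |- Comp (fun a => if _ then _ else _) _ => eapply Comp0_if; [comp0|comp0|comp0]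
  | h : Comp (fun q => ?f (fst q) (snd q)) _ |- Comp (fun a => ?f _ _) _ =>
      eapply (Comp0_fun2 h); [comp0|comp0]
  | |- _ => first [eapply Comp_nat | eapply Comp_real | comp0_user]
  end.

Ltac comp_user := fail.
Ltac comp :=
  lazy beta;
  first [solve [comp0] | lazymatch goal with
  | |- Comp (fun a => a) _ => eapply Comp_id
  | |- Comp fst _ => eapply Comp_fst; eapply Comp_id
  | |- Comp snd _ => eapply Comp_snd; eapply Comp_id
  | |- Comp (fun a => fst _) _ => eapply Comp_fst; comp
  | |- Comp (fun a => snd _) _ => eapply Comp_snd; comp
  | |- Comp (fun a => (_, _)) _ => eapply Comp_pair; [comp|comp]
  | |- Comp (fun a => bind _ _) _ => eapply Comp_bind; [comp|comp]
  | |- Comp (fun a => ocase _ _ _) _ => eapply Comp_ocase; [comp|comp|comp]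
  | |- Comp (fun a => lcase _ _ _) _ => eapply Comp_lcase; [comp|comp|comp]
  | |- Comp (fun a => None) _ => eapply Comp_none
  | |- Comp (fun a => Some _) _ => eapply Comp_some; comp
  | |- Comp (fun a => [::]) _ => eapply Comp_nil
  | |- Comp (fun a => _ :: _) _ => eapply Comp_cons; [comp|comp]
  | |- Comp (fun a => true) _ => eapply Comp_bool
  | |- Comp (fun a => false) _ => eapply Comp_bool
  | |- Comp (fun a => 0%R) _ => eapply Comp_0
  | |- Comp (fun a => 1%R) _ => eapply Comp_1
  | |- Comp (fun a => (_ + _)%N) _ => eapply Comp_addn; [comp|comp]
  | |- Comp (fun a => (_ <= _)%N) _ => eapply Comp_leq; [comp|comp]
  | |- Comp (fun a => (_ <= _)%R) _ => eapply Comp_le_real; [comp|comp]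
  | |- Comp (fun a => (_ - _)%R) _ => eapply Comp_subr; [comp|comp]
  | |- Comp (fun a => (_ + _)%R) _ => eapply Comp_addr; [comp|comp]
  | |- Comp (fun a => (_ / _)%R) _ => eapply Comp_divr; [comp|comp]
  | |- Comp (fun a => (_ * _)%R) _ => eapply Comp_mulr; [comp|comp]
  | |- Comp (fun a => Num.sqrt _) _ => eapply Comp_sqrt; comp
  | |- Comp (fun a => if _ then _ else _) _ => eapply Comp_if; [comp|comp|comp]
  | |- _ => first [eapply Comp_nat | eapply Comp_real | comp_user]
  end].

(** * While loops, folds and linear recursion *)

Section Loops.
Variable R : realType.

(** The number [n] only makes the definition structural: by [iterw_stable] every value above the
    measure gives the same result. *)
Fixpoint iterw A (b : A -> bool) (f : A -> A) n a :=
  if n is n'.+1 then if b a then iterw b f n' (f a) else a else a.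

Lemma iterw_stable A (b : A -> bool) f (mu : A -> nat) n n' a :
  (forall a, b a -> (mu (f a) < mu a)%N) ->
  (mu a < n)%N -> (mu a < n')%N -> iterw b f n a = iterw b f n' a.
Proof.
move=> hmu; elim: n n' a => [|n IH] [|n'] a //= h1 h2.
by case: ifP => // /hmu h; apply: IH; apply: leq_trans h _.
Qed.

Lemma iterwE A (b : A -> bool) f (mu : A -> nat) a :
  (forall a, b a -> (mu (f a) < mu a)%N) ->
  iterw b f (mu a).+1 a = if b a then iterw b f (mu (f a)).+1 (f a) else a.
Proof.
move=> hmu; rewrite [LHS]/=; case: ifP => // /hmu h; exact: (iterw_stable (mu := mu)).
Qed.

Section InnerLoops.
Context {A : Type} {ea : Enc R A}.

Lemma Comp_while (b : A -> bool) (f : A -> A) (mu : A -> nat) (tb tf T : A -> nat) :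
  Comp b tb -> Comp f tf ->
  (forall a, b a -> (mu (f a) < mu a)%N) ->
  (forall a, (tb a + (if b a then tf a + T (f a) + 1 else 0) <= T a)%N) ->
  Comp (fun a => iterw b f (mu a).+1 a) T.
Proof.
move=> h1 h2 h3 h4; apply: (Run_while h1 _ h3 _ h4).
- exact: (Run_sub (fun a : {a | b a} => sval a) h2).
- by move=> a; apply: iterwE.
Qed.

End InnerLoops.

Section Folds.
Context {A C S X : Type} {ea : Enc R A} {ec : Enc R C}
  {es : Enc R S} {ex : Enc R X}.

(** Functions are not values of the heap, so the data on which the step function depends are carried
    along as a component [C] of the loop state. *)
Lemma Comp_foldl_aux (f : C -> S -> X -> S) t :
  Comp (fun q : C * (S * X) => f q.1 q.2.1 q.2.2) t ->
  Comp (fun q : C * (S * seq X) => foldl (f q.1) q.2.1 q.2.2)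
    (fun q => fold_cost (f q.1) (fun s x => t (q.1, (s, x))) q.2.1 q.2.2).
Proof.
move=> h.
pose b (q : C * (S * seq X)) := lcase q.2.2 false (fun _ _ => true).
pose st (q : C * (S * seq X)) :=
  lcase q.2.2 q (fun x l => (q.1, (f q.1 q.2.1 x, l))).
pose T (q : C * (S * seq X)) := fold_cost (f q.1) (fun s x => t (q.1, (s, x))) q.2.1 q.2.2.
have hb : Comp b (fun _ => 0).
  rewrite /b; apply: Comp_le 1 _ _; last first. comp. by move=> q; rewrite /lcase; case: (q.2.2) => *; lia.
have hs : Comp st (fun q => lcase q.2.2 0 (fun x _ => t (q.1, (q.2.1, x)))).
  rewrite /st; apply: Comp_le 1 _ _; last first.
    eapply Comp_lcase; [comp|comp|].
    eapply Comp_pair; [comp|eapply Comp_pair; [|comp]].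
    by eapply (Comp_fun3 h); comp.
  by move=> q /=; case: (q.2.2) => *; rewrite /=; lia.
have hw : Comp (fun a => iterw b st (size a.2.2).+1 a) T.
  apply: (Comp_while (mu := fun q => size q.2.2) (T := T) hb hs) => -[c [s l]]; rewrite /b /st /T; case: l => [|x l] /=; lia.
apply: Comp_eq (Comp_fst (Comp_snd hw)) => -[c [s l]].
elim: l s => [|x l IH] s //=; rewrite -IH /=.
congr (_.2.1); apply: (iterw_stable (mu := fun q => size q.2.2)) => //.
Qed.

End Folds.

Section Folds2.
Context {A C S X : Type} {ea : Enc R A} {ec : Enc R C}
  {es : Enc R S} {ex : Enc R X}.

Lemma Comp_foldl (f : C -> S -> X -> S) t (c : A -> C) (s : A -> S) (l : A -> seq X) tc ts tl :
  Comp (fun q : C * (S * X) => f q.1 q.2.1 q.2.2) t ->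
  Comp c tc -> Comp s ts -> Comp l tl ->
  Comp (fun a => foldl (f (c a)) (s a) (l a))
    (fun a => tc a + (ts a + tl a) +
      fold_cost (f (c a)) (fun s x => t (c a, (s, x))) (s a) (l a))%N.
Proof.
move=> hf hc hs hl.
exact: (Comp_comp (Comp_pair hc (Comp_pair hs hl)) (Comp_foldl_aux hf)).
Qed.

End Folds2.

(* Linear recursion: the loop first descends, stacking the continuations, and
   then applies them in reverse. *)
Section LinearRecursion.
Context {X K Z : Type} {ex : Enc R X} {ek : Enc R K} {ez : Enc R Z}.
Variables (st : X -> option (X * K)) (bs : X -> Z) (cb : K -> Z -> Z).
Variables (F : X -> Z) (mu : X -> nat) (tst tbs T : X -> nat) (tcb : K -> Z -> nat).

Lemma Comp_linrec :
  Comp st tst -> Comp bs tbs -> Comp (fun p : K * Z => cb p.1 p.2) (fun p => tcb p.1 p.2) ->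
  (forall x x' k, st x = Some (x', k) -> (mu x' < mu x)%N) ->
  (forall x, F x = if st x is Some (x', k) then cb k (F x') else bs x) ->
  (forall x, (tst x + (if st x is Some (x', k) then tcb k (F x') + T x' + 1 else tbs x)
     <= T x)%N) ->
  Comp F T.
Proof.
move=> hst hbs hcb hmu hF hT.
pose b (q : X * seq K) := ocase (st q.1) false (fun=> true).
pose f (q : X * seq K) := ocase (st q.1) q (fun p => (p.1, p.2 :: q.2)).
have hb : Comp b (fun q => tst q.1).
  by rewrite /b; apply: Comp_le 1 _ _; last (eapply Comp_ocase;
    [eapply (Comp_comp (Comp_fst Comp_id) hst)|comp|comp]); move=> q /=; case: (st _) => *; rewrite /=; lia.
have hf : Comp f (fun q => tst q.1).
  by rewrite /f; apply: Comp_le 1 _ _; last (eapply Comp_ocase;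
    [eapply (Comp_comp (Comp_fst Comp_id) hst)|comp|comp]); move=> q /=; case: (st _) => *; rewrite /=; lia.
have hmu' q : b q -> (mu (f q).1 < mu q.1)%N.
  rewrite /b /f; case e : (st _) => [[x' k]|] //= _; exact: hmu e.
have hw : Comp (fun a => iterw b f (mu a.1).+1 a) (fun q => 3 * T q.1)%N.
  apply: (Comp_while (mu := fun q => mu q.1) hb hf hmu') => q.
  have := hT q.1; rewrite /b /f; case e : (st _) => [[x' k]|] //=; lia.
pose D x := iterw b f (mu x).+1 (x, [::]).
have hD : Comp D (fun x => 3 * T x)%N.
  apply: Comp_le 1 _ (Comp_comp (f := fun x => (x, [::])) (Comp_pair Comp_id Comp_nil) hw) => x /=; lia.
(* Applying the stacked continuations to the base value amounts to applying the older ones [ks] to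
   [F x]; the second conjunct charges the new continuations to [T x]. *)
have key x ks : let q := iterw b f (mu x).+1 (x, ks) in
  foldl (fun z k => cb k z) (bs q.1) q.2 = foldl (fun z k => cb k z) (F x) ks /\
  (tbs q.1 + fold_cost (fun z k => cb k z) (fun z k => tcb k z) (bs q.1) q.2 <=
   T x + fold_cost (fun z k => cb k z) (fun z k => tcb k z) (F x) ks)%N.
  have [n] := ubnP (mu x); elim: n x ks => // n IH x ks ltn.
  rewrite (iterwE (mu := fun q => mu q.1) (x, ks) hmu') /b /f /= hF.
  have := hT x; case e : (st x) => [[x' k]|] /= hx; last by split=> //; lia.
  have := IH x' (k :: ks) (leq_trans (hmu _ _ _ e) ltn).
  rewrite /b /f => -[-> h2]; split=> //.
  by apply: leq_trans h2 _ => /=; lia.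
have hfold : Comp (fun x => foldl (fun z k => cb k z) (bs (D x).1) (D x).2)
   (fun x => 3 * T x + (3 * T x + tbs (D x).1 + 3 * T x +
     fold_cost (fun z k => cb k z) (fun z k => tcb k z) (bs (D x).1) (D x).2))%N.
  have h' : Comp (fun q : X * (Z * K) => cb q.2.2 q.2.1) (fun q => tcb q.2.2 q.2.1).
    apply: Comp_le 1 _ _; last (eapply (Comp_fun2 hcb); comp).
    by move=> q /=; lia.
  apply: Comp_le 1 _ (Comp_foldl (f := fun _ z k => cb k z) h' Comp_id
    (Comp_comp (Comp_fst hD) hbs) (Comp_snd hD)) => x /=; lia.
apply: Comp_le 13 _ (Comp_eq _ hfold) => x.
  by have [_] := key x [::]; rewrite -/(D x) /=; lia.
by have [e _] := key x [::]; rewrite -/(D x) /= in e.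
Qed.

End LinearRecursion.
End Loops.

(** * AVL trees *)

Inductive tree (T : Type) := Lf | Nd of nat & tree T & T & tree T.
Arguments Lf {T}.

Definition tcase T B (t : tree T) (x : B) (f : nat -> tree T -> T -> tree T -> B) :=
  if t is Nd h l v r then f h l v r else x.

Section Avl.
Variable T : Type.
Implicit Types (t l r : tree T) (p : T -> bool).

Fixpoint elems t : seq T :=
  if t is Nd _ l v r then elems l ++ v :: elems r else [::].

(** The true height. The program reads the height stored in the root through [ht]; the two agree on
    AVL trees. *)
Fixpoint depth t : nat :=
  if t is Nd _ l v r then (maxn (depth l) (depth r)).+1 else 0.

Definition ht t := tcase t 0%N (fun h _ _ _ => h).

Definition mk l v r :=
  Nd (if ht l <= ht r then ht r + 1 else ht l + 1)%N l v r.

Definition bal l v r :=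
  if (ht r + 2 <= ht l)%N then
    tcase l (mk l v r) (fun _ ll lv lr =>
      if (ht lr <= ht ll)%N then mk ll lv (mk lr v r)
      else tcase lr (mk l v r) (fun _ lrl lrv lrr =>
             mk (mk ll lv lrl) lrv (mk lrr v r)))
  else if (ht l + 2 <= ht r)%N then
    tcase r (mk l v r) (fun _ rl rv rr =>
      if (ht rl <= ht rr)%N then mk (mk l v rl) rv rr
      else tcase rl (mk l v r) (fun _ rll rlv rlr =>
             mk (mk l v rll) rlv (mk rlr rv rr)))
  else mk l v r.

(** Positions are given by a predicate that holds on a prefix of the elements, not by a fixed
    comparison: the order of segments along the sweep line depends on the abscissa, which enters
    through [p]. *)
Fixpoint ins p x t : tree T :=
  if t is Nd _ l v r then
    if p v then bal l v (ins p x r) else bal (ins p x l) v r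
  else mk Lf x Lf.

Fixpoint popmin t : option (T * tree T) :=
  if t is Nd _ l v r then
    ocase (popmin l) (Some (v, r)) (fun q => Some (q.1, bal q.2 v r))
  else None.

Definition glue l r := ocase (popmin r) l (fun q => bal l q.1 q.2).

(* Deletes the first element on which p fails. *)
Fixpoint del p t : option (T * tree T) :=
  if t is Nd _ l v r then
    if p v then ocase (del p r) None (fun q => Some (q.1, bal l v q.2))
    else ocase (del p l) (Some (v, glue l r)) (fun q => Some (q.1, bal q.2 v r))
  else None.

Fixpoint last_sat p t : option T :=
  if t is Nd _ l v r then
    if p v then ocase (last_sat p r) (Some v) (fun m => Some m)
    else last_sat p l
  else None.

Fixpoint first_unsat p t : option T :=
  if t is Nd _ l v r then
    if p v then first_unsat p r
    else ocase (first_unsat p l) (Some v) (fun m => Some m)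
  else None.

Lemma elems_bal l v r : elems (bal l v r) = elems l ++ v :: elems r.
Proof.
rewrite /bal; case: ifP => _.
  case: l => [|h ll lv lr] //=; case: ifP => _ /=; rewrite -?catA //=.
  by case: lr => [|h' lrl lrv lrr] //=; rewrite -?catA //= -?catA.
case: ifP => _ //.
case: r => [|h rl rv rr] //=; case: ifP => _ /=; rewrite -?catA //=.
by case: rl => [|h' rll rlv rlr] //=; rewrite -?catA //= -?catA.
Qed.

Definition mono p (s : seq T) := pairwise (fun a b => p b ==> p a) s.

Lemma mono_cat p s v s' : mono p (s ++ v :: s') ->
  [/\ mono p s, mono p s', p v -> all p s & ~~ p v -> all (predC p) s'].
Proof.
rewrite /mono pairwise_cat /= => /and3P[h1 h2 /andP[h3 h4]]; split=> //.
- move=> pv; move: h1; rewrite allrel_consr => /andP[h _].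
  by apply: sub_all h => x /=; rewrite pv.
- move=> npv; apply: sub_all h3 => x /=.
  by rewrite (negbTE npv) implybF.
Qed.

Lemma mono_split p A B : all p A -> all (predC p) B -> mono p (A ++ B).
Proof.
elim: A => [_|a A IH /= /andP[pa hA] hB].
  rewrite /mono; elim: B => //= b B IH /andP[_ hB]; rewrite IH // andbT.
  by apply: sub_all hB => x /= /negbTE ->.
rewrite /mono /= -/(mono p (A ++ B)) IH // andbT.
by rewrite pa; elim: (A ++ B) => //= x s ->; rewrite implybT.
Qed.

Lemma filter_split p A B : all p A -> all (predC p) B ->
  (filter p (A ++ B) = A) * (filter (predC p) (A ++ B) = B).
Proof.
move=> hA hB; rewrite !filter_cat (all_filterP hA) (all_filterP hB).
have -> : filter p B = [::] by elim: B hB => //= b B IH /andP[/negbTE -> /IH].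
have -> : filter (predC p) A = [::].
  by elim: A hA => //= b A IH /andP[-> /IH].
by rewrite cats0.
Qed.

Lemma filter_node p (l : seq T) v (r : seq T) : mono p (l ++ v :: r) ->
  filter p (l ++ v :: r) = (if p v then l ++ v :: filter p r else filter p l) /\
  filter (predC p) (l ++ v :: r) =
    (if p v then filter (predC p) r else filter (predC p) l ++ v :: r).
Proof.
case/mono_cat => _ _ h1 h2; rewrite !filter_cat /=; case: ifP => pv.
  have [e1 e2] := filter_split (h1 pv) (isT : all (predC p) [::]).
  by rewrite cats0 in e1 e2; rewrite e1 e2.
have [e1 e2] := filter_split (isT : all p [::]) (h2 (negbT pv)).
by rewrite /= in e1 e2; rewrite e1 e2 cats0.
Qed.

Lemma elems_ins p x t : mono p (elems t) ->
  elems (ins p x t) = filter p (elems t) ++ x :: filter (predC p) (elems t).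
Proof.
elim: t => //= h l IHl v r IHr m; have [hl hr _ _] := mono_cat m.
have [-> ->] := filter_node m.
by case: ifP => pv; rewrite elems_bal ?IHl ?IHr // -catA.
Qed.

Lemma elems_popmin t :
  if popmin t is Some (m, t') then elems t = m :: elems t' else elems t = [::].
Proof.
elim: t => //= h l IHl v r _; case: (popmin l) IHl => [[m l']|] /= ->.
  by rewrite elems_bal.
by [].
Qed.

Lemma elems_glue l r : elems (glue l r) = elems l ++ elems r.
Proof.
rewrite /glue; have := elems_popmin r; case: (popmin r) => [[m r']|] /= ->.
  by rewrite elems_bal.
by rewrite cats0.
Qed.

Lemma elems_del p t : mono p (elems t) ->
  if del p t is Some (m, t') then
    exists B, filter (predC p) (elems t) = m :: B /\ elems t' = filter p (elems t) ++ B
  else filter (predC p) (elems t) = [::].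
Proof.
elim: t => //= h l IHl v r IHr m; have [hl hr hv hv'] := mono_cat m.
have [-> ->] := filter_node m; case: ifP => pv.
  have := IHr hr; case: (del p r) => [[x r']|] //= [B [-> e]].
  by exists B; rewrite elems_bal e -catA.
have := IHl hl; case: (del p l) => [[x l']|] /=.
  by move=> [B [-> e]]; exists (B ++ v :: elems r); rewrite elems_bal e -catA.
move=> e; rewrite e /=; exists (elems r); split=> //.
rewrite elems_glue; congr (_ ++ _).
by elim: (elems l) e => //= a s IH; case: (p a) => //= /IH {1}->.
Qed.

Lemma last_satE p t : mono p (elems t) ->
  last_sat p t = ohead (rev (filter p (elems t))).
Proof.
elim: t => //= h l IHl v r IHr m; have [hl hr hv hv'] := mono_cat m.
have [-> _] := filter_node m; case: ifP => pv; last by rewrite IHl.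
rewrite IHr // rev_cat rev_cons.
by case: (rev (filter p (elems r))).
Qed.

Lemma first_unsatE p t : mono p (elems t) ->
  first_unsat p t = ohead (filter (predC p) (elems t)).
Proof.
elim: t => //= h l IHl v r IHr m; have [hl hr hv hv'] := mono_cat m.
have [_ ->] := filter_node m; case: ifP => pv; first by rewrite IHr.
by rewrite IHl //; case: (filter _ (elems l)).
Qed.

Section Split.
Variables (p : T -> bool) (t : tree T) (A B : seq T).
Hypotheses (tE : elems t = A ++ B) (pA : all p A) (pB : all (predC p) B).

Lemma split_mono : mono p (elems t).
Proof. by rewrite tE; apply: mono_split. Qed.

Lemma ins_split x : elems (ins p x t) = A ++ x :: B.
Proof. by rewrite elems_ins ?split_mono // tE !(filter_split pA pB). Qed.

Lemma last_sat_split : last_sat p t = ohead (rev A).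
Proof. by rewrite last_satE ?split_mono // tE !(filter_split pA pB). Qed.

Lemma first_unsat_split : first_unsat p t = ohead B.
Proof. by rewrite first_unsatE ?split_mono // tE !(filter_split pA pB). Qed.

Lemma del_split x B' : B = x :: B' ->
  exists2 t', del p t = Some (x, t') & elems t' = A ++ B'.
Proof.
move=> e; have := elems_del split_mono; rewrite tE !(filter_split pA pB) e.
case: (del p t) => [[m t']|] // [B'' [[<- <-] h]].
by exists t'.
Qed.
End Split.

Fixpoint avl t : bool :=
  if t is Nd h l _ r then
    [&& avl l, avl r, h == depth t, depth l <= (depth r).+1 & depth r <= (depth l).+1]%N
  else true.

Lemma avl_ht t : avl t -> ht t = depth t.
Proof. by case: t => //= h l v r /and5P[_ _ /eqP]. Qed.

Lemma mk_avl l v r : avl l -> avl r -> (depth l <= (depth r).+1)%N ->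
  (depth r <= (depth l).+1)%N -> avl (mk l v r) /\ depth (mk l v r) = (maxn (depth l) (depth r)).+1.
Proof.
move=> al ar h1 h2; rewrite /= al ar !avl_ht // h1 h2 !andbT; split=> //.
by apply/eqP; case: ifP; lia.
Qed.

(** A rotation may keep the larger depth of the two subtrees or add one level, but without imbalance
    a level is always added. Both facts are used to show that an insertion or deletion changes the
    depth by at most one. *)
Lemma bal_avl l v r : avl l -> avl r -> (depth l <= (depth r).+2)%N ->
  (depth r <= (depth l).+2)%N ->
  [/\ avl (bal l v r), (maxn (depth l) (depth r) <= depth (bal l v r) <= (maxn (depth l) (depth r)).+1)%N &
    (depth l <= (depth r).+1)%N -> (depth r <= (depth l).+1)%N ->
    depth (bal l v r) = (maxn (depth l) (depth r)).+1].
Proof.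
move=> al ar h1 h2; rewrite /bal !avl_ht //; case: ifP => h3.
  case: l al h1 h2 h3 => [|h ll lv lr] /=; first by move=> *; lia.
  move=> /and5P[a1 a2 _ a3 a4] h1 h2 h3; rewrite !avl_ht //; case: ifP => h4.
    have [b1 e1] : avl (mk lr v r) /\ depth (mk lr v r) = (maxn (depth lr) (depth r)).+1.
      by apply: mk_avl => //; lia.
    have [b2 e2] : avl (mk ll lv (mk lr v r)) /\
       depth (mk ll lv (mk lr v r)) = (maxn (depth ll) (depth (mk lr v r))).+1.
      by apply: mk_avl => //; lia.
    by split=> //; lia.
  case: lr a2 a3 a4 h1 h2 h3 h4 => [|h' lrl lrv lrr] /=; first by move=> *; lia.
  move=> /and5P[a21 a22 _ a23 a24] a3 a4 h1 h2 h3 h4.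
  have [b1 e1] : avl (mk ll lv lrl) /\ depth (mk ll lv lrl) = (maxn (depth ll) (depth lrl)).+1.
    by apply: mk_avl => //; lia.
  have [b2 e2] : avl (mk lrr v r) /\ depth (mk lrr v r) = (maxn (depth lrr) (depth r)).+1.
    by apply: mk_avl => //; lia.
  have [b3 e3] := @mk_avl (mk ll lv lrl) lrv (mk lrr v r) b1 b2 ltac:(lia) ltac:(lia).
  by split=> //; lia.
case: ifP => h4.
  case: r ar h1 h2 h3 h4 => [|h rl rv rr] /=; first by move=> *; lia.
  move=> /and5P[a1 a2 _ a3 a4] h1 h2 h3 h5; rewrite !avl_ht //; case: ifP => h4.
    have [b1 e1] : avl (mk l v rl) /\ depth (mk l v rl) = (maxn (depth l) (depth rl)).+1.
      by apply: mk_avl => //; lia.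
    have [b2 e2] := @mk_avl (mk l v rl) rv rr b1 a2 ltac:(lia) ltac:(lia).
    by split=> //; lia.
  case: rl a1 a3 a4 h1 h2 h3 h4 h5 => [|h' rll rlv rlr] /=; first by move=> *; lia.
  move=> /and5P[a21 a22 _ a23 a24] a3 a4 h1 h2 h3 h4 h5.
  have [b1 e1] : avl (mk l v rll) /\ depth (mk l v rll) = (maxn (depth l) (depth rll)).+1.
    by apply: mk_avl => //; lia.
  have [b2 e2] : avl (mk rlr rv rr) /\ depth (mk rlr rv rr) = (maxn (depth rlr) (depth rr)).+1.
    by apply: mk_avl => //; lia.
  have [b3 e3] := @mk_avl (mk l v rll) rlv (mk rlr rv rr) b1 b2 ltac:(lia) ltac:(lia).
  by split=> //; lia.
have [b e] := @mk_avl l v r al ar ltac:(lia) ltac:(lia).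
by split=> //; lia.
Qed.

Lemma ins_avl p x t : avl t ->
  avl (ins p x t) /\ (depth t <= depth (ins p x t) <= (depth t).+1)%N.
Proof.
elim: t => //= h l IHl v r IHr /and5P[al ar _ h1 h2].
have [il dl] := IHl al; have [ir dr] := IHr ar.
case: ifP => _.
  have [? ? h3] := @bal_avl l v _ al ir ltac:(lia) ltac:(lia).
  split=> //; case: (leqP (depth (ins p x r)) (depth l).+1) => c; [have := h3 ltac:(lia) c|]; lia.
have [? ? h3] := @bal_avl _ v r il ar ltac:(lia) ltac:(lia).
split=> //; case: (leqP (depth (ins p x l)) (depth r).+1) => c; [have := h3 c ltac:(lia)|]; lia.
Qed.

Lemma popmin_avl t m t' : avl t -> popmin t = Some (m, t') ->
  avl t' /\ (depth t' <= depth t <= (depth t').+1)%N.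
Proof.
elim: t m t' => //= h l IHl v r _ m t' /and5P[al ar _ h1 h2].
case e : (popmin l) => [[m' l']|] /= [_ <-].
  have [al' d] := IHl _ _ al e.
  have [? ? h3] := @bal_avl l' v r al' ar ltac:(lia) ltac:(lia).
  split=> //; case: (leqP (depth r) (depth l').+1) => c; [have := h3 ltac:(lia) c|]; lia.
by case: l e al h1 h2 {IHl} => [|h' ll lv lr] /=; [move=> *; split=> //; lia|case: (popmin ll)].
Qed.

Lemma glue_avl l r : avl l -> avl r -> (depth l <= (depth r).+1)%N ->
  (depth r <= (depth l).+1)%N -> avl (glue l r) /\
  (depth (glue l r) <= (maxn (depth l) (depth r)).+1 <= (depth (glue l r)).+1)%N.
Proof.
move=> al ar h1 h2; rewrite /glue; case e : (popmin r) => [[m r']|] /=.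
  have [ar' d] := popmin_avl ar e.
  have [? ? h3] := @bal_avl l m r' al ar' ltac:(lia) ltac:(lia).
  split=> //; case: (leqP (depth l) (depth r').+1) => c; [have := h3 c ltac:(lia)|]; lia.
case: r ar e h1 h2 => [|h' rl rv rr] /= _; last by case: (popmin rl).
by move=> *; split=> //; lia.
Qed.

Lemma del_avl p t m t' : avl t -> del p t = Some (m, t') ->
  avl t' /\ (depth t' <= depth t <= (depth t').+1)%N.
Proof.
elim: t m t' => //= h l IHl v r IHr m t' /and5P[al ar _ h1 h2].
case: ifP => _.
  case e : (del p r) => [[m' r']|] //= [_ <-].
  have [ar' d] := IHr _ _ ar e.
  have [? ? h3] := @bal_avl l v r' al ar' ltac:(lia) ltac:(lia).
  split=> //; case: (leqP (depth l) (depth r').+1) => c; [have := h3 c ltac:(lia)|]; lia.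
case e : (del p l) => [[m' l']|] //= [_ <-].
  have [al' d] := IHl _ _ al e.
  have [? ? h3] := @bal_avl l' v r al' ar ltac:(lia) ltac:(lia).
  split=> //; case: (leqP (depth r) (depth l').+1) => c; [have := h3 ltac:(lia) c|]; lia.
have [? ?] := glue_avl al ar h1 h2; split=> //; lia.
Qed.

(** Both subtrees are at most two levels shallower than the tree, so two levels at least double the
    number of leaves. This is cruder than the Fibonacci bound but still logarithmic. *)
Lemma avl_size t : avl t -> (2 ^ (depth t)./2 <= (size (elems t)).+1)%N.
Proof.
have [n] := ubnP (depth t); elim: n t => // n IH [|h l v r] //= ltn.
case/and5P=> al ar _ h1 h2; rewrite size_cat /=.
have hl := IH l ltac:(lia) al; have hr := IH r ltac:(lia) ar.
case: (posnP (maxn (depth l) (depth r))) => [->|c]; first by rewrite /=; lia.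
have e : uphalf (maxn (depth l) (depth r)) = (maxn (depth l) (depth r)).-1./2.+1 by rewrite uphalfE; lia.
rewrite e expnS.
have : (2 ^ (maxn (depth l) (depth r)).-1./2 <= (size (elems l)).+1)%N.
  by apply: leq_trans hl; rewrite leq_exp2l //; lia.
have : (2 ^ (maxn (depth l) (depth r)).-1./2 <= (size (elems r)).+1)%N.
  by apply: leq_trans hr; rewrite leq_exp2l //; lia.
lia.
Qed.

Lemma avl_depth t : avl t -> (depth t <= 2 * trunc_log 2 (size (elems t)).+1 + 1)%N.
Proof.
move=> /avl_size h.
have : ((depth t)./2 <= trunc_log 2 (size (elems t)).+1)%N by apply: trunc_log_max.
lia.
Qed.

End Avl.

#[export] Instance enc_tree (R : realType) T (et : Enc R T) : Enc R (tree T) :=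
  fix enc_tree t := if t is Nd h l v r then
    somev (VP (VN R h) (VP (enc_tree l) (VP (et v) (enc_tree r)))) else nonev R.

(** * Running times of the tree operations *)

Section AvlCost.
Variable R : realType.

Lemma Comp_tcase A T B (ea : Enc R A) (et : Enc R T) (eb : Enc R B)
    (e : A -> tree T) (f : A -> B) (g : A -> nat -> tree T -> T -> tree T -> B) te tf tg :
  Comp e te -> Comp f tf ->
  Comp (fun p : A * (nat * (tree T * (T * tree T))) =>
     g p.1 p.2.1 p.2.2.1 p.2.2.2.1 p.2.2.2.2) tg ->
  Comp (fun a => tcase (e a) (f a) (g a))
    (fun a => te a + tcase (e a) (tf a) (fun h l v r => tg (a, (h, (l, (v, r))))))%N.
Proof.
move=> h1 h2 h3.
pose vw (t : tree T) := if t is Nd h l v r then Some (h, (l, (v, r))) else None.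
have h := @Comp_case _ _ _ _ _ _ _ _ _ vw e f
  (fun p => g p.1 p.2.1 p.2.2.1 p.2.2.2.1 p.2.2.2.2) te tf tg _ h1 h2 h3.
have {}h := h (fun t => match t with Lf => erefl | Nd _ _ _ _ => erefl end).
apply: Comp_le 1 _ (Comp_eq _ h) => a.
  by rewrite /tcase /vw; case: (e a) => *; rewrite mul1n leqnSn.
by rewrite /tcase /vw; case: (e a).
Qed.

Lemma Comp0_tcase A T B (ea : Enc R A) (et : Enc R T) (eb : Enc R B)
    (e : A -> tree T) (f : A -> B) (g : A -> nat -> tree T -> T -> tree T -> B) :
  Comp e (fun=> 0) -> Comp f (fun=> 0) ->
  Comp (fun p : A * (nat * (tree T * (T * tree T))) =>
     g p.1 p.2.1 p.2.2.1 p.2.2.2.1 p.2.2.2.2) (fun=> 0) ->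
  Comp (fun a => tcase (e a) (f a) (g a)) (fun=> 0).
Proof. by move=> h1 h2 h3; apply: Comp_le 1 _ (Comp_tcase h1 h2 h3) => a; case: (e a). Qed.

Lemma Comp_Lf A T (ea : Enc R A) (et : Enc R T) : Comp (fun _ : A => @Lf T) (fun=> 0).
Proof. exact: Comp_none. Qed.

Lemma Comp_Nd A T (ea : Enc R A) (et : Enc R T) (h : A -> nat) (l r : A -> tree T) (v : A -> T) th tl tv tr :
  Comp h th -> Comp l tl -> Comp v tv -> Comp r tr ->
  Comp (fun a => Nd (h a) (l a) (v a) (r a)) (fun a => 0 + (th a + (tl a + (tv a + tr a))))%N.
Proof. by move=> h1 h2 h3 h4; apply: Comp_some (Comp_pair h1 (Comp_pair h2 (Comp_pair h3 h4))). Qed.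

Lemma Comp0_Nd A T (ea : Enc R A) (et : Enc R T) (h : A -> nat) (l r : A -> tree T) (v : A -> T) :
  Comp h (fun=> 0) -> Comp l (fun=> 0) -> Comp v (fun=> 0) -> Comp r (fun=> 0) ->
  Comp (fun a => Nd (h a) (l a) (v a) (r a)) (fun=> 0).
Proof. exact: Comp_Nd. Qed.
End AvlCost.

Ltac comp0_user ::=
  lazymatch goal with
  | |- Comp (fun a => tcase _ _ _) _ => eapply Comp0_tcase; [comp0|comp0|comp0]
  | |- Comp (fun a => Lf) _ => eapply Comp_Lf
  | |- Comp (fun a => Nd _ _ _ _) _ => eapply Comp0_Nd; [comp0|comp0|comp0|comp0]
  | |- Comp (@ht _) _ => rewrite /ht; comp0
  | |- Comp (fun a => ht _) _ => rewrite /ht; comp0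
  | |- Comp (fun a => mk _ _ _) _ => rewrite /mk; comp0
  end.

Ltac comp_user ::=
  lazymatch goal with
  | |- Comp (fun a => tcase _ _ _) _ => eapply Comp_tcase; [comp|comp|comp]
  end.

Section AvlCost2.
Variable R : realType.
Context {T : Type} {et : Enc R T}.

Lemma Comp_bal_aux : Comp (fun q : tree T * (T * tree T) => bal q.1 q.2.1 q.2.2) (fun=> 0).
Proof. by rewrite /bal; comp0. Qed.

Context {A : Type} {ea : Enc R A}.
Implicit Types (l r : A -> tree T) (v : A -> T).

Lemma Comp_bal l r v tl tv tr : Comp l tl -> Comp v tv -> Comp r tr ->
  Comp (fun a => bal (l a) (v a) (r a)) (fun a => tl a + (tv a + tr a) + 0)%N.
Proof. by move=> h1 h2 h3; apply: (Comp_fun3 Comp_bal_aux). Qed.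

Lemma Comp0_bal l r v : Comp l (fun=> 0) -> Comp v (fun=> 0) -> Comp r (fun=> 0) ->
  Comp (fun a => bal (l a) (v a) (r a)) (fun=> 0).
Proof. exact: Comp_bal. Qed.

End AvlCost2.

Ltac comp0_user ::=
  lazymatch goal with
  | |- Comp (fun a => tcase _ _ _) _ => eapply Comp0_tcase; [comp0|comp0|comp0]
  | |- Comp (fun a => Lf) _ => eapply Comp_Lf
  | |- Comp (fun a => Nd _ _ _ _) _ => eapply Comp0_Nd; [comp0|comp0|comp0|comp0]
  | |- Comp (@ht _) _ => rewrite /ht; comp0
  | |- Comp (fun a => ht _) _ => rewrite /ht; comp0
  | |- Comp (fun a => mk _ _ _) _ => rewrite /mk; comp0
  | |- Comp (fun a => bal _ _ _) _ => eapply Comp0_bal; [comp0|comp0|comp0]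
  end.

Section AvlCost3.
Variable R : realType.
Context {T C : Type} {et : Enc R T} {ec : Enc R C}.
Variable P : C -> T -> bool.
Hypothesis hP : Comp (fun q : C * T => P q.1 q.2) (fun=> 0).

(** Linear recursion along the search path; a continuation records the side taken, the element of
    the node and the untouched subtree. *)
Lemma Comp_ins_aux :
  Comp (fun q : C * (T * tree T) => ins (P q.1) q.2.1 q.2.2) (fun q => depth q.2.2 * 2 + 1)%N.
Proof.
pose st (q : C * (T * tree T)) := tcase q.2.2 None (fun h l v r =>
  if P q.1 v then Some ((q.1, (q.2.1, r)), (true, (v, l)))
  else Some ((q.1, (q.2.1, l)), (false, (v, r)))).
pose cb (k : bool * (T * tree T)) (z : tree T) :=
  if k.1 then bal k.2.2 k.2.1 z else bal z k.2.1 k.2.2.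
have hst : Comp st (fun=> 0) by rewrite /st; comp0.
have hbs : Comp (fun q : C * (T * tree T) => mk Lf q.2.1 Lf) (fun=> 0) by comp0.
have hcb : Comp (fun p => cb p.1 p.2) (fun=> 0) by rewrite /cb; comp0.
apply: (Comp_linrec (mu := fun q => depth q.2.2) (tcb := fun _ _ => 0%N) hst hbs hcb)
  => [[c [x t]] y k|[c [x t]]|[c [x t]]]; rewrite /st /cb; case: t => [|h l v r] //=;
  case: (P c v) => //=; first [move=> [<- _] /=; lia|lia].
Qed.

Lemma Comp_popmin_aux : Comp (@popmin T) (fun t => depth t * 2 + 1)%N.
Proof.
pose st (t : tree T) := tcase t None (fun h l v r => Some (l, (v, r))).
pose cb (k : T * tree T) (z : option (T * tree T)) :=
  ocase z (Some (k.1, k.2)) (fun q => Some (q.1, bal q.2 k.1 k.2)).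
have hst : Comp st (fun=> 0) by rewrite /st; comp0.
have hbs : Comp (fun q : tree T => None : option (T * tree T)) (fun=> 0) by comp0.
have hcb : Comp (fun p => cb p.1 p.2) (fun=> 0) by rewrite /cb; comp0.
apply: (Comp_linrec (mu := @depth T) (tcb := fun _ _ => 0%N) hst hbs hcb)
  => [t y k|t|t]; rewrite /st /cb; case: t => [|h l v r] //=;
  first [move=> [<- _] /=; lia|lia].
Qed.

Lemma Comp_glue_aux : Comp (fun q : tree T * tree T => glue q.1 q.2) (fun q => depth q.2 * 2 + 1)%N.
Proof.
have h : Comp (fun q : tree T * tree T => q.2) (fun=> 0) by comp0.
rewrite /glue; apply: Comp_le 2 _ _; last first.
  by eapply Comp_ocase; [eapply (Comp_comp h Comp_popmin_aux)|comp|comp].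
by move=> q /=; case: (popmin _) => * /=; lia.
Qed.

Lemma Comp_last_sat_aux :
  Comp (fun q : C * tree T => last_sat (P q.1) q.2) (fun q => depth q.2 * 2 + 1)%N.
Proof.
pose st (q : C * tree T) := tcase q.2 None (fun h l v r =>
  if P q.1 v then Some ((q.1, r), Some v) else Some ((q.1, l), None)).
pose cb (k z : option T) := ocase z k (fun m => Some m).
have hst : Comp st (fun=> 0) by rewrite /st; comp0.
have hbs : Comp (fun q : C * tree T => None : option T) (fun=> 0) by comp0.
have hcb : Comp (fun p => cb p.1 p.2) (fun=> 0) by rewrite /cb; comp0.
apply: (Comp_linrec (mu := fun q => depth q.2) (tcb := fun _ _ => 0%N) hst hbs hcb)
  => [[c t] y k|[c t]|[c t]]; rewrite /st /cb; case: t => [|h l v r] //=;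
  case: (P c v) => //=; first [move=> [<- _] /=; lia|lia|by case: (last_sat _ _)].
Qed.

Lemma Comp_first_unsat_aux :
  Comp (fun q : C * tree T => first_unsat (P q.1) q.2) (fun q => depth q.2 * 2 + 1)%N.
Proof.
pose st (q : C * tree T) := tcase q.2 None (fun h l v r =>
  if P q.1 v then Some ((q.1, r), None) else Some ((q.1, l), Some v)).
pose cb (k z : option T) := ocase z k (fun m => Some m).
have hst : Comp st (fun=> 0) by rewrite /st; comp0.
have hbs : Comp (fun q : C * tree T => None : option T) (fun=> 0) by comp0.
have hcb : Comp (fun p => cb p.1 p.2) (fun=> 0) by rewrite /cb; comp0.
apply: (Comp_linrec (mu := fun q => depth q.2) (tcb := fun _ _ => 0%N) hst hbs hcb)
  => [[c t] y k|[c t]|[c t]]; rewrite /st /cb; case: t => [|h l v r] //=;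
  case: (P c v) => //=; first [move=> [<- _] /=; lia|lia|by case: (first_unsat _ _)].
Qed.

Lemma Comp_del_aux :
  Comp (fun q : C * tree T => del (P q.1) q.2) (fun q => depth q.2 * 6 + 1)%N.
Proof.
pose st (q : C * tree T) := tcase q.2 None (fun h l v r =>
  if P q.1 v then Some ((q.1, r), (true, (l, (v, r)))) else Some ((q.1, l), (false, (l, (v, r))))).
pose cb (k : bool * (tree T * (T * tree T))) (z : option (T * tree T)) :=
  if k.1 then ocase z None (fun q => Some (q.1, bal k.2.1 k.2.2.1 q.2))
  else ocase z (Some (k.2.2.1, glue k.2.1 k.2.2.2)) (fun q => Some (q.1, bal q.2 k.2.2.1 k.2.2.2)).
pose tcb (k : bool * (tree T * (T * tree T))) (z : option (T * tree T)) :=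
  if k.1 then 0%N else ocase z (depth k.2.2.2 * 2 + 1)%N (fun=> 0%N).
have hst : Comp st (fun=> 0) by rewrite /st; comp0.
have hbs : Comp (fun q : C * tree T => None : option (T * tree T)) (fun=> 0) by comp0.
have hcb : Comp (fun p => cb p.1 p.2) (fun p => tcb p.1 p.2).
  rewrite /cb; apply: Comp_le 1 _ _; last first.
    eapply Comp_if; [comp|comp|eapply Comp_ocase; [comp| |comp]].
    eapply Comp_some; eapply Comp_pair; [comp|].
    by eapply (Comp_fun2 Comp_glue_aux); comp.
  move=> [[k1 [l [v r]]] z] /=; rewrite /tcb /=; case: k1 => /=; case: z => //= *; lia.
(* Subtrees are glued at most once, at the deepest node whose left search fails. Charging failed
   searches less than successful ones keeps the total linear in the depth. *)
pose cost (q : C * tree T) := (depth q.2 * 4 +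
  if del (P q.1) q.2 is Some _ then depth q.2 * 2 + 1 else 1)%N.
have h : Comp (fun q : C * tree T => del (P q.1) q.2) cost; last first.
  apply: Comp_le 1 _ h => q; rewrite /cost; case: (del _ _) => *; lia.
apply: (Comp_linrec (mu := fun q => depth q.2) (tcb := tcb) hst hbs hcb)
  => [[c t] y k|[c t]|[c t]]; rewrite /st /cb /tcb /cost; case: t => [|h l v r] //=;
  case: (P c v) => //=; try (move=> [<- _] /=; lia).
- by case: (del _ r) => //= *; lia.
- by case: (del _ l) => //= *; lia.
Qed.

End AvlCost3.

(* These bounds hold for all trees, so that running times can be bounded
   without knowing that the trees are balanced. *)
Section Depth.
Variable T : Type.
Implicit Types (t l r : tree T).

Lemma depth_bal l v r : (depth (bal l v r) <= (maxn (depth l) (depth r)).+2)%N.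
Proof.
rewrite /bal; case: ifP => _.
  case: l => [|h ll lv lr] /=; first lia.
  by case: ifP => _ /=; last case: lr => [|h' lrl lrv lrr] /=; lia.
case: ifP => _ /=; last lia.
case: r => [|h rl rv rr] /=; first lia.
by case: ifP => _ /=; last case: rl => [|h' rll rlv rlr] /=; lia.
Qed.

Lemma depth_ins p x t : (depth (ins p x t) <= 2 * depth t + 2)%N.
Proof.
elim: t => //= h l IHl v r IHr; case: ifP => _; apply: leq_trans (depth_bal _ _ _) _; lia.
Qed.

Lemma depth_popmin t m t' : popmin t = Some (m, t') -> (depth t' <= 2 * depth t)%N.
Proof.
elim: t m t' => //= h l IHl v r _ m t'.
case: (popmin l) IHl => [[m' l']|] /= IH [_ <-]; last lia.
by have := IH _ _ erefl; have := depth_bal l' v r; lia.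
Qed.

Lemma depth_glue l r : (depth (glue l r) <= 2 * (maxn (depth l) (depth r)) + 2)%N.
Proof.
rewrite /glue; case e : (popmin r) => [[m r']|] /=; last lia.
by have := depth_popmin e; have := depth_bal l m r'; lia.
Qed.

Lemma depth_del p t m t' : del p t = Some (m, t') -> (depth t' <= 2 * depth t)%N.
Proof.
elim: t m t' => //= h l IHl v r IHr m t'; case: ifP => _.
  case: (del p r) IHr => [[m' r']|] //= IH [_ <-].
  by have := IH _ _ erefl; have := depth_bal l v r'; lia.
case: (del p l) IHl => [[m' l']|] /= IH [_ <-].
  by have := IH _ _ erefl; have := depth_bal l' v r; lia.
by have := depth_glue l r; lia.
Qed.
End Depth.

Section AvlComp.
Variable R : realType.
Context {A T C : Type} {ea : Enc R A} {et : Enc R T} {ec : Enc R C}.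
Variable P : C -> T -> bool.
Hypothesis hP : Comp (fun q : C * T => P q.1 q.2) (fun=> 0).
Variables (c : A -> C) (x : A -> T) (t : A -> tree T) (tc tx tt : A -> nat).
Hypotheses (hc : Comp c tc) (hx : Comp x tx) (ht : Comp t tt).

Lemma Comp_ins : Comp (fun a => ins (P (c a)) (x a) (t a))
  (fun a => tc a + tx a + tt a + depth (t a))%N.
Proof.
apply: Comp_le 3 _ (Comp_comp (f := fun a => (c a, (x a, t a))) (Comp_pair hc (Comp_pair hx ht)) (Comp_ins_aux hP)) => a /=; lia.
Qed.

Lemma Comp_del : Comp (fun a => del (P (c a)) (t a))
  (fun a => tc a + tt a + depth (t a))%N.
Proof.
apply: Comp_le 7 _ (Comp_comp (f := fun a => (c a, t a)) (Comp_pair hc ht) (Comp_del_aux hP)) => a /=; lia.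
Qed.

Lemma Comp_last_sat : Comp (fun a => last_sat (P (c a)) (t a))
  (fun a => tc a + tt a + depth (t a))%N.
Proof.
apply: Comp_le 3 _ (Comp_comp (f := fun a => (c a, t a)) (Comp_pair hc ht) (Comp_last_sat_aux hP)) => a /=; lia.
Qed.

Lemma Comp_first_unsat : Comp (fun a => first_unsat (P (c a)) (t a))
  (fun a => tc a + tt a + depth (t a))%N.
Proof.
apply: Comp_le 3 _ (Comp_comp (f := fun a => (c a, t a)) (Comp_pair hc ht) (Comp_first_unsat_aux hP)) => a /=; lia.
Qed.

Lemma Comp_popmin : Comp (fun a => popmin (t a)) (fun a => tt a + depth (t a))%N.
Proof.
have h := @Comp_popmin_aux R T et; apply: Comp_le 3 _ (Comp_comp ht h) => a /=; lia.
Qed.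
End AvlComp.

(** * The plane sweep *)

Section SweepDefs.
Variable R : realType.
Local Open Scope ring_scope.

(* (id, (xl, (xr, (a, (b, len))))): the graph of x |-> a x + b over [xl, xr]. *)
Definition seg : Type := (nat * (R * (R * (R * (R * R)))))%type.
Definition sid (s : seg) := s.1.
Definition sxl (s : seg) := s.2.1.
Definition sxr (s : seg) := s.2.2.1.
Definition sa (s : seg) := s.2.2.2.1.
Definition sb (s : seg) := s.2.2.2.2.1.
Definition slen (s : seg) := s.2.2.2.2.2.
Definition yat (s : seg) (x : R) := sa s * x + sb s.

(* (abscissa, (kind, segments)), of kind 0 for a crossing of two segments, 1 for
   the right end and 2 for the left end of a segment. *)
Definition event : Type := (R * (nat * (seg * seg)))%type.

(** At equal abscissas crossings come first, then right ends, then left ends. Segments that end at a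
    vertex thus leave the sweep line before those that start there enter it. *)
Definition ev_le (e e' : event) : bool :=
  if e.1 <= e'.1 then if e'.1 <= e.1 then (e.2.1 <= e'.2.1)%N else true else false.

Definition ev_before (e e' : event) : bool := ev_le e' e.

(** The order immediately to the right of the abscissa: of two segments through one point, the one
    of smaller slope is below. [below_del] is the order immediately to the left. *)
Definition below_ins (c : R * seg) (u : seg) : bool :=
  if yat c.2 c.1 <= yat u c.1 then
    if yat u c.1 <= yat c.2 c.1 then if sa c.2 <= sa u then false else true
    else false
  else true.

Definition below_del (c : R * seg) (u : seg) : bool :=
  if yat c.2 c.1 <= yat u c.1 then
    if yat u c.1 <= yat c.2 c.1 then if sa u <= sa c.2 then false else true
    else false
  else true.

Definition meet_x (s t : seg) : R := (sb t - sb s) / (sa s - sa t).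

Definition enqueue (e : event) (Q : tree event) := ins (ev_before e) e Q.

(** Meant for [s] below [t] on the sweep line: the two can meet further right only if [s] has the
    larger slope. A meeting at an end of either segment is no crossing. *)
Definition push (s t : seg) (Q : tree event) : tree event :=
  if sa s <= sa t then Q else
  bind (meet_x s t) (fun x =>
    if x <= sxl s then Q else if x <= sxl t then Q else
    if sxr s <= x then Q else if sxr t <= x then Q else
    enqueue (x, (0%N, (s, t))) Q).

Definition pusho (s t : option seg) (Q : tree event) : tree event :=
  ocase s Q (fun s => ocase t Q (fun t => push s t Q)).

Definition state : Type := (tree event * (tree seg * seq (seg * seg)))%type.

(** A crossing may be queued repeatedly, since two neighbours can be separated and become neighbours
    again. When it comes up again the segments are already exchanged; the deletion then finds [t]
    first, and the comparison of identifiers leaves the state unchanged. *)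
Definition cross_step (x : R) (s t : seg) (Q : tree event) (L : tree seg)
    (out : seq (seg * seg)) : state :=
  ocase (del (below_del (x, s)) L) (Q, (L, out)) (fun uL =>
    if (uL.1.1 <= s.1)%N then if (s.1 <= uL.1.1)%N then
      ocase (del (below_del (x, t)) uL.2) (Q, (L, out)) (fun wL =>
        (pusho (last_sat (below_ins (x, t)) wL.2) (Some t)
           (pusho (Some s) (first_unsat (below_ins (x, t)) wL.2) Q),
         (ins (below_ins (x, t)) t (ins (below_ins (x, s)) s wL.2), (s, t) :: out)))
    else (Q, (L, out)) else (Q, (L, out))).

Definition right_step (x : R) (s : seg) (Q : tree event) (L : tree seg)
    (out : seq (seg * seg)) : state :=
  ocase (del (below_del (x, s)) L) (Q, (L, out)) (fun uL =>
    (pusho (last_sat (below_del (x, s)) uL.2) (first_unsat (below_del (x, s)) uL.2) Q,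
     (uL.2, out))).

Definition left_step (x : R) (s : seg) (Q : tree event) (L : tree seg)
    (out : seq (seg * seg)) : state :=
  (pusho (last_sat (below_ins (x, s)) L) (Some s)
     (pusho (Some s) (first_unsat (below_ins (x, s)) L) Q),
   (ins (below_ins (x, s)) s L, out)).

Definition sweep_step (st : state) : state :=
  ocase (popmin st.1) st (fun eQ =>
    if (eQ.1.2.1 <= 0)%N then
      cross_step eQ.1.1 eQ.1.2.2.1 eQ.1.2.2.2 eQ.2 st.2.1 st.2.2
    else if (eQ.1.2.1 <= 1)%N then
      right_step eQ.1.1 eQ.1.2.2.1 eQ.2 st.2.1 st.2.2
    else left_step eQ.1.1 eQ.1.2.2.1 eQ.2 st.2.1 st.2.2).

Definition left_event (s : seg) : event := (sxl s, (2%N, (s, s))).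
Definition right_event (s : seg) : event := (sxr s, (1%N, (s, s))).

Definition init_queue (S : seq seg) : tree event :=
  foldl (fun Q s => enqueue (right_event s) (enqueue (left_event s) Q)) Lf S.

Definition sweep (fuel : seq seg) (S : seq seg) : seq (seg * seg) :=
  (foldl (fun st _ => sweep_step st) (init_queue S, (Lf, [::])) fuel).2.2.

End SweepDefs.

(** * The invariant of the sweep *)

Section SweepCorrect.
Variable R : realType.
Local Open Scope ring_scope.
Local Notation seg := (seg R).
Local Notation event := (event R).
Implicit Types (s t u v : seg) (e : event) (Q : seq event) (L A B : seq seg).

Fixpoint pw (T : eqType) (P : T -> T -> Prop) (l : seq T) : Prop :=
  if l is x :: l' then (forall y, y \in l' -> P x y) /\ pw P l' else True.

Lemma pw_cat (T : eqType) (P : T -> T -> Prop) l1 l2 :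
  pw P (l1 ++ l2) <-> [/\ pw P l1, pw P l2 & forall x y, x \in l1 -> y \in l2 -> P x y].
Proof.
elim: l1 => [|a l1 IH] /=; first by split=> [h|[_ h _]]; first by split.
split.
- case=> h1 /IH[h2 h3 h4]; split=> //.
    by split=> // y hy; apply: h1; rewrite mem_cat hy.
  move=> x y; rewrite inE => /orP[/eqP ->|hx] hy; last exact: h4.
  by apply: h1; rewrite mem_cat hy orbT.
- case=> -[h1 h2] h3 h4; split.
    move=> y; rewrite mem_cat => /orP[|hy]; first exact: h1.
    by apply: h4 => //; rewrite mem_head.
  by apply/IH; split=> // x y hx hy; apply: h4 => //; rewrite inE hx orbT.
Qed.

Lemma pw_ins (T : eqType) (P : T -> T -> Prop) l1 x l2 :
  pw P (l1 ++ x :: l2) <-> [/\ pw P (l1 ++ l2), (forall y, y \in l1 -> P y x) &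
    (forall y, y \in l2 -> P x y)].
Proof.
split=> [/pw_cat[h1 [h2 h3] h4]|[/pw_cat[h1 h2 h3] h4 h5]].
  split=> //; last by move=> y hy; apply: h4; rewrite ?mem_head.
  by apply/pw_cat; split=> // y z hy hz; apply: h4 => //; rewrite inE hz orbT.
apply/pw_cat; split=> // y z hy.
by rewrite inE => /orP[/eqP ->|hz]; [apply: h4|apply: h3].
Qed.

Lemma pw_impl (T : eqType) (P P' : T -> T -> Prop) l :
  (forall x y, x \in l -> y \in l -> P x y -> P' x y) -> pw P l -> pw P' l.
Proof.
elim: l => //= a l IH h [h1 h2]; split.
  by move=> y hy; apply: h; rewrite ?mem_head ?inE ?hy ?orbT //; apply: h1.
by apply: IH h2 => x y hx hy; apply: h; rewrite inE ?hx ?hy orbT.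
Qed.

Definition cross s t (x : R) : bool :=
  [&& sxl s < x, x < sxr s, sxl t < x, x < sxr t, yat s x == yat t x & sa s != sa t].

Lemma cross_sym s t x : cross s t x = cross t s x.
Proof.
by rewrite /cross [sa s == _]eq_sym [yat s x == _]eq_sym; do 4 case: (_ < _).
Qed.

Lemma meet_xE s t x : sa s != sa t -> yat s x = yat t x -> x = meet_x s t.
Proof.
rewrite /yat /meet_x => h e; have h' : sa s - sa t != 0 by rewrite subr_eq0.
apply: (mulIf h'); rewrite divfK //; lra.
Qed.

Lemma yat_meet s t : sa s != sa t -> yat s (meet_x s t) = yat t (meet_x s t).
Proof.
rewrite /yat /meet_x => h; have h' : sa s - sa t != 0 by rewrite subr_eq0.
by field.
Qed.

(** The affine function [yat s - yat t] goes from nonpositive to positive, so it increases and has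
    its zero in between. *)
Lemma meet_between s t X X' : X <= X' -> yat s X <= yat t X -> yat t X' < yat s X' ->
  [/\ sa t < sa s, X <= meet_x s t & meet_x s t < X'].
Proof.
rewrite /yat => h h1 h2.
have h3 : sa t < sa s.
  rewrite ltNge; apply/negP => h4; nra.
have e := @yat_meet s t (negbT (gt_eqF h3)); move: e; rewrite /yat.
set z := meet_x s t => e; split=> //; nra.
Qed.

(* The ways in which two segments that are in this order from below may meet at
   abscissa X, namely in a common end or in a crossing. *)
Definition good (X : R) s t : Prop :=
  yat s X < yat t X \/ (yat s X = yat t X /\
    [\/ [/\ sxr s = X, sxr t = X & sa t < sa s], cross s t X |
        [/\ sxl s = X, sxl t = X & sa s < sa t]]).

Lemma good_le X s t : good X s t -> yat s X <= yat t X.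
Proof. by case=> [/ltW|[-> _]]. Qed.

Variable S : seq seg.

(** The position that sheared drawings guarantee: no T-shaped contacts, no overlaps of positive
    length and no triple crossing points. Contacts at common ends remain possible. *)
Definition segs_ok : Prop :=
  [/\ uniq S, {in S &, injective (@sid R)}, forall s, s \in S -> sxl s < sxr s,
  forall s t x, s \in S -> t \in S -> s != t ->
    sxl s <= x <= sxr s -> sxl t <= x <= sxr t -> yat s x = yat t x ->
    [\/ cross s t x, [/\ x = sxl s, x = sxl t & sa s != sa t],
        [/\ x = sxr s, x = sxr t & sa s != sa t] |
        (x = sxl s /\ x = sxr t) \/ (x = sxr s /\ x = sxl t)] &
  forall s t u x, s \in S -> t \in S -> u \in S -> s != t -> s != u -> t != u ->
    cross s t x -> cross s u x -> cross t u x -> False].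

(** The queue determines the status [L]: a segment is active once its left event is gone and until
    its right event is. [l_adj] keeps the crossings of neighbours that are still to come in the
    queue, so that no exchange can be missed. [o_pw] tells from the order in [L] whether a crossing
    is past: if the lower segment has the smaller slope, the pair has been exchanged and reported,
    with the formerly lower segment first. [q_uniq] leaves out kind 0 because crossings may be
    queued repeatedly. *)
Record Inv (X : R) Q L (out : seq (seg * seg)) : Prop := {
  q_sorted : sorted (@ev_le R) Q;
  q_ge : forall e, e \in Q -> X <= e.1;
  q_kind : forall e, e \in Q ->
    [\/ exists2 s, s \in S & e = left_event s,
        exists2 s, s \in S & e = right_event s |
        exists s t x, [/\ e = (x, (0%N, (s, t))), s \in L, t \in L, cross s t x & sa t < sa s]];
  q_uniq : uniq (filter (fun e => 0 < e.2.1)%N Q);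
  q_lev : forall s, s \in S -> left_event s \in Q -> right_event s \in Q;
  l_mem : forall s, (s \in L) = [&& s \in S, left_event s \notin Q & right_event s \in Q];
  l_uniq : uniq L;
  l_x : forall u s, u \in L -> s \in L -> sxl u < sxr s;
  l_left : forall u, u \in L -> sxl u <= X;
  l_good : pw (good X) L;
  l_adj : forall A s t B x, L = A ++ s :: t :: B -> sa t < sa s -> cross s t x ->
    (x, (0%N, (s, t))) \in Q;
  o_pw : pw (fun s t => (s, t) \notin out /\
    (forall x, cross s t x -> sa s < sa t -> (t, s) \in out)) L;
  o_done : forall s t x, s \in S -> t \in S -> right_event s \notin Q -> cross s t x ->
    ((s, t) \in out) || ((t, s) \in out);
  o_old : forall s t, (s, t) \in out -> left_event s \notin Q /\ left_event t \notin Q;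
  o_uniq : uniq out;
  o_ok : forall s t, (s, t) \in out ->
    [/\ s \in S, t \in S, sa t < sa s & exists x, cross s t x] }.

End SweepCorrect.

Section SweepInvariant.
Variable R : realType.
Local Open Scope ring_scope.
Local Notation seg := (seg R).
Local Notation event := (event R).
Implicit Types (s t u v : seg) (e : event) (Q : seq event) (L A B : seq seg).

Lemma ev_leE e e' : ev_le e e' = (e.1 < e'.1) || ((e.1 == e'.1) && (e.2.1 <= e'.2.1)%N).
Proof. by rewrite /ev_le; case: ltgtP => //= _; rewrite ?orbF. Qed.

Lemma ev_le_total : total (@ev_le R).
Proof.
move=> e e'; rewrite !ev_leE; case: ltgtP => //= _.
exact: leq_total.
Qed.

Lemma ev_le_trans : transitive (@ev_le R).
Proof.
move=> e2 e1 e3; rewrite !ev_leE => /orP[h1|/andP[/eqP h1 k1]] /orP[h2|/andP[/eqP h2 k2]].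
- by rewrite (lt_trans h1 h2).
- by rewrite -h2 h1.
- by rewrite h1 h2.
- by rewrite h1 h2 eqxx (leq_trans k1 k2) orbT.
Qed.

Lemma mono_before e Q : sorted (@ev_le R) Q -> mono (ev_before e) Q.
Proof.
rewrite (sorted_pairwise ev_le_trans); apply: sub_pairwise => x y /= h.
by apply/implyP => h'; apply: ev_le_trans h h'.
Qed.

Lemma elems_enqueue e (T : tree event) : sorted (@ev_le R) (elems T) ->
  sorted (@ev_le R) (elems (enqueue e T)) /\ perm_eq (elems (enqueue e T)) (e :: elems T).
Proof.
move=> h; rewrite /enqueue elems_ins; last exact: mono_before.
set p := ev_before e; set Q := elems T in h *; split; last first.
  rewrite perm_catC -cat1s -catA perm_sym -cat1s perm_cat2l perm_sym perm_catC.
  by rewrite perm_filterC.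
move: h; rewrite !(sorted_pairwise ev_le_trans) => h.
rewrite pairwise_cat pairwise_filter // pairwise_cons pairwise_filter // !andbT /=.
have a1 : all (ev_le e) (filter (predC p) Q).
  apply/allP => x; rewrite mem_filter /p /ev_before /= => /andP[h1 _].
  by have := ev_le_total e x; rewrite (negbTE h1) orbF.
rewrite a1 andbT allrel_consr; apply/andP; split.
  by apply/allP => x; rewrite mem_filter => /andP[].
apply/allrelP => x y; rewrite !mem_filter => /andP[h1 _] /andP[h2 _].
apply: ev_le_trans h1 _; move: h2; rewrite /p /ev_before /=.
by have := ev_le_total e y; case: (ev_le y e); rewrite ?orbF.
Qed.

(* [T'] is obtained from [T] by adding valid crossing events, among which are
   all those of the pairs of [N]. *)
Definition extends (N : seq (seg * seg)) (T T' : tree event) : Prop :=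
  [/\ avl T', sorted (@ev_le R) (elems T') &
  exists E, [/\ perm_eq (elems T') (E ++ elems T), (size E <= size N)%N,
    forall e, e \in E -> exists s t x, [/\ (s, t) \in N, e = (x, (0%N, (s, t))),
      cross s t x & sa t < sa s] &
    forall s t x, (s, t) \in N -> cross s t x -> sa t < sa s -> (x, (0%N, (s, t))) \in E]].

Lemma extends0 T : avl T -> sorted (@ev_le R) (elems T) -> extends [::] T T.
Proof. by move=> h1 h2; split=> //; exists [::]. Qed.

Lemma extends_weaken N p T T' : extends N T T' ->
  (forall x, cross p.1 p.2 x -> sa p.2 < sa p.1 -> False) -> extends (p :: N) T T'.
Proof.
case=> h1 h2 [E [h3 h4 h5 h6]] h7; split=> //; exists E; split=> //.
- exact: leq_trans h4 _.
- move=> e /h5[s [t [x [k1 k2 k3 k4]]]]; exists s, t, x; split=> //.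
  by rewrite inE k1 orbT.
- move=> s t x; rewrite inE => /orP[/eqP e|]; last exact: h6.
  by move=> k1 k2; exfalso; apply: (h7 x); rewrite -e.
Qed.

(** The supporting lines meet once, so if that point fails to be interior to both segments there is
    no crossing to record. *)
Lemma extends_push N T T' s t : extends N T T' -> extends ((s, t) :: N) T (push s t T').
Proof.
move=> h; rewrite /push; case: ifP => h1.
  by apply: extends_weaken h _ => x _ /=; rewrite ltNge h1.
move/negbT: h1; rewrite -ltNge => h1; rewrite /bind.
have hm x : cross s t x -> x = meet_x s t.
  by case/and5P=> _ _ _ _ /andP[/eqP ? ?]; apply: meet_xE.
do 4 (case: ifP => [hx|/negbT]; [apply: extends_weaken h _ => x /=;
  by move=> c _; move: (hm _ c) (c) hx => <- /and5P[? ? ? ? _]; lra|rewrite -ltNge => ?]).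
case: h => a1 a2 [E [b1 b2 b3 b4]].
have [c1 c2] := elems_enqueue (meet_x s t, (0%N, (s, t))) a2.
have cr : cross s t (meet_x s t).
  apply/and5P; split=> //; rewrite yat_meet ?eqxx //=; exact: negbT (gt_eqF h1).
split=> //; first by case: (ins_avl (ev_before (meet_x s t, (0%N, (s, t)))) (meet_x s t, (0%N, (s, t))) a1).
exists ((meet_x s t, (0%N, (s, t))) :: E); split=> //.
- by rewrite (perm_trans c2) // perm_cons.
- move=> e; rewrite inE => /orP[/eqP ->|/b3[s' [t' [x [k1 k2 k3 k4]]]]].
    by exists s, t, (meet_x s t); rewrite mem_head.
  by exists s', t', x; rewrite inE k1 orbT.
- move=> s' t' x; rewrite !inE => /orP[/eqP[-> ->]|hin] k1 k2.
    by rewrite (hm _ k1) eqxx.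
  by rewrite (b4 _ _ _ hin k1 k2) orbT.
Qed.

Definition opair (s t : option seg) : seq (seg * seg) :=
  if s is Some s then if t is Some t then [:: (s, t)] else [::] else [::].

Lemma extends_pusho N T T' (s t : option seg) : extends N T T' -> extends (opair s t ++ N) T (pusho s t T').
Proof. by case: s => [s|] //; case: t => [t|] // h; apply: extends_push. Qed.

Variable S : seq seg.
Hypothesis Sok : segs_ok S.

Lemma S_inj : {in S &, injective (@sid R)}. Proof. by case: Sok. Qed.
Lemma S_lr s : s \in S -> sxl s < sxr s. Proof. by case: Sok => _ _ h _ _; apply: h. Qed.

Lemma tie s t X : s \in S -> t \in S -> s != t ->
    sxl s <= X <= sxr s -> sxl t <= X <= sxr t -> yat s X = yat t X ->
    [\/ cross s t X, [/\ X = sxl s, X = sxl t & sa s != sa t],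
        [/\ X = sxr s, X = sxr t & sa s != sa t] |
        (X = sxl s /\ X = sxr t) \/ (X = sxr s /\ X = sxl t)].
Proof. by case: Sok => _ _ _ h _; apply: h. Qed.

(** A third segment through a crossing point cannot end there, for an end on another segment is an
    end of that one too. It would cross both segments in a triple point. *)
Lemma cross_only s t u X : s \in S -> t \in S -> u \in S -> s != t -> u != s -> u != t ->
  cross s t X -> sxl u <= X <= sxr u -> yat u X <> yat s X.
Proof.
move=> hs ht hu st us ut c hX e.
have /and5P[s1 s2 t1 t2 /andP[/eqP e2 _]] := c.
have us' : s != u by rewrite eq_sym.
have ut' : t != u by rewrite eq_sym.
have hsX : sxl s <= X <= sxr s by rewrite !ltW.
have htX : sxl t <= X <= sxr t by rewrite !ltW.
have c1 : cross s u X.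
  case: (tie hs hu us' hsX hX (esym e)) => // [[q1 q2 q3]|[q1 q2 q3]|[[q1 q2]|[q1 q2]]]; lra.
have c2 : cross t u X.
  case: (tie ht hu ut' htX hX (etrans (esym e2) (esym e))) => // [[q1 q2 q3]|[q1 q2 q3]|[[q1 q2]|[q1 q2]]]; lra.
case: Sok => _ _ _ _ h; exact: (h s t u X).
Qed.

Section Step.
Variables (X : R) (Q : seq event) (L : seq seg) (out : seq (seg * seg)).
Hypothesis I : Inv S X Q L out.

Lemma L_S s : s \in L -> s \in S. Proof. by rewrite (l_mem I) => /and3P[]. Qed.
Lemma L_right s : s \in L -> right_event s \in Q. Proof. by rewrite (l_mem I) => /and3P[]. Qed.

Lemma adjacent_sorted (T : eqType) (r : rel T) (l : seq T) :
  (forall l1 x y l2, l = l1 ++ x :: y :: l2 -> r x y) -> sorted r l.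
Proof.
case: l => //= a l; elim: l a => //= b l IH a h; apply/andP; split.
  exact: (h [::] a b l).
by apply: IH => l1 x y l2 e; apply: (h (a :: l1) x y l2); rewrite e.
Qed.

Lemma pw_pairwise (T : eqType) (r : rel T) (l : seq T) : pairwise r l -> pw r l.
Proof. by elim: l => //= a l IH /andP[/allP h /IH]. Qed.

Lemma pw_and (T : eqType) (P P' : T -> T -> Prop) l :
  pw P l -> pw P' l -> pw (fun x y => P x y /\ P' x y) l.
Proof. by elim: l => //= a l IH [h1 h2] [k1 k2]; split; [move=> y hy; split; [apply: h1|apply: k1]|apply: IH]. Qed.

Lemma pw_uniq (T : eqType) (l : seq T) : uniq l -> pw (fun x y => x != y) l.
Proof. by elim: l => //= a l IH /andP[h /IH]; split=> // y hy; apply: contraNneq h => ->. Qed.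

(** An inversion at [X'] would already occur between neighbours; these would have crossed before
    [X'], and [l_adj] provides a queued event before [X']. Ties at [X'] are then classified by the
    position of the segments. *)
Lemma advance X' : X <= X' -> (forall e, e \in Q -> X' <= e.1) -> pw (good X') L.
Proof.
rewrite le_eqVlt => /orP[/eqP <-|hX] hQ; first exact: (l_good I).
have hr s : s \in L -> X' <= sxr s by move=> /L_right /hQ.
have hl s : s \in L -> sxl s <= X by apply: (l_left I).
have adj A s t B : L = A ++ s :: t :: B -> yat s X' <= yat t X'.
  move=> e; rewrite leNgt; apply/negP => lt.
  have hs : s \in L by rewrite e mem_cat mem_head orbT.
  have ht : t \in L by rewrite e mem_cat !inE eqxx !orbT.
  have := l_good I; rewrite e => /pw_cat[_ /= [g _] _].
  have {}g : good X s t by apply: g; rewrite mem_head.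
  have [sl x1 x2] := meet_between (ltW hX) (good_le g) lt.
  have [s1 s2 t1 t2] := And4 (hl _ hs) (hr _ hs) (hl _ ht) (hr _ ht).
  have ne : sa s != sa t by rewrite gt_eqF.
  have c : cross s t (meet_x s t).
    case: (ltrP X (meet_x s t)) => [x3|x3].
      by apply/and5P; split; rewrite ?yat_meet ?eqxx //; lra.
    have eX : X = meet_x s t by apply/eqP; rewrite eq_le x1 x3.
    rewrite -eX; case: g => [h|[_ [[h _ _]|//|[_ _ h]]]].
    - by have := yat_meet ne; rewrite -eX; lra.
    - lra.
    - lra.
  have := hQ _ (l_adj I e sl c); rewrite /=; lra.
have ple : pw (fun s t => yat s X' <= yat t X') L.
  apply: pw_pairwise; rewrite -(sorted_pairwise (leT := fun s t => yat s X' <= yat t X')).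
    exact: adjacent_sorted.
  by move=> ? ? ?; apply: le_trans.
have := pw_and (pw_and ple (l_good I)) (pw_uniq (l_uniq I)).
apply: pw_impl => s t hs ht [[le g] st].
rewrite /good; move: le; rewrite le_eqVlt => /orP[/eqP e|]; [right|by left].
split=> //.
have [s1 s2 t1 t2] := And4 (hl _ hs) (hr _ hs) (hl _ ht) (hr _ ht).
have hsX : sxl s <= X' <= sxr s by rewrite s2 andbT (le_trans s1 (ltW hX)).
have htX : sxl t <= X' <= sxr t by rewrite t2 andbT (le_trans t1 (ltW hX)).
case: (tie (L_S hs) (L_S ht) st hsX htX e)=> [c|[h h' _]|[h1 h2 ne]|[[h h']|[h' h]]]; try lra.
  by apply: Or32.
apply: Or31; split=> //; move: ne; rewrite neq_lt => /orP[lt|//].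
have := good_le g; move: e lt; rewrite /yat; nra.
Qed.

End Step.

End SweepInvariant.

(** * Preservation of the invariant by the three kinds of events *)

Section SweepStep.
Variable R : realType.
Local Open Scope ring_scope.
Local Notation seg := (seg R).
Local Notation event := (event R).
Implicit Types (s t u v : seg) (e : event) (Q : seq event) (L A B : seq seg).

Lemma adj_cat (T : eqType) (A B l1 l2 : seq T) (s t : T) : A ++ B = l1 ++ s :: t :: l2 ->
  [\/ exists l, A = l1 ++ s :: t :: l, ohead (rev A) = Some s /\ ohead B = Some t |
     exists l, B = l ++ s :: t :: l2].
Proof.
elim: A l1 => [|a A IH] l1 /=; first by move=> ->; apply: Or33; exists l1.
case: l1 => [|b l1] /= [-> e].
  case: A e {IH} => [|a' A] /=.
    by move=> ->; apply: Or32.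
  by case=> -> _; apply: Or31; exists A.
case: (IH _ e) => [[l ->]|[h1 h2]|h]; [by apply: Or31; exists l| |by apply: Or33].
by apply: Or32; split=> //; rewrite rev_cons; case: (rev A) h1.
Qed.

Lemma adj_ins (T : eqType) (A B l1 l2 : seq T) (x s t : T) : A ++ x :: B = l1 ++ s :: t :: l2 ->
  [\/ exists l, A = l1 ++ s :: t :: l, ohead (rev A) = Some s /\ t = x,
     s = x /\ ohead B = Some t | exists l, B = l ++ s :: t :: l2].
Proof.
case/adj_cat => [h|[h1 [h2]]|[[|y l] /= [e1 e2]]].
- exact: Or41.
- by apply: Or42.
- by apply: Or43; rewrite e2 e1.
- by apply: Or44; exists l.
Qed.

Variable S : seq seg.
Hypothesis Sok : segs_ok S.

Lemma mem_tail_event X e Q' L out f : Inv S X (e :: Q') L out -> (0 < f.2.1)%N ->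
  (f \in Q') = (f \in e :: Q') && (f != e).
Proof.
move=> I hf; rewrite inE; case: (eqVneq f e) => [fe|] /=; last by rewrite andbT.
apply/negbTE/negP => he; have := q_uniq I.
by rewrite /= -fe hf /= mem_filter hf he.
Qed.

Lemma queue_min X e Q' L out f : Inv S X (e :: Q') L out -> f \in Q' -> ev_le e f.
Proof.
move=> I; have := q_sorted I; rewrite (sorted_pairwise (@ev_le_trans R)) /=.
by case/andP=> /allP h _ /h.
Qed.

Lemma queue_min_x X e Q' L out f : Inv S X (e :: Q') L out -> f \in e :: Q' -> e.1 <= f.1.
Proof.
move=> I; rewrite inE => /orP[/eqP ->//|/(queue_min I)].
by rewrite ev_leE => /orP[/ltW|/andP[/eqP ->]].
Qed.

(** The bookkeeping common to the three kinds of events. [N] lists the pairs that have just become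
    neighbours; what depends on the kind of event is left to the hypotheses. *)
Lemma Inv_step X e Q' L out (T' T'' : tree event) N L' out' :
  Inv S X (e :: Q') L out -> elems T' = Q' -> extends N T' T'' ->
  (forall s t, (s, t) \in N -> [/\ s \in L', t \in L' & yat s e.1 <= yat t e.1]) ->
  (forall s t x, (x, (0%N, (s, t))) \in Q' -> s \in L -> t \in L -> cross s t x ->
     s \in L' /\ t \in L') ->
  (forall s, s \in S -> left_event s \in Q' -> right_event s != e) ->
  (forall s, (s \in L') = [&& s \in S, left_event s \notin Q' & right_event s \in Q']) ->
  uniq L' -> (forall u s, u \in L' -> s \in L' -> sxl u < sxr s) ->
  (forall u, u \in L' -> sxl u <= e.1) -> pw (good e.1) L' ->
  (forall A s t B x, L' = A ++ s :: t :: B -> sa t < sa s -> cross s t x ->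
    (s, t) \in N \/ (x, (0%N, (s, t))) \in Q') ->
  pw (fun s t => (s, t) \notin out' /\
    (forall x, cross s t x -> sa s < sa t -> (t, s) \in out')) L' ->
  (forall s t x, s \in S -> t \in S -> right_event s \notin Q' -> cross s t x ->
    ((s, t) \in out') || ((t, s) \in out')) ->
  (forall s t, (s, t) \in out' -> left_event s \notin Q' /\ left_event t \notin Q') ->
  uniq out' ->
  (forall s t, (s, t) \in out' -> [/\ s \in S, t \in S, sa t < sa s & exists x, cross s t x]) ->
  Inv S e.1 (elems T'') L' out'.
Proof.
move=> I eT [_ srt [E [pE _ hE1 hE2]]] hN hcr hlr hmem hu hx hleft hgood hadj hpw hdone hold huo hok.
have mT f : (f \in elems T'') = (f \in E) || (f \in Q').
  by rewrite (perm_mem pE) mem_cat eT.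
have mT1 f : (0 < f.2.1)%N -> (f \in elems T'') = (f \in Q').
  move=> hf; rewrite mT; case hfE: (f \in E) => //=.
  by have [s [t [x [_ fE _ _]]]] := hE1 _ hfE; rewrite fE in hf.
split=> //.
(* A new crossing is not in the past: its first segment is at or below the second at [e.1] and has
   the larger slope. *)
- move=> f; rewrite mT => /orP[/hE1[s [t [x [k1 -> k3 k4]]]]|hf]; last first.
    by apply: (queue_min_x I); rewrite inE hf orbT.
  have [_ _ h] := hN _ _ k1; rewrite /= leNgt; apply/negP => lt.
  have /and5P[_ _ _ _ /andP[/eqP h' _]] := k3.
  by move: h h' k4 lt; rewrite /yat; nra.
- move=> f; rewrite mT => /orP[/hE1[s [t [x [k1 -> k3 k4]]]]|hf].
    by apply: Or33; exists s, t, x; have [] := hN _ _ k1.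
  have hf' : f \in e :: Q' by rewrite inE hf orbT.
  case: (q_kind I hf') => [h|h|[s [t [x [h1 h2 h3 h4 h5]]]]]; [exact: Or31|exact: Or32|].
  apply: Or33; exists s, t, x; rewrite h1 in hf.
  by have [] := hcr _ _ _ hf h2 h3 h4.
- have := q_uniq I; rewrite (perm_uniq (perm_filter _ pE)) filter_cat eT /=.
  have -> : filter (fun e => (0 < e.2.1)%N) E = [::].
    apply/eqP; rewrite -size_eq0 size_filter -leqn0 leqNgt -has_count -all_predC.
    by apply/allP => f /hE1[s [t [x [_ -> _ _]]]].
  by case: ifP => //= _ /andP[].
- move=> s hs; rewrite !mT1 // => hl.
  rewrite (mem_tail_event I) // (hlr _ hs hl) andbT.
  by apply: (q_lev I) => //; rewrite inE hl orbT.
- by move=> s; rewrite !mT1.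
- move=> A s t B x eL sl c; rewrite mT.
  by case: (hadj _ _ _ _ _ eL sl c) => [h|->]; rewrite ?orbT // hE2.
- by move=> s t x hs ht; rewrite mT1 //; apply: hdone.
- by move=> s t /hold; rewrite !mT1.
Qed.

Lemma below_delE x s u :
  below_del (x, s) u = (yat u x < yat s x) || ((yat u x == yat s x) && (sa s < sa u)).
Proof. by rewrite /below_del /=; case: ltgtP => //= _; rewrite ?orbF // ltNge; case: (_ <= _). Qed.

Lemma below_insE x s u :
  below_ins (x, s) u = (yat u x < yat s x) || ((yat u x == yat s x) && (sa u < sa s)).
Proof. by rewrite /below_ins /=; case: ltgtP => //= _; rewrite ?orbF // ltNge; case: (_ <= _). Qed.

(** Left events weigh 3, right events 2 and crossings 1. Treating a left end queues at most two
    crossings and treating a right end at most one, so the weight drops in either case. *)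
Definition epot Q : nat := (size Q + 2 * count (fun e => e.2.1 == 2%N) Q +
  count (fun e => e.2.1 == 1%N) Q)%N.

Lemma extends_epot N T T' : extends N T T' ->
  (epot (elems T') <= epot (elems T) + size N)%N.
Proof.
case=> _ _ [E [p sE hE _]]; rewrite /epot (perm_size p) size_cat.
rewrite (permP p (fun e => e.2.1 == 2%N)) (permP p (fun e => e.2.1 == 1%N)) !count_cat.
have cE k : (0 < k)%N -> count (fun e => e.2.1 == k) E = 0%N.
  move=> hk; apply/eqP; rewrite -leqn0 leqNgt -has_count -all_predC.
  by apply/allP => f /hE[s [t [x [_ -> _ _]]]] /=; rewrite neq_ltn hk.
rewrite !cE //=.
have arith a b c m1 m2 : (a <= b -> a + c + 2 * (0 + m1) + (0 + m2) <= c + 2 * m1 + m2 + b)%N by lia.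
exact: arith sE.
Qed.

Lemma ohead_mem (T : eqType) (l : seq T) x : ohead l = Some x -> x \in l.
Proof. by case: l => //= a l [->]; rewrite mem_head. Qed.

Lemma ohead_rev_mem (T : eqType) (l : seq T) x : ohead (rev l) = Some x -> x \in l.
Proof. by move/ohead_mem; rewrite mem_rev. Qed.

Lemma opair_mem (os ot : option seg) s t : (s, t) \in opair os ot -> os = Some s /\ ot = Some t.
Proof. by case: os => [s'|] //; case: ot => [t'|] //=; rewrite inE => /eqP[-> ->]. Qed.

Lemma opair_size (os ot : option seg) : (size (opair os ot) <= 1)%N.
Proof. by case: os => [s|] //; case: ot. Qed.

Lemma mem_split (T : eqType) (l : seq T) x : x \in l -> exists l1 l2, l = l1 ++ x :: l2.
Proof. by case/splitPr=> A B; exists A, B. Qed.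

Definition SInv X (st : state R) : Prop :=
  [/\ avl st.1, avl st.2.1 & Inv S X (elems st.1) (elems st.2.1) st.2.2].

Lemma right_case X s Q' Tq Tl out :
  Inv S X (right_event s :: Q') (elems Tl) out -> s \in S ->
  avl Tq -> avl Tl -> elems Tq = Q' ->
  SInv (sxr s) (right_step (sxr s) s Tq Tl out) /\
  (epot (elems (right_step (sxr s) s Tq Tl out).1) <= epot Q' + 1)%N /\
  (right_step (sxr s) s Tq Tl out).2.2 = out.
Proof.
move=> I hs aq al eT; set L := elems Tl in I; set X' := sxr s.
have hmin f : f \in right_event s :: Q' -> X' <= f.1 by apply: (queue_min_x I).
have lr := S_lr Sok hs.
have sL : s \in L.
  rewrite (l_mem I) hs mem_head andbT /=; apply/negP => h.
  by have : X' <= sxl s := hmin _ h; rewrite leNgt lr.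
have hX : X <= X' by have := q_ge I (mem_head _ _).
have hg := advance Sok I hX hmin.
have hl u : u \in L -> sxl u < X' by move=> hu; apply: (l_x I).
have hr u : u \in L -> X' <= sxr u by move=> /(L_right I) /hmin.
have ht u : u \in L -> u != s -> yat u X' = yat s X' -> sxr u = X' /\ sa u != sa s.
  move=> hu us e.
  have xu : sxl u <= X' <= sxr u by rewrite (ltW (hl _ hu)) hr.
  have xs : sxl s <= X' <= sxr s by rewrite (ltW (hl _ sL)) /X' lexx.
  case: (tie Sok (L_S I hu) hs us xu xs e) => [/and5P[_ _ _ h _]|[h _ _]|[h1 _ h2]|[[h _]|[h h']]].
  - by move: h; rewrite /X' ltxx.
  - by have := hl _ hu; rewrite -h ltxx.
  - by rewrite h1.
  - by have := hl _ hu; rewrite -h ltxx.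
  - by move: h'; rewrite /X' => h'; move: lr; rewrite h' ltxx.
have nl u v : u \in L -> [/\ sxl u = X', sxl v = X' & sa u < sa v] -> False.
  by move=> /hl; move=> + [h _ _]; rewrite h ltxx.
have nc u : cross u s X' -> False by case/and5P=> _ _ _; rewrite /X' ltxx.
have nc' u : cross s u X' -> False by case/and5P=> _; rewrite /X' ltxx.
have [A [B eL]] := mem_split sL.
have uL := l_uniq I; rewrite -/L eL in uL.
have /pw_cat[_ /= [hsB _] hAs] : pw (good X') (A ++ s :: B) by rewrite -eL.
have memL u : u \in L = (u \in A) || (u == s) || (u \in B) by rewrite eL mem_cat inE orbA.
have [uA uB] : s \notin A /\ s \notin B.
  by move: uL; rewrite cat_uniq /= negb_or => /and3P[_ /andP[-> _] /andP[-> _]].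
have pA : all (below_del (X', s)) A.
  apply/allP => u hu; have uL' : u \in L by rewrite memL hu.
  have us : u != s by apply: contraNneq uA => <-.
  rewrite below_delE; case: (hAs _ _ hu (mem_head _ _)) => [->//|[e h]].
  rewrite e ltxx eqxx /=; case: h => [[_ _ ->]//|/nc//|/(nl _ _ uL')//].
have pB : all (predC (below_del (X', s))) (s :: B).
  apply/allP => u; rewrite inE => /orP[/eqP ->|hu].
    by rewrite /= below_delE !ltxx andbF.
  have uL' : u \in L by rewrite memL hu orbT.
  rewrite /= below_delE; case: (hsB _ hu) => [h|[e h]].
    by rewrite ltNge (ltW h) gt_eqF.
  rewrite e ltxx eqxx /= -leNgt; case: h => [[_ _ /ltW]//|/nc'//|/nl-/(_ ltac:(by rewrite memL eqxx orbT))//].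
have [L1 dL1 eL1] := del_split eL pA pB (erefl _).
have pB' : all (predC (below_del (X', s))) B by case/andP: pB.
have [aL1 _] := del_avl al dL1.
rewrite /right_step -/X' dL1 /=.
rewrite (last_sat_split eL1 pA pB') (first_unsat_split eL1 pA pB').
have sQ : sorted (@ev_le R) (elems Tq).
  by rewrite eT; have /= := q_sorted I; apply: path_sorted.
have ext := extends_pusho (ohead (rev A)) (ohead B) (extends0 aq sQ).
rewrite cats0 in ext.
split; last first.
  split=> //; apply: leq_trans (extends_epot ext) _; rewrite eT leq_add2l.
  exact: opair_size.
have [aT'' _ _] := ext.
split=> //=; rewrite eL1.
have subL u : u \in A ++ B -> u \in L.
  by rewrite mem_cat memL => /orP[->|->]; rewrite ?orbT.
apply: (Inv_step I eT ext).
- move=> u v /opair_mem[/ohead_rev_mem hu /ohead_mem hv].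
  rewrite !mem_cat hu hv orbT; split=> //.
  move: hg; rewrite eL => /pw_ins[/pw_cat[_ _ h] _ _].
  exact: (good_le (h _ _ hu hv)).
- move=> u v x hq hu hv c.
  have : X' <= x by have := @hmin (x, (0%N, (u, v))); apply; rewrite inE hq orbT.
  have /and5P[_ cu _ cv _] := c.
  move: hu hv; rewrite !memL !mem_cat.
  case: (eqVneq u s) => [e|_]; first by rewrite e in cu; rewrite /X' leNgt cu.
  case: (eqVneq v s) => [e|_]; first by rewrite e in cv; rewrite /X' leNgt cv.
  by rewrite !orbF.
- move=> u hu hq; apply/eqP => e.
  have : X' <= sxl u by have := @hmin (left_event u); apply; rewrite inE hq orbT.
  have us : u = s by case: e.
  by rewrite us leNgt lr.
- move=> u; rewrite mem_cat.
  have := l_mem I u; rewrite -/L memL.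
  rewrite (mem_tail_event (f := left_event u) I) // (mem_tail_event (f := right_event u) I) //.
  have -> : left_event u != right_event s by apply/eqP => -[].
  rewrite andbT; case: (eqVneq u s) => [->|us].
    by rewrite eqxx !andbF (negbTE uA) (negbTE uB).
  rewrite !orbF => ->; have -> : right_event u != right_event s.
    by apply: contraNneq us => -[_ ->].
  by rewrite andbT.
- by move: uL; rewrite (uniq_catCA A [:: s] B : uniq (A ++ s :: B) = _) /= => /andP[].
- by move=> u v /subL hu /subL hv; apply: (l_x I).
- by move=> u /subL hu; apply: ltW; apply: hl.
- by move: hg; rewrite eL => /pw_ins[].
- move=> l1 u v l2 x /adj_cat[[l e]|[h1 h2]|[l e]] sl c.
  + have := l_adj I (A := l1) (s := u) (t := v) (B := l ++ s :: B) _ sl c.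
    rewrite -/L eL e -!catA /= inE => /(_ erefl) /orP[/eqP//|->]; by right.
  + by left; rewrite h1 h2 /= mem_head.
  + have := l_adj I (A := A ++ s :: l) (s := u) (t := v) (B := l2) _ sl c.
    rewrite -/L eL e -!catA /= inE => /(_ erefl) /orP[/eqP//|->]; by right.
- by have := o_pw I; rewrite -/L eL => /pw_ins[].
- move=> u v x hu hv; rewrite (mem_tail_event I) // negb_and negbK => /orP[h c|/eqP e c].
    exact: (o_done I hu hv h c).
  have {e} us : u = s by case: e.
  rewrite {u}us in hu c *.
  have := o_pw I; rewrite -/L eL => /pw_ins[_ hAo hBo].
  have /and5P[cx1 cx2 cx3 cx4 /andP[/eqP cy ca]] := c.
  have vs : v != s by apply: contraNneq ca => ->.
  case hq: (right_event v \in right_event s :: Q'); last first.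
    by rewrite orbC; apply: (o_done I hv hu (negbT hq)); rewrite cross_sym; exact: c.
  have vL : v \in L.
    rewrite (l_mem I) hv hq andbT /=; apply/negP => h.
    by have : X' <= sxl v := hmin _ h; rewrite leNgt (lt_trans cx3 cx2).
  (* The crossing lies to the left of [X'], so the order at [X'] determines which slope is smaller,
     and [o_pw] says that the pair has been reported. *)
  have ne : sa v < sa s \/ sa s < sa v by apply/orP; rewrite -neq_lt eq_sym.
  move: vL; rewrite memL (negbTE vs) orbF => /orP[] hv'.
    have [_ h] := hAo _ hv'; rewrite (h x) //; first by rewrite cross_sym.
    have := good_le (hAs _ _ hv' (mem_head _ _)); case: ne => //.
    by move: cy cx2; rewrite /yat -/X'; nra.
  have [_ h] := hBo _ hv'; rewrite (h x) ?orbT //.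
  have := good_le (hsB _ hv'); case: ne => //.
  by move: cy cx2; rewrite /yat -/X'; nra.
- by move=> u v /(o_old I); rewrite !inE !negb_or => -[/andP[_ ->] /andP[_ ->]].
- exact: (o_uniq I).
- exact: (o_ok I).
Qed.


End SweepStep.

Section SweepStep2.
Variable R : realType.
Local Open Scope ring_scope.
Local Notation seg := (seg R).
Local Notation event := (event R).
Implicit Types (s t u v : seg) (e : event) (Q : seq event) (L A B : seq seg).

Variable S : seq seg.
Hypothesis Sok : segs_ok S.

Lemma pw_mono (T : eqType) (P : T -> T -> Prop) (p : T -> bool) l : pw P l ->
  (forall x y, x \in l -> y \in l -> P x y -> p y -> p x) -> mono p l.
Proof.
elim: l => //= a l IH [h1 h2] h; apply/andP; split.
  apply/allP => y hy; apply/implyP; apply: h; rewrite ?mem_head ?inE ?hy ?orbT //.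
  exact: h1.
by apply: IH => // x y hx hy; apply: h; rewrite inE ?hx ?hy orbT.
Qed.

Lemma mono_filter (T : eqType) (p : T -> bool) (l : seq T) : mono p l ->
  l = filter p l ++ filter (predC p) l.
Proof.
elim: l => //= a l IH /andP[ha /IH e]; case: ifP => pa /=; first by rewrite -e.
have np : all (predC p) l by apply: sub_all ha => x /=; rewrite pa; case: (p x).
have [-> ->] := filter_split (isT : all p [::]) np.
by [].
Qed.

Lemma left_case X s Q' Tq Tl out :
  Inv S X (left_event s :: Q') (elems Tl) out -> s \in S ->
  avl Tq -> avl Tl -> elems Tq = Q' ->
  SInv S (sxl s) (left_step (sxl s) s Tq Tl out) /\
  (epot (elems (left_step (sxl s) s Tq Tl out).1) <= epot Q' + 2)%N /\
  (left_step (sxl s) s Tq Tl out).2.2 = out.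
Proof.
move=> I hs aq al eT; set L := elems Tl in I; set X' := sxl s.
have hmin f : f \in left_event s :: Q' -> X' <= f.1 by apply: (queue_min_x I).
have lr := S_lr Sok hs.
have sL : s \notin L by rewrite (l_mem I) mem_head andbF.
have hX : X <= X' by have := q_ge I (mem_head _ _).
have hg := advance Sok I hX hmin.
have hl u : u \in L -> sxl u <= X' by move=> hu; apply: le_trans hX; apply: (l_left I).
(* Strict, since at equal abscissas right ends precede left ends in the queue. *)
have hr u : u \in L -> X' < sxr u.
  move=> /(L_right I); rewrite inE => /orP[/eqP //|/(queue_min I)].
  by rewrite ev_leE => /orP[//|/andP[_]].
have ht u : u \in L -> yat u X' = yat s X' -> sxl u = X' /\ sa u != sa s.
  move=> hu e; have us : u != s by apply: contraNneq sL => <-.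
  have xu : sxl u <= X' <= sxr u by rewrite hl // ltW // hr.
  have xs : sxl s <= X' <= sxr s by rewrite lexx ltW.
  case: (tie Sok (L_S I hu) hs us xu xs e) => [/and5P[_ _ h _ _]|[h _ ne]|[h1 _ _]|[[_ h]|[h _]]].
  - by move: h; rewrite ltxx.
  - by rewrite h.
  - by have := hr _ hu; rewrite -h1 ltxx.
  - by move: lr; rewrite -h ltxx.
  - by have := hr _ hu; rewrite -h ltxx.
set p := below_ins (X', s).
(* An active segment that passes through the left end of [s] starts there too; among such segments
   the status is ordered by slope, in accordance with [below_ins]. *)
have mp : mono p L.
  apply: pw_mono hg _ => u v hu hv g; rewrite /p !below_insE.
  case: g => [lt|[e h]].
    move=> /orP[h|/andP[/eqP <- _]]; last by rewrite lt.
    by rewrite (lt_trans lt h).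
  rewrite e => /orP[->//|/andP[/eqP ev h2]]; rewrite ev eqxx /=.
  have [lv nv] := ht _ hv ev.
  case: h => [[_ h _]|/and5P[_ _ h _ _]|[_ _ h]].
  - by have := hr _ hv; rewrite h ltxx.
  - by move: h; rewrite lv ltxx.
  - by rewrite (lt_trans h h2) orbT.
set A := filter p L; set B := filter (predC p) L.
have eL : elems Tl = A ++ B := mono_filter mp.
have pA : all p A by apply: filter_all.
have pB : all (predC p) B by apply: filter_all.
have memL u : (u \in L) = (u \in A) || (u \in B) by rewrite /L eL mem_cat.
rewrite /left_step -/X' -/p.
rewrite (last_sat_split eL pA pB) (first_unsat_split eL pA pB) /=.
have sQ : sorted (@ev_le R) (elems Tq).
  by rewrite eT; have /= := q_sorted I; apply: path_sorted.
have := extends_pusho (ohead (rev A)) (Some s)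
  (extends_pusho (Some s) (ohead B) (extends0 aq sQ)).
rewrite cats0; set N := opair _ _ ++ opair _ _ => ext.
split; last first.
  split=> //; apply: leq_trans (extends_epot ext) _; rewrite eT leq_add2l.
  by rewrite size_cat (leq_add (opair_size _ _) (opair_size _ _)).
have eL' := ins_split eL pA pB s.
have aL' : avl (ins p s Tl) by case: (ins_avl p s al).
have [aT'' _ _] := ext.
split=> //=; rewrite eL'.
have memL' u : (u \in A ++ s :: B) = (u == s) || (u \in L).
  by rewrite mem_cat inE memL orbCA.
have gA u : u \in A -> good X' u s.
  move=> hu; have uL : u \in L by rewrite memL hu.
  move/allP: pA => /(_ _ hu); rewrite /p below_insE => /orP[h|/andP[/eqP h1 h2]]; [by left|right].
  by split=> //; apply: Or33; have [-> _] := ht _ uL h1.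
have gB u : u \in B -> good X' s u.
  move=> hu; have uL : u \in L by rewrite memL hu orbT.
  move/allP: pB => /(_ _ hu); rewrite /p /= below_insE negb_or -leNgt => /andP[].
  rewrite le_eqVlt => /orP[/eqP e|h] h2; [right|by left].
  split=> //; apply: Or33; have [-> ne] := ht _ uL (esym e).
  split=> //; move: h2; rewrite e eqxx /= -leNgt le_eqVlt eq_sym.
  by rewrite (negbTE ne).
apply: (Inv_step I eT ext).
- move=> u v; rewrite mem_cat => /orP[/opair_mem[/ohead_rev_mem hu [<-]]|/opair_mem[[<-] /ohead_mem hv]].
    rewrite !memL' eqxx (memL u) hu orbT; split=> //; exact: good_le (gA _ hu).
  rewrite !memL' eqxx (memL v) hv !orbT; split=> //; exact: good_le (gB _ hv).
- by move=> u v x _ hu hv _; rewrite !memL' hu hv !orbT.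
- by move=> u _ _; apply/eqP => -[].
- move=> u; rewrite memL'.
  have := l_mem I u; rewrite -/L.
  rewrite (mem_tail_event (f := left_event u) I) // (mem_tail_event (f := right_event u) I) //.
  have -> : right_event u != left_event s by apply/eqP => -[].
  rewrite andbT; case: (eqVneq u s) => [->|us].
    rewrite eqxx /= andbF hs /= => _; apply/esym.
    by apply: (q_lev I) => //; rewrite mem_head.
  by rewrite /= => ->; have -> : left_event u != left_event s;
    [apply: contraNneq us => -[_ ->]|rewrite andbT].
- rewrite (uniq_catCA A [:: s] B : uniq (A ++ s :: B) = _) /=.
  have := l_uniq I; rewrite -/L /L eL => ->; rewrite andbT.
  by rewrite mem_cat -memL.
- move=> u v; rewrite !memL' => /orP[/eqP->|hu] /orP[/eqP->|hv] //.
  + exact: hr.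
  + by apply: le_lt_trans lr; apply: hl.
  + exact: (l_x I).
- by move=> u; rewrite memL' => /orP[/eqP->|/hl].
- by apply/pw_ins; split=> //; rewrite -eL.
- move=> l1 u v l2 x /adj_ins[[l e]|[h1 ->]|[-> h2]|[l e]] sl c.
  + have := l_adj I (A := l1) (s := u) (t := v) (B := l ++ B) _ sl c.
    rewrite -/L /L eL e -!catA /= inE => /(_ erefl) /orP[/eqP//|->]; by right.
  + by left; rewrite /N h1 /= mem_head.
  + by left; rewrite /N h2 mem_cat /= mem_head orbT.
  + have := l_adj I (A := A ++ l) (s := u) (t := v) (B := l2) _ sl c.
    rewrite -/L /L eL e -!catA /= inE => /(_ erefl) /orP[/eqP//|->]; by right.
(* By [o_old] a reported pair has lost both of its left events, whereas that of [s] is being treated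
   only now. *)
- have sout u v : (u, v) \in out -> u != s /\ v != s.
    by move=> /(o_old I)[h1 h2]; split; [apply: contraNneq h1|apply: contraNneq h2];
      move=> ->; rewrite mem_head.
  apply/pw_ins; split.
  + by have := o_pw I; rewrite -/L /L eL.
  + move=> u hu; split; first by apply/negP => /sout[_]; rewrite eqxx.
    move=> x /and5P[_ _ c3 _ /andP[/eqP cy _]] lt; exfalso.
    by have := good_le (gA _ hu); move: cy c3 lt; rewrite /yat -/X'; nra.
  + move=> u hu; split; first by apply/negP => /sout[]; rewrite eqxx.
    move=> x /and5P[c1 _ _ _ /andP[/eqP cy _]] lt; exfalso.
    by have := good_le (gB _ hu); move: cy c1 lt; rewrite /yat -/X'; nra.
- move=> u v x hu hv; rewrite (mem_tail_event I) // negb_and negbK => /orP[h c|/eqP //].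
  exact: (o_done I hu hv h c).
- by move=> u v /(o_old I); rewrite !inE !negb_or => -[/andP[_ ->] /andP[_ ->]].
- exact: (o_uniq I).
- exact: (o_ok I).
Qed.

Lemma cross_case X s t x Q' Tq Tl out :
  Inv S X ((x, (0%N, (s, t))) :: Q') (elems Tl) out ->
  s \in elems Tl -> t \in elems Tl -> cross s t x -> sa t < sa s ->
  avl Tq -> avl Tl -> elems Tq = Q' ->
  let st := cross_step x s t Tq Tl out in
  SInv S x st /\
  ((epot (elems st.1) <= epot Q')%N /\ st.2.2 = out \/
   (epot (elems st.1) <= epot Q' + 2)%N /\ st.2.2 = (s, t) :: out).
Proof.
move=> I + + c sl aq al eT; set L := elems Tl in I * => sL tL.
have hs := L_S I sL; have htS := L_S I tL.
have hmin f : f \in (x, (0%N, (s, t))) :: Q' -> x <= f.1 by apply: (queue_min_x I).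
have hX : X <= x by have := q_ge I (mem_head _ _).
have hg := advance Sok I hX hmin.
have /and5P[s1 s2 t1 t2 /andP[/eqP ey ne]] := c.
have st : s != t by apply: contraNneq ne => ->.
have hl u : u \in L -> sxl u <= x by move=> hu; apply: le_trans hX; apply: (l_left I).
have hr u : u \in L -> x <= sxr u by move=> /(L_right I) /hmin.
have only u : u \in L -> u != s -> u != t -> yat u x <> yat s x.
  move=> hu us ut; apply: (cross_only Sok hs htS (L_S I hu) st us ut c).
  by rewrite hl // hr.
have sQ : sorted (@ev_le R) (elems Tq).
  by rewrite eT; have /= := q_sorted I; apply: path_sorted.
have uL := l_uniq I; rewrite -/L in uL.
have neL u : (left_event u == (x, (0%N, (s, t)))) = false by apply/eqP => -[].
have neR u : (right_event u == (x, (0%N, (s, t)))) = false by apply/eqP => -[].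
have mkeep u : (u \in L) = [&& u \in S, left_event u \notin Q' & right_event u \in Q'].
  by rewrite (l_mem I) !inE neL neR.
have done0 u v y : u \in S -> v \in S -> right_event u \notin Q' -> cross u v y ->
    ((u, v) \in out) || ((v, u) \in out).
  by move=> hu hv h; apply: (o_done I hu hv); rewrite inE neR.
have old0 u v : (u, v) \in out -> left_event u \notin Q' /\ left_event v \notin Q'.
  by move=> /(o_old I); rewrite !inE !neL.
(* the case of a crossing that has been processed before *)
have [A [B [eL|eL]]] : exists A B, L = A ++ s :: t :: B \/ L = A ++ t :: s :: B.
  (* The two segments are neighbours, in one order or the other: a segment between them would pass
     through their crossing point, against [cross_only]. *)
  have [l1 [l2 e]] := mem_split sL; move: tL; rewrite e mem_cat inE eq_sym (negbTE st) /=.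
  move=> /orP[] /mem_split[l3 [l4 e']].
    exists l3, l2; right; rewrite e' -catA /=; congr (_ ++ _ :: _).
    case: l4 e' => [|u l4] e' //; exfalso.
    move: hg; rewrite e e' -catA => /pw_cat[_ /= [h1 [h2 _]] _].
    have g1 : good x t u by apply: h1; rewrite mem_head.
    have g2 : good x u s by apply: h2; rewrite mem_cat mem_head orbT.
    have uLL : u \in L by rewrite e e' -catA mem_cat /= !inE eqxx !orbT.
    move: uL; rewrite e e' -catA cat_uniq /= => /and3P[_ _ /and3P[n1 n2 _]].
    apply: (only u uLL).
    + by apply: contraNneq n2 => ->; rewrite mem_cat mem_head orbT.
    + by apply: contraNneq n1 => ->; rewrite mem_head.
    + by have := good_le g1; have := good_le g2; lra.
  exists l1, l4; left; rewrite e' /=; congr (_ ++ _ :: _).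
  case: l3 e' => [|u l3] e' //; exfalso.
  move: hg; rewrite e e' => /pw_cat[_ /= [h1 [h2 _]] _].
  have g1 : good x s u by apply: h1; rewrite mem_head.
  have g2 : good x u t by apply: h2; rewrite mem_cat mem_head orbT.
  have uLL : u \in L by rewrite e e' mem_cat /= !inE eqxx !orbT.
  move: uL; rewrite e e' cat_uniq /= => /and3P[_ _ /and3P[n1 n2 _]].
  apply: (only u uLL).
  + by apply: contraNneq n1 => ->; rewrite mem_head.
  + by apply: contraNneq n2 => ->; rewrite mem_cat mem_head orbT.
  + by have := good_le g1; have := good_le g2; lra.
all: have [nsA ntA nsB ntB] : [/\ s \notin A, t \notin A, s \notin B & t \notin B]
  by move: uL; rewrite eL cat_uniq /= !inE !negb_or => /and3P[_ /and3P[-> -> _] /and3P[/andP[_ ->] -> _]].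
all: have memL u : (u \in L) = [|| u == s, u == t, u \in A | u \in B]
  by rewrite eL mem_cat !inE; do !case: (_ == _); do !case: (u \in _).
have hAsB : (forall u, u \in A -> good x u s) /\ (forall u, u \in B -> good x s u).
  move: hg; rewrite eL => /pw_cat[_ /= [h1 _] h2]; split=> u hu.
    by apply: h2; rewrite ?mem_head.
  by apply: h1; rewrite inE hu orbT.
2: have hAsB : (forall u, u \in A -> good x u s) /\ (forall u, u \in B -> good x s u).
2: {
  move: hg; rewrite eL => /pw_cat[_ /= [_ [h1 _]] h2]; split=> u hu; last exact: h1.
  by apply: h2; rewrite // !inE eqxx orbT. }
all: have [hAs hsB] := hAsB.
all: have ltA u : u \in A -> yat u x < yat s x
  by move=> hu; have := good_le (hAs _ hu); rewrite le_eqVlt => /orP[/eqP e|//];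
     case: (only u _ _ _ e); rewrite ?memL ?hu ?orbT //; [apply: contraNneq nsA|apply: contraNneq ntA] => <-.
all: have gtB u : u \in B -> yat s x < yat u x
  by move=> hu; have := good_le (hsB _ hu); rewrite le_eqVlt => /orP[/eqP e|//];
     case: (only u _ _ _ (esym e)); rewrite ?memL ?hu ?orbT //; [apply: contraNneq nsB|apply: contraNneq ntB] => <-.
all: have pA : all (below_del (x, s)) A by apply/allP => u /ltA h; rewrite below_delE h.
all: have nB : all (predC (below_del (x, s))) B
  by apply/allP => u /gtB h; rewrite /= below_delE negb_or -leNgt ltW //= (gt_eqF h).
(* First treatment of the crossing: both segments are removed in the order left of [x] and come back
   in the order right of [x], that is, exchanged. *)
- have pB : all (predC (below_del (x, s))) (s :: t :: B).
    by rewrite /= nB andbT !below_delE !ltxx !eqxx /= -ey ltxx eqxx /= -leNgt ltW.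
  have [L1 d1 eL1] := del_split eL pA pB erefl.
  have [aL1 _] := del_avl al d1.
  have pA' : all (below_del (x, t)) A by apply/allP => u /ltA h; rewrite below_delE -ey h.
  have nB' : all (predC (below_del (x, t))) (t :: B).
    rewrite /= below_delE !ltxx eqxx /=.
    by apply/allP => u /gtB h; rewrite /= below_delE -ey negb_or -leNgt ltW //= (gt_eqF h).
  have [L2 d2 eL2] := del_split eL1 pA' nB' erefl.
  have [aL2 _] := del_avl aL1 d2.
  rewrite /cross_step d1 /= leqnn d2 /=.
  have qA : all (below_ins (x, t)) A by apply/allP => u /ltA h; rewrite below_insE -ey h.
  have qB : all (predC (below_ins (x, t))) B.
    by apply/allP => u /gtB h; rewrite /= below_insE -ey negb_or -leNgt ltW //= (gt_eqF h).
  have rA : all (below_ins (x, s)) A by apply/allP => u /ltA h; rewrite below_insE h.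
  have rB : all (predC (below_ins (x, s))) B.
    by apply/allP => u /gtB h; rewrite /= below_insE negb_or -leNgt ltW //= (gt_eqF h).
  have eL3 := ins_split eL2 rA rB s.
  have qB' : all (predC (below_ins (x, t))) (s :: B).
    by rewrite /= qB andbT below_insE -ey ltxx eqxx /= -leNgt ltW.
  have eL4 := ins_split eL3 qA qB' t.
  have aL3 : avl (ins (below_ins (x, s)) s L2) by case: (ins_avl (below_ins (x, s)) s aL2).
  have aL4 : avl (ins (below_ins (x, t)) t (ins (below_ins (x, s)) s L2)).
    by case: (ins_avl (below_ins (x, t)) t aL3).
  rewrite (last_sat_split eL2 qA qB) (first_unsat_split eL2 qA qB).
  have := extends_pusho (ohead (rev A)) (Some t)
    (extends_pusho (Some s) (ohead B) (extends0 aq sQ)).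
  rewrite cats0; set N := opair _ _ ++ opair _ _ => ext.
  split; last first.
    right; split=> //; apply: leq_trans (extends_epot ext) _; rewrite eT leq_add2l.
    by rewrite size_cat (leq_add (opair_size _ _) (opair_size _ _)).
  have [aT'' _ _] := ext.
  split=> //=; rewrite eL4.
  have memL' u : (u \in A ++ t :: s :: B) = (u \in L).
    by rewrite memL mem_cat !inE; do !case: (_ == _); do !case: (u \in _).
  have gAB := hg; rewrite eL in gAB.
  have [gA gsB gAsB] := iffLR (pw_cat _ _ _) gAB.
  have [gst [gtB' gB]] := gsB.
  apply: (Inv_step I eT ext).
  + move=> u v; rewrite mem_cat => /orP[/opair_mem[/ohead_rev_mem hu [<-]]|/opair_mem[[<-] /ohead_mem hv]].
      rewrite !memL' tL (memL u) hu !orbT; split=> //=.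
      by rewrite -ey ltW // ltA.
    rewrite !memL' sL (memL v) hv !orbT; split=> //=.
    by rewrite ltW // gtB.
  + by move=> u v y _ hu hv _; rewrite !memL' hu hv.
  + by move=> u _ _; rewrite neR.
  + by move=> u; rewrite memL' mkeep.
  + rewrite -(perm_uniq (_ : perm_eq L _)) //; rewrite eL perm_cat2l.
    by rewrite -[s :: t :: B]/([:: s; t] ++ B) -[t :: s :: B]/([:: t; s] ++ B) perm_cat2r
      perm_sym (perm_catC [:: t] [:: s]).
  + by move=> u v; rewrite !memL' => hu hv; apply: (l_x I).
  + by move=> u; rewrite memL' => /hl.
  + have gAB0 : pw (good x) (A ++ B) by move: gAB => /pw_ins[/pw_ins[]].
    apply/pw_ins; split.
    * apply/pw_ins; split=> //.
    * by move=> u hu; apply: gAsB => //; rewrite !inE eqxx orbT.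
    * move=> u; rewrite inE => /orP[/eqP ->|hu]; last exact: gtB'.
      by right; split=> //; apply: Or32; rewrite cross_sym.
  + move=> l1 u v l2 y /adj_ins[[l e]|[h1 ->]|[-> /= [<-]]|[l e]] sl' c'.
    * have := l_adj I (A := l1) (s := u) (t := v) (B := l ++ s :: t :: B) _ sl' c'.
      rewrite -/L eL e -!catA /= inE => /(_ erefl) /orP[/eqP[_ us _]|->]; last by right.
      by move: nsA; rewrite e -us mem_cat mem_head orbT.
    * by left; rewrite /N h1 /= mem_head.
    * by move: sl'; rewrite ltNge ltW.
    * case: (@adj_ins _ [::] B l l2 s u v e) => [[l' e']|[//]|[-> h2]|[l' e']]; first by case: l {e} e'.
        by left; rewrite /N h2 mem_cat /= mem_head orbT.
      have := l_adj I (A := A ++ s :: t :: l') (s := u) (t := v) (B := l2) _ sl' c'.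
      rewrite -/L eL e' -!catA /= inE => /(_ erefl) /orP[/eqP[_ us _]|->]; last by right.
      by move: nsB; rewrite e' -us mem_cat mem_head orbT.
  + have := o_pw I; rewrite -/L eL => /pw_ins[/pw_ins[j1 j2 j3] j4 j5].
    have up u v (J := fun o => (u, v) \notin o /\ (forall y, cross u v y -> sa u < sa v -> (v, u) \in o)) :
        J out -> u != s \/ v != t -> J ((s, t) :: out).
      case=> k1 k2 h; split; last by move=> y c1 c2; rewrite inE (k2 y) ?orbT.
      rewrite inE negb_or k1 andbT; apply/eqP => -[us vt].
      by move: h; rewrite us vt !eqxx; case.
    apply/pw_ins; split; first (apply/pw_ins; split).
    * apply: pw_impl j1 => u v hu hv j; apply: up j _; left.
      by move: hu; rewrite mem_cat; apply: contraTneq => ->; rewrite negb_or nsA nsB.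
    * by move=> u hu; apply: up (j4 _ hu) _; right.
    * move=> u hu; apply: up _ _; first by apply: j5; rewrite inE hu orbT.
      by right; apply: contraNneq ntB => <-.
    * by move=> u hu; apply: up (j2 _ hu) _; left; apply: contraNneq nsA => <-.
    * move=> u; rewrite inE => /orP[/eqP ->|hu].
        split; last by move=> *; rewrite mem_head.
        rewrite inE negb_or; apply/andP; split.
          by apply/eqP => -[ts _]; rewrite ts eqxx in st.
        by apply/negP => /(o_ok I)[_ _ lt _]; move: sl; rewrite ltNge ltW.
      by apply: up (j3 _ hu) _; left; rewrite eq_sym.
  + by move=> u v y hu hv h c'; rewrite !inE; have := done0 _ _ _ hu hv h c'; case/orP=> ->; rewrite !orbT.
  + move=> u v; rewrite inE => /orP[/eqP[-> ->]|/old0//].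
    by move: sL tL; rewrite !mkeep => /and3P[_ -> _] /and3P[_ -> _].
  + rewrite /= (o_uniq I) andbT.
    by have := o_pw I; rewrite -/L eL => /pw_ins[_ _ /(_ t (mem_head _ _))[]].
  + move=> u v; rewrite inE => /orP[/eqP[-> ->]|/(o_ok I)//].
    by split=> //; exists x.
(* Repeated event: the first element not below [s] is [t], whose identifier differs. *)
- have pB : all (predC (below_del (x, s))) (t :: s :: B).
    by rewrite /= nB andbT !below_delE !ltxx !eqxx /= -ey ltxx eqxx /= -leNgt ltW.
  have [L1 d1 eL1] := del_split eL pA pB erefl.
  have -> : cross_step x s t Tq Tl out = (Tq, (Tl, out)).
    rewrite /cross_step d1 /=; case: leqP => // h1; case: leqP => // h2.
    have e : sid s = sid t by apply/eqP; rewrite eqn_leq h1 h2.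
    by move: st; rewrite (S_inj Sok hs htS e) eqxx.
  split; last by left; rewrite /= eT.
  split=> //=; apply: (Inv_step I eT (extends0 aq sQ)) => //.
  + by move=> u _ _; rewrite neR.
  + exact: (l_x I).
  + move=> l1 u v l2 y e sl' c'; right.
    have := l_adj I e sl' c'; rewrite inE => /orP[/eqP[_ us vt]|//]; exfalso.
    move: e; rewrite us vt -/L eL => /adj_cat[[l e]|[h _]|[[|a [|b l]] /=]].
    * by move: nsA; rewrite e mem_cat mem_head orbT.
    * by move: nsA; rewrite (ohead_rev_mem h).
    * by case=> ts; rewrite ts eqxx in st.
    * by case=> _ eB; move: ntB; rewrite eB mem_head.
    * by case=> _ _ eB; move: nsB; rewrite eB mem_cat mem_head orbT.
  + exact: (o_pw I).
  + exact: (o_uniq I).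
  + exact: (o_ok I).
Qed.

End SweepStep2.

Arguments left_step : simpl never.
Arguments right_step : simpl never.
Arguments cross_step : simpl never.

(** * Termination and correctness of the sweep *)

Section SweepSpec.
Variable R : realType.
Local Open Scope ring_scope.
Local Notation seg := (seg R).
Local Notation event := (event R).
Variable S : seq seg.
Hypothesis Sok : segs_ok S.

Definition out_ok (out : seq (seg * seg)) : Prop :=
  uniq out /\ (forall s t, (s, t) \in out ->
    [/\ s \in S, t \in S, sa t < sa s & exists x, cross s t x]).

Variable K : nat.
Hypothesis hK : forall out, out_ok out -> (size out <= K)%N.

(** The first treatment of a crossing queues up to two new ones; they are paid for by the growth of
    the output, whose length [hK] bounds by [K], so that the truncated subtraction is exact. *)
Definition spot (st : state R) : nat := (epot (elems st.1) + 2 * (K - size st.2.2))%N.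

Lemma sweep_step_nil (st : state R) : elems st.1 = [::] -> sweep_step st = st.
Proof.
rewrite /sweep_step; have := elems_popmin st.1.
by case: (popmin st.1) => [[m t']|] //= ->.
Qed.

Lemma Inv_out_ok X Q L out : Inv S X Q L out -> out_ok out.
Proof. by move=> I; split; [exact: o_uniq I|exact: o_ok I]. Qed.

Lemma sweep_step_inv X (st : state R) : SInv S X st -> elems st.1 <> [::] ->
  exists X', SInv S X' (sweep_step st) /\ (spot (sweep_step st) < spot st)%N.
Proof.
case: st => [Tq [Tl out]] [/= aq al I] ne; rewrite /sweep_step /=.
have := elems_popmin Tq; case e : (popmin Tq) => [[m Tq']|] //= eQ.
have [aq' _] := popmin_avl aq e.
rewrite eQ in I; rewrite /spot /= eQ.
have := q_kind I (mem_head _ _).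
case=> [[s hs em]|[s hs em]|[s [t [x [em hs ht c sl]]]]]; rewrite em in I *; rewrite /=.
- have [h1 [h2 h3]] := left_case Sok I hs aq' al erefl.
  exists (sxl s); split; first exact: h1.
  move: h2; rewrite /left_step /= /epot /=; lia.
- have [h1 [h2 h3]] := right_case Sok I hs aq' al erefl.
  exists (sxr s); split; first exact: h1.
  move: h2 h3; case: (right_step _ _ _ _ _) {h1} => [Q1 [L1 o1]] /= + ->; rewrite /epot /=; lia.
- have [h1 h2] := cross_case Sok I hs ht c sl aq' al erefl.
  exists x; split; first exact: h1.
  have [_ _ /Inv_out_ok/hK] := h1; move: h2.
  case: (cross_step _ _ _ _ _ _) {h1} => [Q1 [L1 o1]] /= [[+ ->]|[+ ->]]; rewrite /epot /=; lia.
Qed.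

Lemma sweep_fold (T : Type) (fuel : seq T) X (st : state R) : SInv S X st ->
  exists X', SInv S X' (foldl (fun st _ => sweep_step st) st fuel) /\
    (spot (foldl (fun st _ => sweep_step st) st fuel) <= spot st)%N /\
    ((spot st <= size fuel)%N -> elems (foldl (fun st _ => sweep_step st) st fuel).1 = [::]).
Proof.
elim: fuel X st => [|f fuel IH] X st I /=.
  exists X; split=> //; split=> //; rewrite /spot /epot; case: (elems st.1) => //= a l; lia.
case: (elems st.1 =P [::]) => [e|ne].
  rewrite sweep_step_nil //; have [X' [h1 [h2 h3]]] := IH _ _ I.
  exists X'; split=> //; split=> // _; elim: fuel {IH h1 h2 h3} => //= a l.
  by rewrite sweep_step_nil.
have [X1 [I1 lt]] := sweep_step_inv I ne.
have [X' [h1 [h2 h3]]] := IH _ _ I1.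
exists X'; split=> //; split; first by lia.
by move=> h; apply: h3; lia.
Qed.

Lemma init_queue_spec (l : seq seg) (T : tree event) : avl T -> sorted (@ev_le R) (elems T) ->
  let T' := foldl (fun Q s => enqueue (right_event s) (enqueue (left_event s) Q)) T l in
  [/\ avl T', sorted (@ev_le R) (elems T') &
     perm_eq (elems T') (map (@left_event R) l ++ map (@right_event R) l ++ elems T)].
Proof.
elim: l T => [|s l IH] T aT sT //=.
have [s1 p1] := elems_enqueue (left_event s) sT.
have [s2 p2] := elems_enqueue (right_event s) s1.
have [a1 _] := ins_avl (ev_before (left_event s)) (left_event s) aT.
have [a2 _] := ins_avl (ev_before (right_event s)) (right_event s) a1.
have [h1 h2 h3] := IH _ a2 s2.
split=> //; apply: (perm_trans h3); apply/permP => p; move/permP: p1 => /(_ p).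
move/permP: p2 => /(_ p); rewrite /= !count_cat /= !count_cat /enqueue => -> ->.
have arith (cl cr r' l' c : nat) : (cl + (cr + (r' + (l' + c))) = l' + (cl + (r' + (cr + c))))%N by lia.
exact: arith.
Qed.

Lemma lower_bound_ex (l : seq seg) : exists X : R, forall s, s \in l -> X <= sxl s.
Proof.
elim: l => [|s l [X IH]]; first by exists 0.
exists (Num.min X (sxl s)) => u; rewrite inE => /orP[/eqP ->|/IH h].
  by rewrite ge_min lexx orbT.
by rewrite ge_min h.
Qed.

Lemma init_inv : exists X, SInv S X (init_queue S, (Lf, [::])).
Proof.
have [X hX] := lower_bound_ex S; exists X.
have [h1 h2] := @init_queue_spec S Lf isT isT.
rewrite -/(init_queue S) cats0 => p.
have mQ e : (e \in elems (init_queue S)) = (e \in map (@left_event R) S) || (e \in map (@right_event R) S).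
  by rewrite (perm_mem p) mem_cat.
have lS s : s \in S -> left_event s \in elems (init_queue S).
  by move=> hs; rewrite mQ map_f.
have rS s : s \in S -> right_event s \in elems (init_queue S).
  by move=> hs; rewrite mQ map_f ?orbT.
split=> //=; split=> //=.
- move=> e; rewrite mQ => /orP[] /mapP[s hs ->] /=; first exact: hX.
  by apply: le_trans (hX _ hs) (ltW (S_lr Sok hs)).
- by move=> e; rewrite mQ => /orP[] /mapP[s hs ->]; [apply: Or31|apply: Or32]; exists s.
- apply: filter_uniq; rewrite (perm_uniq p) cat_uniq.
  have us : uniq S by case: Sok.
  rewrite !map_inj_uniq ?us ?andbT /=; try by move=> s t [].
  by apply/hasPn => e /mapP[s hs ->]; apply/mapP => -[t _ []].
- by move=> s hs _; apply: rS.
- by move=> s; case hs: (s \in S) => //=; rewrite lS.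
- by move=> [].
- by move=> s t x hs ht; rewrite rS.
Qed.

(** Each segment contributes a left event of weight 3 and a right event of weight 2. *)
Lemma init_spot : (spot (init_queue S, (Lf, [::])) <= 5 * size S + 2 * K)%N.
Proof.
have [_ _ p] := @init_queue_spec S Lf isT isT.
rewrite /spot /= subn0 leq_add2r /epot.
rewrite -/(init_queue S) in p.
rewrite (perm_size p) (permP p (fun e => e.2.1 == 2%N)) (permP p (fun e => e.2.1 == 1%N)).
have cT (a : pred event) (f : seg -> event) (l : seq seg) : (forall s, a (f s)) -> count a (map f l) = size l.
  by move=> h; rewrite -(size_map f); apply/eqP; rewrite -all_count; apply/allP => e /mapP[s _ ->].
have cF (a : pred event) (f : seg -> event) (l : seq seg) : (forall s, ~~ a (f s)) -> count a (map f l) = 0%N.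
  by move=> h; elim: l => //= s l ->; rewrite (negbTE (h s)).
rewrite !cats0 size_cat !size_map !count_cat.
rewrite (cT _ (@left_event R)) // (cF _ (@right_event R)) // (cF _ (@left_event R)) // (cT _ (@right_event R)) //.
have arith a k : (a + a + 2 * (a + 0) + (0 + a) + 2 * k <= 5 * a + 2 * k)%N by lia.
by rewrite -(leq_add2r (2 * K)); exact: arith.
Qed.

(** When the queue is empty all right events are past, and [o_done] covers every crossing. *)
Lemma sweep_spec fuel : (5 * size S + 2 * K <= size fuel)%N ->
  out_ok (sweep fuel S) /\ forall s t x, s \in S -> t \in S -> cross s t x ->
    ((s, t) \in sweep fuel S) || ((t, s) \in sweep fuel S).
Proof.
move=> hf; have [X I] := init_inv; have [X' [I' [_ h]]] := sweep_fold fuel I.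
have e : elems (foldl (fun st _ => sweep_step st) (init_queue S, (Lf, [::])) fuel).1 = [::].
  exact: h (leq_trans init_spot hf).
have [_ _ J] := I'; split; first exact: Inv_out_ok J.
move=> s t x hs ht c.
by apply: (o_done J hs ht _ c); rewrite e.
Qed.

End SweepSpec.

(** * Running time of the sweep *)

Section SweepCost.
Variable R : realType.
Local Notation seg := (seg R).
Local Notation event := (event R).

Lemma Comp_ev_before : Comp (fun q : event * event => ev_before q.1 q.2) (fun=> 0).
Proof. rewrite /ev_before /ev_le; comp0. Qed.

Lemma Comp_below_ins : Comp (fun q : (R * seg) * seg => below_ins q.1 q.2) (fun=> 0).
Proof. rewrite /below_ins /yat /sa /sb; comp0. Qed.

Lemma Comp_below_del : Comp (fun q : (R * seg) * seg => below_del q.1 q.2) (fun=> 0).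
Proof. rewrite /below_del /yat /sa /sb; comp0. Qed.

Lemma Comp_enqueue : Comp (fun q : event * tree event => enqueue q.1 q.2) (fun q => depth q.2).
Proof.
by rewrite /enqueue; apply: Comp_le 1 _ _;
  last (eapply (Comp_ins Comp_ev_before); comp); move=> q /=; lia.
Qed.

Lemma Comp_push : Comp (fun q : seg * (seg * tree event) => push q.1 q.2.1 q.2.2)
  (fun q => depth q.2.2).
Proof.
have hm : Comp (fun q : seg * seg => meet_x q.1 q.2) (fun=> 0).
  by rewrite /meet_x /sb /sa; comp0.
rewrite /push; apply: Comp_le 1 _ _; last first.
  rewrite /sa /sxl /sxr.
  eapply Comp_if; [comp|comp|eapply Comp_bind; [comp|]].
  do 4 (eapply Comp_if; [comp|comp|]).
  by eapply (Comp_fun2 Comp_enqueue); comp.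
move=> q /=; repeat (case: ifP => _ /=); lia.
Qed.

Lemma Comp_pusho : Comp (fun q : option seg * (option seg * tree event) => pusho q.1 q.2.1 q.2.2)
  (fun q => depth q.2.2).
Proof.
rewrite /pusho; apply: Comp_le 1 _ _; last first.
  by eapply Comp_ocase; [comp|comp|eapply Comp_ocase; [comp|comp|eapply (Comp_fun3 Comp_push); comp]].
move=> [s [t Q]] /=; case: s => [s|] /=; last lia.
case: t => [t|] /=; lia.
Qed.

Lemma depth_push (s t : seg) Q : (depth (push s t Q) <= 2 * depth Q + 2)%N.
Proof.
rewrite /push /bind; do 5 (case: ifP => _; first lia).
exact: depth_ins.
Qed.

Lemma depth_pusho (s t : option seg) Q : (depth (pusho s t Q) <= 2 * depth Q + 2)%N.
Proof.
by case: s => [s|] /=; [case: t => [t|] /=; [exact: depth_push|]|]; lia.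
Qed.

Local Notation args := (R * (seg * (tree event * (tree seg * seq (seg * seg)))))%type.

Lemma Comp_right_step :
  Comp (fun q : args => right_step q.1 q.2.1 q.2.2.1 q.2.2.2.1 q.2.2.2.2)
    (fun q => depth q.2.2.1 + depth q.2.2.2.1)%N.
Proof.
rewrite /right_step; apply: Comp_le 9 _ _; last first.
  eapply Comp_ocase; [eapply (Comp_del Comp_below_del); comp|comp|].
  eapply Comp_pair; [|comp].
  eapply (Comp_fun3 Comp_pusho); [eapply (Comp_last_sat Comp_below_del); comp|
    eapply (Comp_first_unsat Comp_below_del); comp|comp].
move=> [x [s [Q [L out]]]] /=; case e : (del _ _) => [[u L']|] /=; last lia.
by have := depth_del e; lia.
Qed.

Lemma Comp_left_step :
  Comp (fun q : args => left_step q.1 q.2.1 q.2.2.1 q.2.2.2.1 q.2.2.2.2)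
    (fun q => depth q.2.2.1 + depth q.2.2.2.1)%N.
Proof.
rewrite /left_step; apply: Comp_le 9 _ _; last first.
  eapply Comp_pair; [|eapply Comp_pair; [eapply (Comp_ins Comp_below_ins); comp|comp]].
  eapply (Comp_fun3 Comp_pusho); [eapply (Comp_last_sat Comp_below_ins); comp|comp|].
  eapply (Comp_fun3 Comp_pusho); [comp|eapply (Comp_first_unsat Comp_below_ins); comp|comp].
move=> [x [s [Q [L out]]]] /=.
set o := first_unsat _ _.
have := depth_pusho (Some s) o Q; rewrite /=; lia.
Qed.

(** Depths are followed without assuming balance: a deletion at most doubles the depth and an
    insertion adds 2 more, which only inflates the constant. *)
Lemma Comp_cross_step :
  Comp (fun q : seg * args => cross_step q.2.1 q.1 q.2.2.1 q.2.2.2.1 q.2.2.2.2.1 q.2.2.2.2.2)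
    (fun q => depth q.2.2.2.1 + depth q.2.2.2.2.1)%N.
Proof.
rewrite /cross_step; apply: Comp_le 60 _ _; last first.
  eapply Comp_ocase; [eapply (Comp_del Comp_below_del); comp|comp|].
  eapply Comp_if; [comp|eapply Comp_if; [comp| |comp]|comp].
  eapply Comp_ocase; [eapply (Comp_del Comp_below_del); comp|comp|].
  eapply Comp_pair; last first.
    eapply Comp_pair; [|comp].
    eapply (Comp_ins Comp_below_ins); [comp|comp|eapply (Comp_ins Comp_below_ins); comp].
  eapply (Comp_fun3 Comp_pusho); [eapply (Comp_last_sat Comp_below_ins); comp|comp|].
  eapply (Comp_fun3 Comp_pusho); [comp|eapply (Comp_first_unsat Comp_below_ins); comp|comp].
move=> [s [x [t [Q [L out]]]]] /=; case e1 : (del _ _) => [[u L1]|] /=; last lia.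
case: ifP => _; last lia.
case: ifP => _; last lia.
case e2 : (del _ _) => [[w L2]|] /=; last by have := depth_del e1; lia.
set o := first_unsat _ _; have := depth_pusho (Some s) o Q; rewrite /=.
have := depth_del e1; have := depth_del e2.
have := depth_ins (below_ins (x, s)) s L2; lia.
Qed.

Definition st_depth (st : state R) : nat := (depth st.1 + depth st.2.1)%N.

Lemma Comp_sweep_step : Comp (@sweep_step R) st_depth.
Proof.
have hc : Comp (fun a : state R * (event * tree event) =>
    (a.2.1.2.2.1, (a.2.1.1, (a.2.1.2.2.2, (a.2.2, (a.1.2.1, a.1.2.2)))))) (fun=> 0) by comp0.
have hlr : Comp (fun a : state R * (event * tree event) =>
    (a.2.1.1, (a.2.1.2.2.1, (a.2.2, (a.1.2.1, a.1.2.2))))) (fun=> 0) by comp0.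
rewrite /sweep_step; apply: Comp_le 9 _ _; last first.
  eapply Comp_ocase; [eapply Comp_popmin; comp|comp|].
  eapply Comp_if; [comp|exact: Comp_comp hc Comp_cross_step|].
  eapply Comp_if; [comp|exact: Comp_comp hlr Comp_right_step|exact: Comp_comp hlr Comp_left_step].
move=> [Q [L out]]; rewrite /st_depth /=; case e : (popmin Q) => [[m Q']|] /=; last lia.
by have := depth_popmin e; case: ifP => _ /=; [|case: ifP => _ /=]; lia.
Qed.

Lemma Comp_init_queue :
  Comp (@init_queue R) (fun S => fold_cost (fun Q s => enqueue (right_event s) (enqueue (left_event s) Q))
    (fun Q s => depth Q) Lf S).
Proof.
rewrite /init_queue.
have h : Comp (fun q : nat * (tree event * seg) =>
    enqueue (right_event q.2.2) (enqueue (left_event q.2.2) q.2.1)) (fun q => depth q.2.1).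
  apply: Comp_le 3 _ _; last first.
    eapply (Comp_fun2 Comp_enqueue); first by rewrite /right_event /sxr; comp.
    by eapply (Comp_fun2 Comp_enqueue); [rewrite /left_event /sxl; comp|comp].
  move=> [n [Q s]] /=; have := depth_ins (ev_before (left_event s)) (left_event s) Q.
  rewrite /enqueue; lia.
apply: Comp_le 1 _ _; last first.
  eapply (Comp_foldl (c := fun=> 0%N) (f := fun _ Q s => enqueue (right_event s) (enqueue (left_event s) Q)) h); comp.
by move=> S /=; lia.
Qed.

Lemma Comp_sweep :
  Comp (fun q : seq seg * seq seg => sweep q.1 q.2)
   (fun q => fold_cost (fun Q s => enqueue (right_event s) (enqueue (left_event s) Q))
    (fun Q s => depth Q) Lf q.2 +
     fold_cost (fun st (_ : seg) => sweep_step st) (fun st _ => st_depth st) (init_queue q.2, (Lf, [::])) q.1)%N.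
Proof.
rewrite /sweep.
have h : Comp (fun q : nat * (state R * seg) => sweep_step q.2.1) (fun q => st_depth q.2.1).
  have h0 : Comp (fun q : nat * (state R * seg) => q.2.1) (fun=> 0) by comp0.
  by apply: Comp_le 1 _ (Comp_comp h0 Comp_sweep_step) => q /=; lia.
have hq : Comp (fun q : seq seg * seq seg => q.2) (fun=> 0) by comp0.
apply: Comp_le 1 _ _; last first.
  eapply Comp_snd; eapply Comp_snd.
  eapply (Comp_foldl (c := fun=> 0%N) (f := fun _ st _ => sweep_step st) h); [comp| |comp].
  by eapply Comp_pair; [eapply (Comp_comp hq Comp_init_queue)|comp].
by move=> q /=; lia.
Qed.

End SweepCost.

(** * Optimal ratios on a rooted tree *)

Section Rose.
Variable R : realType.
Local Open Scope ring_scope.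

(* (id, (len, (ap, (bd, (long, (short, (glong, gshort))))))) for a node v with
   parent p: the value of the parent is at most ap or that of v is at most bd;
   long and short are the maximal inks of the subtree of v without a constraint
   on v and with values at most bd for v, and glong and gshort are values of v
   in optimal solutions. *)
Definition info : Type := (nat * (R * (R * (R * (R * (R * (R * R)))))))%type.

Inductive rose := RNode of info & seq rose.

Definition rinfo (r : rose) := let: RNode i _ := r in i.
Definition rchildren (r : rose) := let: RNode _ cs := r in cs.
Definition rid (r : rose) := (rinfo r).1.
Definition rap (r : rose) := (rinfo r).2.2.1.
Definition rbd (r : rose) := (rinfo r).2.2.2.1.
Definition rlong (r : rose) := (rinfo r).2.2.2.2.1.
Definition rshort (r : rose) := (rinfo r).2.2.2.2.2.1.
Definition rglong (r : rose) := (rinfo r).2.2.2.2.2.2.1.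
Definition rgshort (r : rose) := (rinfo r).2.2.2.2.2.2.2.

(** The generated principle has no induction hypothesis for the children, which are nested in a
    list. *)
Lemma rose_ind' (P : rose -> Prop) :
  (forall i cs, (forall c, List.In c cs -> P c) -> P (RNode i cs)) -> forall r, P r.
Proof.
move=> h; exact: (fix IH r := match r with RNode i cs => h i cs
  ((fix IHs cs := match cs return forall c, List.In c cs -> P c with
    | [::] => fun c f => False_ind _ f
    | c' :: cs' => fun c H => match H with
        | or_introl e => eq_ind _ P (IH c') _ e
        | or_intror H' => IHs cs' c H'
        end
    end) cs) end).
Qed.

Definition one_half : R := 1 / (1 + 1).

(** The best ink of a subtree whose root has ratio [g]: a root at or below the threshold of a child
    leaves this child free, otherwise the child has to respect its own bound. *)
Definition node_ink (len : R) (cs : seq rose) (g : R) : R :=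
  foldl (fun acc c => acc + (if g <= rap c then rlong c else rshort c)) (len * g + len * g) cs.

Definition best (len : R) (cs : seq rose) (b : R) : R * R :=
  foldl (fun gv c =>
    if rap c <= b then
      bind (node_ink len cs (rap c)) (fun v => if v <= gv.2 then gv else (rap c, v))
    else gv) (b, node_ink len cs b) cs.

Definition mkrose (id : nat) (len ap bd : R) (cs : seq rose) : rose :=
  bind (best len cs one_half) (fun l => bind (best len cs bd) (fun s =>
    RNode (id, (len, (ap, (bd, (l.2, (s.2, (l.1, s.1))))))) cs)).

Fixpoint allp (T : Type) (P : T -> Prop) (l : seq T) : Prop :=
  if l is x :: l' then P x /\ allp P l' else True.

Lemma allpP (T : Type) (P : T -> Prop) (l : seq T) : allp P l <-> (forall x, List.In x l -> P x).
Proof.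
elim: l => //= x l IH; split=> [[h /IH h'] y [<-|/h']|h] //.
by split; [apply: h; left|apply/IH => y hy; apply: h; right].
Qed.

Fixpoint rwf (r : rose) : Prop :=
  let: RNode i cs := r in
  [/\ RNode i cs = mkrose i.1 i.2.1 i.2.2.1 i.2.2.2.1 cs, 0 <= i.2.1,
      0 < i.2.2.1 <= one_half, 0 < i.2.2.2.1 <= one_half & allp rwf cs].

Fixpoint rnodes (r : rose) : seq (nat * R) :=
  let: RNode i cs := r in (i.1, i.2.1) :: flatten (map rnodes cs).

Fixpoint redges (r : rose) : seq (nat * (nat * (R * R))) :=
  let: RNode i cs := r in
  flatten (map (fun c => (i.1, (rid c, (rap c, rbd c))) :: redges c) cs).

Definition nfeas (h : nat -> R) (ns : seq (nat * R)) : Prop :=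
  forall n, n \in ns -> 0 < h n.1 <= one_half.
Definition efeas (h : nat -> R) (es : seq (nat * (nat * (R * R)))) : Prop :=
  forall e, e \in es -> h e.1 <= e.2.2.1 \/ h e.2.1 <= e.2.2.2.

Definition ink_of (h : nat -> R) (ns : seq (nat * R)) : R :=
  \sum_(n <- ns) (n.2 * h n.1 + n.2 * h n.1).

(** The traceback of the dynamic program: the ratio chosen at the parent decides which of the two
    stored optima a child uses. *)
Fixpoint rasg (r : rose) (b : bool) : seq (nat * R) :=
  let: RNode i cs := r in
  let g := if b then i.2.2.2.2.2.2.1 else i.2.2.2.2.2.2.2 in
  (i.1, g) :: flatten (map (fun c => rasg c (g <= rap c)) cs).

Lemma node_inkE len cs g :
  node_ink len cs g = len * g + len * g + \sum_(c <- cs) (if g <= rap c then rlong c else rshort c).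
Proof.
rewrite /node_ink; elim/last_ind: cs => [|cs c IH]; first by rewrite big_nil addr0.
by rewrite foldl_rcons IH big_rcons /= -!addrA; congr (_ + (_ + _)); rewrite addrC.
Qed.

Lemma ler_sum_In (T : Type) (l : seq T) (F G : T -> R) :
  (forall x, List.In x l -> F x <= G x) -> \sum_(x <- l) F x <= \sum_(x <- l) G x.
Proof.
elim: l => [|x l IH] h; first by rewrite !big_nil.
by rewrite !big_cons lerD //; [apply: h; left|apply: IH => y hy; apply: h; right].
Qed.

Lemma eq_sum_In (T : Type) (l : seq T) (F G : T -> R) :
  (forall x, List.In x l -> F x = G x) -> \sum_(x <- l) F x = \sum_(x <- l) G x.
Proof.
elim: l => [|x l IH] h; first by rewrite !big_nil.
by rewrite !big_cons h; [rewrite IH // => y hy; apply: h; right|left].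
Qed.

Definition best_step len cs b (gv : R * R) c :=
  if rap c <= b then
    bind (node_ink len cs (rap c)) (fun v => if v <= gv.2 then gv else (rap c, v))
  else gv.

Lemma best_fold len cs b l gv :
  gv.2 = node_ink len cs gv.1 -> 0 < gv.1 <= b -> (forall c, List.In c l -> 0 < rap c) ->
  let gv' := foldl (best_step len cs b) gv l in
  [/\ gv'.2 = node_ink len cs gv'.1, 0 < gv'.1 <= b, gv.2 <= gv'.2 &
    forall c, List.In c l -> rap c <= b -> node_ink len cs (rap c) <= gv'.2].
Proof.
elim: l gv => [|c l IH] gv e hgv hl //=.
have hl' : forall c, List.In c l -> 0 < rap c by move=> d hd; apply: hl; right.
have hc : 0 < rap c by apply: hl; left.
have [e1 h1 le1 ge1] : [/\ (best_step len cs b gv c).2 = node_ink len cs (best_step len cs b gv c).1,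
   0 < (best_step len cs b gv c).1 <= b, gv.2 <= (best_step len cs b gv c).2 &
   rap c <= b -> node_ink len cs (rap c) <= (best_step len cs b gv c).2].
  rewrite /best_step /bind; case: ifP => [h|/negbT h]; last first.
    by split=> // h'; rewrite h' in h.
  case: ifP => [h'|/negbT]; first by split.
  by rewrite -ltNge => h'; split=> //=; rewrite ?hc ?h ?ltW.
have [e2 h2 le2 ge2] := IH _ e1 h1 hl'.
split=> //; first exact: le_trans le1 le2.
move=> d [<-|hd] hb; last exact: ge2.
exact: le_trans (ge1 hb) le2.
Qed.

Lemma best_spec len cs b : 0 < b -> (forall c, List.In c cs -> 0 < rap c) ->
  [/\ (best len cs b).2 = node_ink len cs (best len cs b).1, 0 < (best len cs b).1 <= b,
    node_ink len cs b <= (best len cs b).2 &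
    forall c, List.In c cs -> rap c <= b -> node_ink len cs (rap c) <= (best len cs b).2].
Proof. by move=> hb hcs; apply: best_fold; rewrite //= hb lexx. Qed.

Lemma node_ink_mono len cs g g' : 0 <= len -> g <= g' ->
  (forall c, List.In c cs -> g <= rap c -> g' <= rap c) ->
  node_ink len cs g <= node_ink len cs g'.
Proof.
move=> hl hg h; rewrite !node_inkE lerD //; first by rewrite lerD // ler_wpM2l.
apply: ler_sum_In => c hc; case: ifP => [/(h _ hc) ->//|/negbT].
rewrite -ltNge => lt; have -> // : (g' <= rap c) = false.
by apply/negbTE; rewrite -ltNge (lt_le_trans lt hg).
Qed.

(* Raising g to the next threshold changes no comparison with a threshold, so
   the maximum is attained at a threshold or at the bound. *)
Lemma best_ub len cs b g : 0 <= len -> (forall c, List.In c cs -> 0 < rap c) ->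
  0 < g <= b -> node_ink len cs g <= (best len cs b).2.
Proof.
move=> hl hcs /andP[g0 gb].
have [_ _ h1 h2] := best_spec len (lt_le_trans g0 gb) hcs.
suff [g' [gg' hor hle hg']] : exists g', [/\ g <= g',
    g' = b \/ exists2 c, List.In c cs & g' = rap c, g' <= b &
    forall c, List.In c cs -> g <= rap c -> g' <= rap c].
  apply: (le_trans (node_ink_mono hl gg' hg')).
  by case: hor => [->|[c hc e]] //; rewrite e in hle *; exact: h2.
elim: (cs) => [|c l [g' [gg' hor hle hg']]]; first by exists b; split=> //; left.
case: (lerP g (rap c)) => hc; last first.
  exists g'; split=> //.
    by case: hor => [h|[d hd h]]; [left|right; exists d => //; right].
  by move=> d [<-|hd] h; [move: (lt_le_trans hc h); rewrite ltxx|apply: hg'].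
case: (lerP g' (rap c)) => hc'.
  exists g'; split=> //.
    by case: hor => [h|[d hd h]]; [left|right; exists d => //; right].
  by move=> d [<-|hd] h //; apply: hg'.
exists (rap c); split=> //.
- by right; exists c => //; left.
- exact: le_trans (ltW hc') hle.
- by move=> d [<-|hd] h //; apply: le_trans (ltW hc') (hg' _ hd h).
Qed.

Lemma rwfP i cs : rwf (RNode i cs) -> forall c, List.In c cs -> rwf c.
Proof. by case=> _ _ _ _ /allpP. Qed.

Lemma rwf_ap r : rwf r -> 0 < rap r <= one_half.
Proof. by case: r => i cs []. Qed.

Lemma ink_of_cons h n ns : ink_of h (n :: ns) = n.2 * h n.1 + n.2 * h n.1 + ink_of h ns.
Proof. by rewrite /ink_of big_cons. Qed.

Lemma ink_of_flatten h (T : Type) (f : T -> seq (nat * R)) l :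
  ink_of h (flatten (map f l)) = \sum_(x <- l) ink_of h (f x).
Proof.
elim: l => [|x l IH] /=; first by rewrite big_nil /ink_of big_nil.
by rewrite big_cons -IH /ink_of big_cat.
Qed.

Lemma In_flatten (T : Type) (U : eqType) (f : T -> seq U) l x y :
  List.In x l -> y \in f x -> y \in flatten (map f l).
Proof.
elim: l => //= a l IH [->|hx] hy; rewrite mem_cat ?hy //.
by rewrite (IH hx hy) orbT.
Qed.

Lemma flatten_In (T : Type) (U : eqType) (f : T -> seq U) l y :
  y \in flatten (map f l) -> exists2 x, List.In x l & y \in f x.
Proof.
elim: l => //= a l IH; rewrite mem_cat => /orP[h|/IH[x hx hy]]; first by exists a => //; left.
by exists x => //; right.
Qed.

(** For each child the constraint is met at the parent or at the child; in the second case the child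
    stays within its bound and the second half of the induction hypothesis applies. *)
Lemma rose_upper h r : rwf r -> nfeas h (rnodes r) -> efeas h (redges r) ->
  ink_of h (rnodes r) <= rlong r /\ (h (rid r) <= rbd r -> ink_of h (rnodes r) <= rshort r).
Proof.
elim/rose_ind': r => i cs IH w nf ef.
have hw := rwfP w; have [e l0 ap0 bd0 _] := w.
have nfc c : List.In c cs -> nfeas h (rnodes c).
  by move=> hc n hn; apply: nf; rewrite inE (In_flatten hc hn) orbT.
have efc c : List.In c cs -> efeas h (redges c).
  by move=> hc n hn; apply: ef; apply: (In_flatten hc); rewrite inE hn orbT.
have hap c : List.In c cs -> 0 < rap c by move=> /hw /rwf_ap /andP[].
have hi : 0 < h i.1 <= one_half by apply: (nf (i.1, i.2.1)); rewrite mem_head.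
have ub : ink_of h (rnodes (RNode i cs)) <= node_ink i.2.1 cs (h i.1).
  rewrite /= ink_of_cons node_inkE /= lerD2l ink_of_flatten; apply: ler_sum_In => c hc.
  have [h1 h2] := IH c hc (hw _ hc) (nfc _ hc) (efc _ hc).
  case: ifP => // /negbT hn; apply: h2.
  have : (i.1, (rid c, (rap c, rbd c))) \in redges (RNode i cs).
    by apply: (In_flatten hc); rewrite mem_head.
  by move=> /ef[/=|//]; rewrite (negbTE hn).
have el : rlong (RNode i cs) = (best i.2.1 cs one_half).2 by rewrite e.
have es : rshort (RNode i cs) = (best i.2.1 cs i.2.2.2.1).2 by rewrite e.
rewrite el es; split=> [|hb]; apply: le_trans ub _; apply: best_ub => //.
by move: hi hb => /andP[-> _] /= ->.
Qed.

Definition agrees (h : nat -> R) (a : seq (nat * R)) : Prop := forall p, p \in a -> h p.1 = p.2.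

Lemma rose_attained h r b : rwf r -> agrees h (rasg r b) ->
  [/\ nfeas h (rnodes r), efeas h (redges r),
      ink_of h (rnodes r) = (if b then rlong r else rshort r) & b || (h (rid r) <= rbd r)].
Proof.
elim/rose_ind': r b => i cs IH b w ag.
have hw := rwfP w; have [e l0 ap0 bd0 _] := w.
have hap c : List.In c cs -> 0 < rap c by move=> /hw /rwf_ap /andP[].
set g := if b then i.2.2.2.2.2.2.1 else i.2.2.2.2.2.2.2.
have hg : h i.1 = g by apply: (ag (i.1, g)); rewrite mem_head.
have ihc c (hc : List.In c cs) := IH c hc (g <= rap c) (hw _ hc)
  (fun p hp => ag p (mem_behead (In_flatten (f := fun c => rasg c (g <= rap c)) hc hp : p \in behead (rasg (RNode i cs) b)))).
set bb := if b then one_half else i.2.2.2.1.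
have bb0 : 0 < bb <= one_half.
  have h0 : 0 < one_half by apply: divr_gt0; lra.
  by rewrite /bb; move: bd0 h0; clear; case: b => // _ ->; rewrite lexx.
have /andP[bb1 bb2] := bb0.
have [b1 /andP[b2 b3] _ _] := best_spec i.2.1 bb1 hap.
have eg : g = (best i.2.1 cs bb).1.
  by rewrite /g /bb; have := congr1 rglong e; have := congr1 rgshort e; clear; case: b.
have ev : (if b then rlong (RNode i cs) else rshort (RNode i cs)) = (best i.2.1 cs bb).2.
  by rewrite /bb; have := congr1 rlong e; have := congr1 rshort e; clear; case: b.
split.
- move=> n; rewrite inE => /orP[/eqP -> /=|/flatten_In[c hc hn]].
    by rewrite hg eg b2 (le_trans b3 bb2).
  by have [h1 _ _ _] := ihc c hc; apply: h1.
- move=> f /flatten_In[c hc]; rewrite inE => /orP[/eqP -> /=|hf].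
    have [_ _ _] := ihc c hc; rewrite hg; case: (g <= rap c) => /= q; [by left|by right].
  by have [_ h2 _ _] := ihc c hc; apply: h2.
- rewrite ev b1 -eg node_inkE /= ink_of_cons hg; congr (_ + _).
  rewrite ink_of_flatten; apply: eq_sum_In => c hc.
  by have [_ _ -> _] := ihc c hc.
- by rewrite /rid /rbd /= hg eg; move: b3; rewrite /bb; clear; case: b.
Qed.

End Rose.
Arguments one_half {R}.

(** Amortised cost. A step beyond [B] is paid for by a decrease of [D] or by an increase of [A]; two
    functions avoid subtraction of naturals. The search uses [D], the assignment of ratios uses
    [A]. *)
Lemma fold_cost_potential S X (f : S -> X -> S) (t : S -> X -> nat) (I : S -> Prop)
    (A D : S -> nat) B s l :
  (forall s x, I s -> I (f s x) /\ (t s x + A s + D (f s x) <= A (f s x) + D s + B)%N) ->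
  I s -> (fold_cost f t s l + A s + D (foldl f s l) <= A (foldl f s l) + D s + B.+1 * size l)%N.
Proof.
move=> h; elim: l s => [|x l IH] s Is /=; first lia.
have [Is' h1] := h s x Is; have := IH _ Is'; rewrite mulnS; lia.
Qed.

Lemma fold_cost_bound S X (f : S -> X -> S) (t : S -> X -> nat) (I : S -> Prop) B s l :
  (forall s x, I s -> I (f s x) /\ (t s x <= B)%N) -> I s ->
  (fold_cost f t s l <= B.+1 * size l)%N.
Proof.
move=> h Is.
have H s' x : I s' -> I (f s' x) /\ (t s' x + 0 + 0 <= 0 + 0 + B)%N.
  by move=> /h -/(_ x)[? ?]; rewrite !addn0.
by have := fold_cost_potential (A := fun=> 0) (D := fun=> 0) l H Is; rewrite !addn0.
Qed.

Lemma fold_cost_all S X (f : S -> X -> S) (t : S -> X -> nat) B s l :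
  (forall s x, t s x <= B)%N -> (fold_cost f t s l <= B.+1 * size l)%N.
Proof. by move=> h; apply: (@fold_cost_bound _ _ _ _ (fun=> True)). Qed.

#[export] Instance enc_rose (R : realType) : Enc R (rose R) :=
  fix enc_rose r := let: RNode i cs := r in
    VP (enc i) (@enc_seq R (rose R) enc_rose cs).

Section RoseComp.
Variable R : realType.
Context {A : Type} {ea : Enc R A}.
Implicit Types (e : A -> rose R).

Lemma Comp_rinfo e t : Comp e t -> Comp (fun a => rinfo (e a)) t.
Proof.
move=> h; apply: (@Run_le _ _ _ _ (fun a => t a + 0)%N _ 1); first by move=> a; lia.
apply: Run_comp; last exact: (Run_fst (fun a => enc (rinfo (e a))) (fun a => enc (rchildren (e a)))).
by apply: Run_ext h => // a; case: (e a).
Qed.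

Lemma Comp_rchildren e t : Comp e t -> Comp (fun a => rchildren (e a)) t.
Proof.
move=> h; apply: (@Run_le _ _ _ _ (fun a => t a + 0)%N _ 1); first by move=> a; lia.
apply: Run_comp; last exact: (Run_snd (fun a => enc (rinfo (e a))) (fun a => enc (rchildren (e a)))).
by apply: Run_ext h => // a; case: (e a).
Qed.

Lemma Comp0_RNode (i : A -> info R) (cs : A -> seq (rose R)) :
  Comp i (fun=> 0) -> Comp cs (fun=> 0) -> Comp (fun a => RNode (i a) (cs a)) (fun=> 0).
Proof. exact: Run_pair. Qed.
End RoseComp.

Ltac comp0_user ::=
  lazymatch goal with
  | |- Comp (fun a => rinfo _) _ => eapply Comp_rinfo; comp0
  | |- Comp (fun a => rchildren _) _ => eapply Comp_rchildren; comp0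
  | |- Comp (fun a => Lf) _ => eapply Comp_Lf
  | |- Comp (fun a => RNode _ _) _ => eapply Comp0_RNode; [comp0|comp0]
  end.

Section RoseAlgo.
Variable R : realType.
Local Open Scope ring_scope.
Local Notation rose := (rose R).

Lemma Comp_node_ink :
  Comp (fun q : R * (seq rose * R) => node_ink q.1 q.2.1 q.2.2) (fun q => size q.2.1).
Proof.
rewrite /node_ink.
have h : Comp (fun q : R * (R * rose) => q.2.1 + (if q.1 <= rap q.2.2 then rlong q.2.2 else rshort q.2.2))
   (fun=> 0%N) by rewrite /rap /rlong /rshort; comp0.
apply: Comp_le 2 _ _; last first.
  by eapply (Comp_foldl (f := fun g acc c => acc + (if g <= rap c then rlong c else rshort c)) h); comp.
move=> q /=; set X := fold_cost _ _ _ _.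
have : (X <= 1 * size q.2.1)%N by apply: fold_cost_all.
lia.
Qed.

Definition best_ctx_step (c : R * (seq rose * R)) (gv : R * R) (r : rose) :=
  best_step c.1 c.2.1 c.2.2 gv r.

Lemma Comp_best :
  Comp (fun q : R * (seq rose * R) => best q.1 q.2.1 q.2.2) (fun q => (size q.2.1).+1 * size q.2.1)%N.
Proof.
have h : Comp (fun q : (R * (seq rose * R)) * ((R * R) * rose) => best_ctx_step q.1 q.2.1 q.2.2)
   (fun q => size q.1.2.1).
  rewrite /best_ctx_step /best_step /rap; apply: Comp_le 1 _ _; last first.
    eapply Comp_if; [comp|eapply Comp_bind; [eapply (Comp_fun3 Comp_node_ink); comp|comp]|comp].
  by move=> q /=; case: ifP => _ /=; lia.
rewrite -[fun q => best _ _ _]/(fun q : R * (seq rose * R) =>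
  foldl (best_ctx_step (q.1, (q.2.1, q.2.2))) (q.2.2, node_ink q.1 q.2.1 q.2.2) q.2.1).
apply: Comp_le 3 _ _; last first.
  eapply (Comp_foldl h); [comp| |comp].
  by eapply Comp_pair; [comp|eapply (Comp_fun3 Comp_node_ink); comp].
move=> q /=; set X := fold_cost _ _ _ _.
have : (X <= (size q.2.1).+1 * size q.2.1)%N by apply: fold_cost_all.
nia.
Qed.

Lemma Comp_mkrose :
  Comp (fun q : nat * (R * (R * (R * seq rose))) => mkrose q.1 q.2.1 q.2.2.1 q.2.2.2.1 q.2.2.2.2)
    (fun q => (size q.2.2.2.2).+1 * size q.2.2.2.2)%N.
Proof.
rewrite /mkrose; apply: Comp_le 3 _ _; last first.
  eapply Comp_bind; [eapply (Comp_fun3 Comp_best); [comp|comp|rewrite /one_half; comp]|].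
  by eapply Comp_bind; [eapply (Comp_fun3 Comp_best); comp|comp].
move=> q /=; lia.
Qed.

(** [rasg] branches, so linear recursion does not apply; an explicit list of pending subtrees with
    their flags replaces the recursion. *)
Definition asg_state : Type := (seq (rose * bool) * seq (nat * R))%type.

Definition asg_step (st : asg_state) : asg_state :=
  lcase st.1 st (fun rb w =>
    bind (if rb.2 then rglong rb.1 else rgshort rb.1) (fun g =>
      (foldl (fun w c => (c, g <= rap c) :: w) w (rchildren rb.1), (rid rb.1, g) :: st.2))).

Lemma Comp_asg_step :
  Comp asg_step (fun st => lcase st.1 0%N (fun rb _ => size (rchildren rb.1))).
Proof.
have h : Comp (fun q : R * (seq (rose * bool) * rose) => (q.2.2, q.1 <= rap q.2.2) :: q.2.1) (fun=> 0%N).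
  by rewrite /rap; comp0.
rewrite /asg_step; apply: Comp_le 2 _ _; last first.
  eapply Comp_lcase; [comp|comp|eapply Comp_bind; [rewrite /rglong /rgshort; comp|]].
  eapply Comp_pair; [|rewrite /rid; comp].
  by eapply (Comp_foldl (f := fun g w c => (c, g <= rap c) :: w) h); comp.
move=> [[|rb w] out] /=; first lia.
set X := fold_cost _ _ _ _.
have : (X <= 1 * size (rchildren rb.1))%N by apply: fold_cost_all.
lia.
Qed.

Definition asg_all (w : seq (rose * bool)) : seq (nat * R) :=
  flatten (map (fun rb => rasg rb.1 rb.2) w).

Lemma asg_push g cs w : perm_eq (asg_all (foldl (fun w c => (c, g <= rap c) :: w) w cs))
  (flatten (map (fun c => rasg c (g <= rap c)) cs) ++ asg_all w).
Proof.
elim: cs w => [|c cs IH] w //=; apply: perm_trans (IH _) _.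
by rewrite /asg_all /= perm_catCA catA.
Qed.

(** The entries still due together with those already written are invariant up to order, and each
    step moves one entry from the former to the latter. *)
Lemma asg_step_perm rb w out :
  let st := asg_step (rb :: w, out) in
  perm_eq (asg_all st.1 ++ st.2) (asg_all (rb :: w) ++ out) /\
  size (asg_all st.1) = (size (asg_all (rb :: w))).-1.
Proof.
case: rb => -[i cs] b.
pose g := if b then i.2.2.2.2.2.2.1 else i.2.2.2.2.2.2.2.
have p := asg_push g cs w.
have e : asg_all ((RNode i cs, b) :: w) =
  (i.1, g) :: (flatten (map (fun c => rasg c (g <= rap c)) cs) ++ asg_all w) by [].
have -> : asg_step ((RNode i cs, b) :: w, out) =
  (foldl (fun w c => (c, g <= rap c) :: w) w cs, (i.1, g) :: out) by [].
cbv zeta; rewrite e /fst /snd; split; last by rewrite (perm_size p).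
rewrite -[(i.1, g) :: out]/([:: (i.1, g)] ++ out) perm_catCA /= perm_cons.
by rewrite perm_cat2r.
Qed.

Lemma asg_fold (T : Type) (fuel : seq T) (st : asg_state) : (size (asg_all st.1) <= size fuel)%N ->
  let st' := foldl (fun st _ => asg_step st) st fuel in
  st'.1 = [::] /\ perm_eq st'.2 (asg_all st.1 ++ st.2).
Proof.
elim: fuel st => [|f fuel IH] [[|rb w] out] //=.
- by case: rb => -[i cs] b.
- by move=> _; apply: IH.
have [p sz] := asg_step_perm rb w out.
move=> h; have := IH (asg_step (rb :: w, out)); rewrite sz.
have -> : ((size (asg_all (rb :: w))).-1 <= size fuel)%N by lia.
by case=> // -> h'; split=> //; apply: perm_trans h' p.
Qed.

End RoseAlgo.

(** * Depth-first search of the intersection graph *)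

Section DfsDefs.
Variable R : realType.
Local Notation rose := (rose R).

(* (source, (target, (threshold on the source, (threshold on the target,
   length of the target)))) *)
Definition dedge : Type := (nat * (nat * (R * (R * R))))%type.

Definition dbefore (c : nat * nat) (e : dedge) : bool :=
  if (c.1 <= e.1)%N then if (e.1 <= c.1)%N then if (c.2 <= e.2.1)%N then false else true
    else false else true.

(** A vertex on the current search path: its identifier, length and two thresholds, and the trees of
    its finished children. *)
Definition frame : Type := ((nat * (R * (R * R))) * seq rose)%type.
Definition dstate : Type := (tree dedge * (seq frame * seq rose))%type.

Definition frame_rose (f : frame) : rose :=
  mkrose f.1.1 f.1.2.1 f.1.2.2.1 f.1.2.2.2 f.2.

Definition dpop (adj : tree dedge) (f : frame) (fs : seq frame) (done : seq rose) : dstate :=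
  bind (frame_rose f) (fun r =>
    lcase fs (adj, ([::], r :: done)) (fun f' fs' => (adj, ((f'.1, r :: f'.2) :: fs', done)))).

(** The reverse copy of the edge is deleted too, so the search never returns to the parent through
    it. *)
Definition dpush (e : dedge) (adj : tree dedge) (f : frame) (fs : seq frame)
    (done : seq rose) : dstate :=
  (ocase (del (dbefore (e.2.1, e.1)) adj) adj (fun q => q.2),
   (((e.2.1, (e.2.2.2.2, (e.2.2.1, e.2.2.2.1))), [::]) :: f :: fs, done)).

(** Edges are stored by source and then target, so the first one not before [(f.1.1, 0)] leaves the
    vertex [f.1.1], unless no edge does. *)
Definition dfs_step (st : dstate) : dstate :=
  lcase st.2.1 st (fun f fs =>
    ocase (ocase (del (dbefore (f.1.1, 0%N)) st.1) None
            (fun q => if (q.1.1 <= f.1.1)%N then Some q else None))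
      (dpop st.1 f fs st.2.2)
      (fun q => dpush q.1 q.2 f fs st.2.2)).

Definition dlt (e e' : dedge) : bool := dbefore (e'.1, e'.2.1) e.

Lemma dbeforeE c e : dbefore c e = (e.1 < c.1)%N || ((e.1 == c.1) && (e.2.1 < c.2)%N).
Proof. by rewrite /dbefore; case: ltngtP => //= _; case: ltngtP. Qed.

Lemma dlt_trans : transitive dlt.
Proof. move=> e2 e1 e3; rewrite /dlt !dbeforeE /=; lia. Qed.

Lemma dbefore_mono c (s : seq dedge) : sorted dlt s -> mono (dbefore c) s.
Proof.
rewrite (sorted_pairwise dlt_trans); apply: sub_pairwise => x y /=.
by rewrite /dlt !dbeforeE /= => h; apply/implyP; move: h; lia.
Qed.

Lemma dlt_uniq (s : seq dedge) : sorted dlt s -> uniq s.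
Proof.
apply: sorted_uniq; first exact: dlt_trans.
by move=> e; rewrite /dlt dbeforeE /=; lia.
Qed.

Lemma ddel_spec c (t : tree dedge) : avl t -> sorted dlt (elems t) ->
  if del (dbefore c) t is Some (m, t') then
    [/\ m \in elems t, ~~ dbefore c m & (forall x, x \in elems t -> ~~ dbefore c x -> x = m \/ dlt m x)] /\
    [/\ avl t', sorted dlt (elems t') & perm_eq (elems t) (m :: elems t')]
  else forall x, x \in elems t -> dbefore c x.
Proof.
move=> at_ st; have mm := dbefore_mono c st; have := elems_del mm.
have eL : elems t = filter (dbefore c) (elems t) ++ filter (predC (dbefore c)) (elems t).
  have := mm; move: (elems t); elim=> //= a l IH /andP[ha /IH {1}->].
  case: ifP => pa //=.
  have np : all (predC (dbefore c)) l by apply: sub_all ha => x /=; rewrite pa; case: (dbefore c x).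
  by have [-> ->] := filter_split (isT : all (dbefore c) [::]) np.
case e : (del (dbefore c) t) => [[m t']|].
  move=> [B [eB e']]; rewrite eB in eL.
  have p : perm_eq (elems t) (m :: elems t').
    by rewrite eL e' -[m :: B]/([:: m] ++ B) -[m :: _]/([:: m] ++ _) perm_catCA.
  have mB : m \in filter (predC (dbefore c)) (elems t) by rewrite eB mem_head.
  move: mB; rewrite mem_filter => /andP[nm mt].
  have [at' _] := del_avl at_ e.
  split; split=> //.
  - move=> x hx nx; have : x \in filter (predC (dbefore c)) (elems t) by rewrite mem_filter /= nx.
    rewrite eB inE => /orP[/eqP|hB]; [by left|right].
    have : sorted dlt (m :: B) by rewrite -eB; apply: sorted_filter st; exact: dlt_trans.
    by rewrite (sorted_pairwise dlt_trans) /= => /andP[/allP h _]; apply: h.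
  - apply: (subseq_sorted dlt_trans) st; rewrite e' [X in subseq _ X]eL.
    by apply: cat_subseq => //; apply: subseq_cons.
move=> eB x hx; move: hx; rewrite eL eB cats0 mem_filter => /andP[] //.
Qed.

End DfsDefs.

Section CycleLemma.
Variables (T : finType) (e e' : rel T).

(** A simple path of [e'] is closed by the edge [v w]; it has an inner vertex because [e'] does not
    contain that edge. *)
Lemma chord_cycle v w : symmetric e -> irreflexive e -> subrel e' e ->
  e v w -> ~~ e' v w -> connect e' v w -> exists2 c : seq T, ucycle e c & (2 < size c)%N.
Proof.
move=> sym irr sub evw nvw /connectP[p]; case/shortenP => q pq uq _ lw.
exists (v :: q).
  rewrite /ucycle uq andbT /= rcons_path (sub_path sub pq) /= -lw sym evw.
  by [].
case: q pq uq lw => [|x [|y q]] //=.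
- by move=> _ _ ew; move: evw; rewrite ew irr.
- by rewrite andbT => e'vx _ ew; move: nvw; rewrite ew e'vx.
Qed.

End CycleLemma.

Section DfsCorrect.
Variable R : realType.
Local Open Scope ring_scope.
Local Notation rose := (rose R).
Variables (m : nat) (eg : rel 'I_m) (al : 'I_m -> 'I_m -> R) (ln : 'I_m -> R).
Hypothesis eg_sym : symmetric eg.
Hypothesis eg_irr : irreflexive eg.
Hypothesis eg_acyclic : forall c : seq 'I_m, ucycle eg c -> (size c <= 2)%N.
Hypothesis al_ok : forall u w, eg u w -> 0 < al u w <= one_half.
Hypothesis ln_ok : forall u, 0 <= ln u.

Definition de (u w : 'I_m) : dedge R := (val u, (val w, (al u w, (al w u, ln w)))).
Definition te (u w : 'I_m) : nat * (nat * (R * R)) := (val u, (val w, (al u w, al w u))).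

Definition frame_nodes (f : frame R) : seq (nat * R) :=
  (f.1.1, f.1.2.1) :: flatten (map (@rnodes R) f.2).

Definition own_edges (f : frame R) : seq (nat * (nat * (R * R))) :=
  flatten (map (fun c => (f.1.1, (rid c, (rap c, rbd c))) :: redges c) f.2).

(** Consecutive frames are joined by a tree edge that becomes a link to a child only when the upper
    frame is popped. *)
Fixpoint frames_edges (fs : seq (frame R)) : seq (nat * (nat * (R * R))) :=
  if fs is f :: fs' then
    own_edges f ++ (if fs' is f' :: _ then [:: (f'.1.1, (f.1.1, (f.1.2.2.1, f.1.2.2.2)))] else [::])
      ++ frames_edges fs'
  else [::].

Definition dnodes (fs : seq (frame R)) (done : seq rose) : seq (nat * R) :=
  flatten (map frame_nodes fs) ++ flatten (map (@rnodes R) done).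
Definition dedges (fs : seq (frame R)) (done : seq rose) :=
  frames_edges fs ++ flatten (map (@redges R) done).

Definition found (adj : seq (dedge R)) : rel 'I_m := fun u w => eg u w && (de u w \notin adj).

Definition frame_ok (f : frame R) : Prop :=
  [/\ 0 <= f.1.2.1, 0 < f.1.2.2.1 <= one_half, 0 < f.1.2.2.2 <= one_half & allp (@rwf R) f.2].

(** [d_conn] is what excludes a second visit: an unexplored edge between two reached vertices would
    close a cycle. [d_closed] says that a vertex leaves the stack only when all its edges are
    explored, so that in the end connectedness yields all vertices. *)
Record DInv (root : 'I_m) (adj : seq (dedge R)) (fs : seq (frame R)) (done : seq rose) : Prop := {
  d_adj : forall e, e \in adj -> exists u w, eg u w /\ e = de u w;
  d_sym : forall u w, de u w \in adj -> de w u \in adj;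
  d_uniq : uniq (map fst (dnodes fs done));
  d_nodes : forall n, n \in dnodes fs done -> exists v, n = (val v, ln v);
  d_edges : forall e, e \in dedges fs done -> exists u w,
    [/\ eg u w, e = te u w, (val u, ln u) \in dnodes fs done & (val w, ln w) \in dnodes fs done];
  d_found : forall u w, eg u w -> de u w \notin adj ->
    (te u w \in dedges fs done) || (te w u \in dedges fs done);
  d_conn : forall u w, (val u, ln u) \in dnodes fs done -> (val w, ln w) \in dnodes fs done ->
    connect (found adj) u w;
  d_closed : forall u w, (val u, ln u) \in dnodes fs done ->
    val u \notin map (fun f => f.1.1) fs -> de u w \notin adj;
  d_frames : allp frame_ok fs;
  d_done : allp (@rwf R) done;
  d_root : (val root, ln root) \in dnodes fs done;
  d_one : (done = [::] /\ fs <> [::]) \/ (fs = [::] /\ exists r, done = [:: r]) }.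

Lemma rwf_frame_rose f : frame_ok f -> rwf (frame_rose f).
Proof. by case: f => -[id [len [ap bd]]] cs [/= h1 h2 h3 h4]. Qed.

Lemma DInv_perm root adj fs done fs' done' : DInv root adj fs done ->
  perm_eq (dnodes fs' done') (dnodes fs done) ->
  perm_eq (dedges fs' done') (dedges fs done) ->
  (forall u w, (val u, ln u) \in dnodes fs done ->
    val u \notin map (fun f => f.1.1) fs' -> de u w \notin adj) ->
  allp frame_ok fs' -> allp (@rwf R) done' ->
  (done' = [::] /\ fs' <> [::]) \/ (fs' = [::] /\ exists r, done' = [:: r]) ->
  DInv root adj fs' done'.
Proof.
move=> I /[dup] pn /perm_mem mn /perm_mem me hc hf hd ho.
split=> //; first [exact: d_adj I|exact: d_sym I|idtac].
- by rewrite (perm_uniq (perm_map fst pn)); exact: d_uniq I.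
- by move=> n; rewrite mn => /(d_nodes I).
- by move=> e; rewrite me => /(d_edges I)[u [w h]]; exists u, w; rewrite !mn.
- by move=> u w; rewrite !me; apply: (d_found I).
- by move=> u w; rewrite !mn; apply: (d_conn I).
- by move=> u w; rewrite mn; apply: hc.
- by rewrite mn; apply: (d_root I).
Qed.

Lemma dpop_inv root (adj : tree (dedge R)) f fs done :
  DInv root (elems adj) (f :: fs) done ->
  (forall e, e \in elems adj -> e.1 != f.1.1) ->
  let st := dpop adj f fs done in
  [/\ DInv root (elems st.1) st.2.1 st.2.2, st.1 = adj & size st.2.1 = size fs].
Proof.
move=> I hno; have done0 : done = [::] by case: (d_one I) => -[].
have hcl u w : (val u, ln u) \in dnodes (f :: fs) done ->
    val u \notin map (fun f => f.1.1) fs -> de u w \notin elems adj.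
  move=> hu hn; case: (eqVneq (val u) f.1.1) => [e|ne].
    by apply/negP => /hno; rewrite /= e eqxx.
  by apply: (d_closed I) => //; rewrite /= inE negb_or ne.
have [okf okfs] := d_frames I.
rewrite /dpop /bind; case: fs I hcl okfs => [|f' fs'] I hcl okfs /=.
  split=> //; apply: (DInv_perm I) => //=.
  - by rewrite /dnodes /= done0 !cats0.
  - by rewrite /dedges /= done0 !cats0.
  - by split; [exact: rwf_frame_rose|exact: d_done I].
  - by right; split=> //; exists (frame_rose f); rewrite done0.
split=> //; have [okf' okfs'] := okfs; apply: (DInv_perm I) => //=.
- pose X := flatten (map (@rnodes R) f'.2) ++ flatten (map frame_nodes fs') ++ flatten (map (@rnodes R) done).
  have -> : dnodes ((f'.1, frame_rose f :: f'.2) :: fs') done =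
    [:: (f'.1.1, f'.1.2.1)] ++ (frame_nodes f ++ X) by rewrite /dnodes /frame_nodes /= -!catA.
  have -> : dnodes [:: f, f' & fs'] done = frame_nodes f ++ ([:: (f'.1.1, f'.1.2.1)] ++ X).
    by rewrite /dnodes /frame_nodes /= -!catA /= -!catA.
  by rewrite perm_catCA.
- pose X := own_edges f' ++ (if fs' is f'' :: _ then [:: (f''.1.1, (f'.1.1, (f'.1.2.2.1, f'.1.2.2.2)))] else [::])
      ++ frames_edges fs' ++ flatten (map (@redges R) done).
  pose l := (f'.1.1, (f.1.1, (f.1.2.2.1, f.1.2.2.2))).
  have -> : dedges ((f'.1, frame_rose f :: f'.2) :: fs') done = [:: l] ++ (own_edges f ++ X).
    by rewrite /dedges /own_edges /= -!catA.
  have -> : dedges [:: f, f' & fs'] done = own_edges f ++ ([:: l] ++ X).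
    by rewrite /dedges /own_edges /= -!catA /= -!catA.
  by rewrite perm_catCA.
- split=> //; case: okf' => h1 h2 h3 h4; split=> //=; split=> //.
  exact: rwf_frame_rose.
- exact: d_done I.
- by left.
Qed.

Lemma val_pair_inj (u v : 'I_m) : (val u, ln u) = (val v, ln v) -> u = v.
Proof. by case=> /val_inj. Qed.

Lemma de_inj u w u' w' : de u w = de u' w' -> u = u' /\ w = w'.
Proof. by case=> /val_inj -> /val_inj ->. Qed.

Lemma dpush_inv root (adj adj' : tree (dedge R)) f fs done e :
  avl adj -> sorted (@dlt R) (elems adj) ->
  DInv root (elems adj) (f :: fs) done ->
  avl adj' -> sorted (@dlt R) (elems adj') -> perm_eq (elems adj) (e :: elems adj') ->
  e.1 = f.1.1 ->
  let st := dpush e adj' f fs done in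
  [/\ DInv root (elems st.1) st.2.1 st.2.2, avl st.1, sorted (@dlt R) (elems st.1),
     (size (elems st.1)).+2 = size (elems adj) & size st.2.1 = (size fs).+2].
Proof.
move=> aa sa I aa' sa' pe ef; have done0 : done = [::] by case: (d_one I) => -[].
have memA x : (x \in elems adj) = (x == e) || (x \in elems adj') by rewrite (perm_mem pe).
have ue : e \notin elems adj'.
  by have := dlt_uniq sa; rewrite (perm_uniq pe) /= => /andP[].
have eA : e \in elems adj by rewrite memA eqxx.
have [v [w [evw ee]]] := d_adj I eA.
have vf : val v = f.1.1 by rewrite -ef ee.
have vw : v != w by apply: contraTneq evw => ->; rewrite eg_irr.
have rA : de w v \in elems adj by apply: (d_sym I); rewrite -ee.
have rA' : de w v \in elems adj'.
  move: rA; rewrite memA ee => /orP[/eqP/de_inj[wv _]|//].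
  by move: vw; rewrite wv eqxx.
rewrite /dpush; have := ddel_spec (e.2.1, e.1) aa' sa'.
case: (del _ _) => [[x adj'']|] /=; last first.
  by move=> /(_ _ rA'); rewrite ee dbeforeE /= !ltnn !eqxx.
move=> [[xA nx xmin] [aa'' sa'' pe']].
have {nx xmin} ex : x = de w v.
  have : ~~ dbefore (e.2.1, e.1) (de w v) by rewrite ee dbeforeE /= !ltnn !eqxx.
  move=> /(xmin _ rA')[//|lt]; exfalso; move: nx; rewrite ee => /negP; apply; exact: lt.
subst x.
have memA' x : (x \in elems adj') = (x == de w v) || (x \in elems adj'') by rewrite (perm_mem pe').
have ur : de w v \notin elems adj''.
  by have := dlt_uniq sa'; rewrite (perm_uniq pe') /= => /andP[].
have memA'' x : (x \in elems adj'') = [&& x \in elems adj, x != de v w & x != de w v].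
  rewrite memA memA' -ee; case: (eqVneq x e) => [->|] /=.
    by apply: negbTE; apply: contra ue; rewrite memA' => ->; rewrite orbT.
  by case: (eqVneq x (de w v)) => [->|]; rewrite ?(negbTE ur) ?andbT.
have subA x : x \in elems adj'' -> x \in elems adj by rewrite memA'' => /andP[].
have vN : (val v, ln v) \in dnodes (f :: fs) done.
  have h : (f.1.1, f.1.2.1) \in dnodes (f :: fs) done by rewrite mem_head.
  have [v' e'] := d_nodes I h; rewrite e' in h; case: e' => e' _.
  by rewrite -vf in e'; move/val_inj: e' => ->.
(* The target is new, since explored edges connect all reached vertices and the edge [v w] is
   unexplored. *)
have wN : (val w, ln w) \notin dnodes (f :: fs) done.
  apply/negP => hw; have := d_conn I vN hw.
  have sub : subrel (found (elems adj)) eg by move=> x y /andP[].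
  have nf : ~~ found (elems adj) v w by rewrite /found evw -ee eA.
  move=> c; have [cy uc sz] := chord_cycle eg_sym eg_irr sub evw nf c.
  by have := eg_acyclic uc; rewrite leqNgt sz.
set f2 : frame R := ((e.2.1, (e.2.2.2.2, (e.2.2.1, e.2.2.2.1))), [::]).
have e2 : f2 = ((val w, (ln w, (al v w, al w v))), [::]) by rewrite /f2 ee.
have eN : dnodes (f2 :: f :: fs) done = (val w, ln w) :: dnodes (f :: fs) done.
  by rewrite e2.
have eE : dedges (f2 :: f :: fs) done = te v w :: dedges (f :: fs) done.
  by rewrite e2 /dedges /= -vf.
split=> //.
- split.
  + by move=> x /subA /(d_adj I).
  + move=> x y; rewrite !memA'' => /and3P[h1 h2 h3]; rewrite (d_sym I h1) /=.
    apply/andP; split.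
      by apply: contra h3 => /eqP/de_inj[-> ->].
    by apply: contra h2 => /eqP/de_inj[-> ->].
  + rewrite eN map_cons cons_uniq (d_uniq I) andbT; apply/negP => /mapP[n hn /= en].
    have [x ex] := d_nodes I hn; rewrite ex /= in en; move/val_inj: en => en.
    by move: wN; rewrite en -ex hn.
  + by move=> n; rewrite eN in_cons => /orP[/eqP ->|/(d_nodes I)//]; exists w.
  + move=> x; rewrite eE in_cons => /orP[/eqP ->|/(d_edges I)[a [b [h1 h2 h3 h4]]]].
      by exists v, w; split=> //; rewrite eN in_cons ?eqxx ?vN ?orbT.
    by exists a, b; split=> //; rewrite eN in_cons ?h3 ?h4 orbT.
  + move=> x y exy; rewrite memA'' eE !in_cons negb_and negb_and !negbK.
    case/or3P=> [/(d_found I exy)/orP[] ->|/eqP/de_inj[-> ->]|/eqP/de_inj[-> ->]];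
      by rewrite ?eqxx ?orbT.
  + have sub : subrel (found (elems adj)) (found (elems adj'')).
      by move=> x y /andP[h1 h2]; rewrite /found h1; apply: contra h2; apply: subA.
    have cc x y : (val x, ln x) \in dnodes (f :: fs) done ->
       (val y, ln y) \in dnodes (f :: fs) done -> connect (found (elems adj'')) x y.
      by move=> hx hy; apply: connect_sub (d_conn I hx hy) => a b /sub; apply: connect1.
    have fvw : connect (found (elems adj'')) v w.
      by apply: connect1; rewrite /found evw memA'' eqxx andbF.
    have fwv : connect (found (elems adj'')) w v.
      by apply: connect1; rewrite /found eg_sym evw memA'' eqxx !andbF.
    move=> x y; rewrite !eN !inE.
    move=> /orP[/eqP/val_pair_inj ->|hx] /orP[/eqP/val_pair_inj ->|hy].
    * exact: connect0.
    * exact: connect_trans fwv (cc _ _ vN hy).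
    * exact: connect_trans (cc _ _ hx vN) fvw.
    * exact: cc.
  + move=> x y; rewrite eN in_cons map_cons in_cons e2 negb_or => /orP[/eqP/val_pair_inj ->|hx].
      by rewrite eqxx.
    move=> /andP[_ hn]; apply: contra (d_closed I y hx hn); exact: subA.
  + split; last exact: d_frames I.
    rewrite e2; split=> //=; [exact: al_ok|by apply: al_ok; rewrite eg_sym].
  + exact: d_done I.
  + by rewrite eN in_cons (d_root I) orbT.
  + by left.
- by rewrite (perm_size pe) /= (perm_size pe').
Qed.

Definition dgood root (st : dstate R) : Prop :=
  [/\ avl st.1, sorted (@dlt R) (elems st.1) & DInv root (elems st.1) st.2.1 st.2.2].

(** A push removes the two copies of an edge and adds a frame, a pop removes a frame. *)
Definition dpot (st : dstate R) : nat := (size (elems st.1) + size st.2.1)%N.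

Lemma dfs_step_nil (st : dstate R) : st.2.1 = [::] -> dfs_step st = st.
Proof. by rewrite /dfs_step => ->. Qed.

Lemma dfs_step_inv root (st : dstate R) : dgood root st -> st.2.1 <> [::] ->
  dgood root (dfs_step st) /\ (dpot (dfs_step st) < dpot st)%N.
Proof.
case: st => adj [[|f fs] done] [/= aa sa I] // _; rewrite /dfs_step /=.
have pop : (forall e, e \in elems adj -> e.1 != f.1.1) ->
    dgood root (dpop adj f fs done) /\ (dpot (dpop adj f fs done) < dpot (adj, (f :: fs, done)))%N.
  move=> h; have [h1 h2 h3] := dpop_inv I h; move: h1 h2 h3; rewrite /dgood /dpot.
  by case: (dpop _ _ _ _) => a [fs' d'] /= h1 h2 h3; rewrite h2 in h1 *; rewrite h3 addnS.
have := ddel_spec (f.1.1, 0%N) aa sa.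
case: (del _ adj) => [[e adj']|] /=; last first.
  move=> h; apply: pop => e /h; rewrite dbeforeE /= ltn0 andbF orbF => lt.
  by rewrite neq_ltn lt.
move=> [[eA ne emin] [aa' sa' pe]]; case: (leqP e.1 f.1.1) => /= h; last first.
  apply: pop => x hx; apply/eqP => ex.
  have nx : ~~ dbefore (f.1.1, 0%N) x by rewrite dbeforeE /= ex ltnn eqxx ltn0.
  case: (emin _ hx nx) => [xe|]; first by move: h; rewrite -xe ex ltnn.
  rewrite /dlt dbeforeE /= ex => /orP[lt|/andP[/eqP e' _]].
    by have := ltn_trans h lt; rewrite ltnn.
  by move: h; rewrite e' ltnn.
have ef : e.1 = f.1.1.
  apply/eqP; rewrite eqn_leq h leqNgt; apply: contra ne => lt.
  by rewrite dbeforeE /= lt.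
have [h1 h2 h3 h4 h5] := dpush_inv aa sa I aa' sa' pe ef.
split; first by split.
rewrite /dpot -[size (adj, _).2.1]/(size fs).+1 -[(adj, _).1]/adj.
by rewrite h5 -h4 !addnS !addSn.
Qed.

Lemma dfs_fold root (T : Type) (fuel : seq T) (st : dstate R) : dgood root st ->
  dgood root (foldl (fun st _ => dfs_step st) st fuel) /\
  ((dpot st <= size fuel)%N -> (foldl (fun st _ => dfs_step st) st fuel).2.1 = [::]).
Proof.
elim: fuel st => [|x fuel IH] st g /=.
  by split=> //; rewrite /dpot leqn0 addn_eq0 => /andP[_ /nilP].
case: (boolP (nilp st.2.1)) => [/nilP e|/nilP ne].
  rewrite dfs_step_nil //; have [h1 _] := IH _ g; split=> // _.
  by elim: (fuel) => //= y l h; rewrite dfs_step_nil.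
have [g' lt] := dfs_step_inv g ne; have [h1 h2] := IH _ g'.
by split=> // h; apply: h2; lia.
Qed.

(** The root has no parent; [one_half] is a threshold that constrains nothing. *)
Definition root_frame (root : 'I_m) : frame R := ((val root, (ln root, (one_half, one_half))), [::]).

Lemma dfs_init root (adj : tree (dedge R)) :
  avl adj -> sorted (@dlt R) (elems adj) ->
  (forall e, e \in elems adj <-> exists u w, eg u w /\ e = de u w) ->
  dgood root (adj, ([:: root_frame root], [::])).
Proof.
move=> aa sa hA; split=> //=.
have hN : dnodes [:: root_frame root] [::] = [:: (val root, ln root)] by [].
split.
- by move=> e /hA.
- move=> u w /hA[a [b [h /de_inj[-> ->]]]]; apply/hA; exists b, a.
  by rewrite eg_sym.
- by rewrite hN.
- by move=> n; rewrite hN inE => /eqP ->; exists root.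
- by [].
- move=> u w h /negP[]; apply/hA; by exists u, w.
- by move=> u w; rewrite hN !inE => /eqP/val_pair_inj -> /eqP/val_pair_inj ->; apply: connect0.
- by move=> u w; rewrite hN !inE => /eqP/val_pair_inj ->; rewrite eqxx.
- have h0 : 0 < one_half :> R by rewrite /one_half divr_gt0 // addr_gt0.
  by split=> //; split=> //=; rewrite ?h0 ?lexx // ln_ok.
- by [].
- by rewrite hN mem_head.
- by left.
Qed.

Hypothesis eg_connected : forall u w, connect eg u w.

Lemma dfs_spec root (adj : tree (dedge R)) (T : Type) (fuel : seq T) :
  avl adj -> sorted (@dlt R) (elems adj) ->
  (forall e, e \in elems adj <-> exists u w, eg u w /\ e = de u w) ->
  (size (elems adj) + 1 <= size fuel)%N ->
  exists r, [/\ (foldl (fun st _ => dfs_step st) (adj, ([:: root_frame root], [::])) fuel).2.2 = [:: r],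
   rwf r, perm_eq (rnodes r) (map (fun v => (val v, ln v)) (enum 'I_m)),
   (forall e, e \in redges r -> exists u w, eg u w /\ e = te u w) &
   (forall u w, eg u w -> (te u w \in redges r) || (te w u \in redges r))].
Proof.
move=> aa sa hA hf; have g0 := dfs_init root aa sa hA.
have [[_ _ I] h] := dfs_fold fuel g0; move: I (h hf).
set st := foldl _ _ _; case: st => a [fs done] /= I e; subst fs.
case: (d_one I) => [[_ //]|[_ [r er]]]; subst done.
have nE : dnodes [::] [:: r] = rnodes r by rewrite /dnodes /= cats0.
have eE : dedges [::] [:: r] = redges r by rewrite /dedges /= cats0.
have hno u w : (val u, ln u) \in rnodes r -> de u w \notin elems a.
  by move=> hu; apply: (d_closed I); rewrite ?nE.
have hstep u w : eg u w -> (val u, ln u) \in rnodes r -> (val w, ln w) \in rnodes r.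
  move=> ew hu; have := d_found I ew (hno _ w hu); rewrite eE.
  have from_edge x y : te x y \in dedges [::] [:: r] -> (val x, ln x) \in rnodes r /\ (val y, ln y) \in rnodes r.
    move=> /(d_edges I)[x' [y' [_ ee]]]; rewrite nE.
    by case: ee => /val_inj -> /val_inj -> _ _.
  by rewrite -!eE => /orP[] /from_edge[].
have hall v : (val v, ln v) \in rnodes r.
  have h0 : (val root, ln root) \in rnodes r by have := d_root I; rewrite nE.
  have /connectP[p] := eg_connected root v.
  elim: p (root) h0 => [|y p IH] x hx /=; first by move=> _ ->.
  by move=> /andP[exy py] ev; apply: (IH y (hstep _ _ exy hx) py ev).
exists r; split=> //.
- by have [] := d_done I.
- apply: uniq_perm.
  + by have := d_uniq I; rewrite nE => /map_uniq.
  + by rewrite map_inj_uniq ?enum_uniq // => u v /val_pair_inj.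
  + move=> n; apply/idP/mapP => [hn|[v _ ->]]; last exact: hall.
    have [v ->] : exists v, n = (val v, ln v) by apply: (d_nodes I); rewrite nE.
    by exists v; rewrite ?mem_enum.
- by move=> e; rewrite -eE => /(d_edges I)[u [w [h1 h2 _ _]]]; exists u, w.
- by move=> u w ew; rewrite -eE; apply: (d_found I) => //; apply: hno.
Qed.


End DfsCorrect.

(** * Running time of the search *)

Section DfsCost.
Variable R : realType.
Local Notation rose := (rose R).

Lemma Comp_dbefore : Comp (fun q : (nat * nat) * dedge R => dbefore q.1 q.2) (fun=> 0).
Proof. rewrite /dbefore; comp0. Qed.

Definition pop_cost (f : frame R) : nat := (size f.2).+1 * size f.2.

Definition dfs_next (st : dstate R) (f : frame R) : option (dedge R * tree (dedge R)) :=
  ocase (del (dbefore (f.1.1, 0%N)) st.1) None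
    (fun q => if (q.1.1 <= f.1.1)%N then Some q else None).

Definition dfs_cost (st : dstate R) : nat :=
  (depth st.1 + lcase st.2.1 0 (fun f _ => ocase (dfs_next st f) (pop_cost f) (fun=> 0)))%N.

Lemma Comp_frame_rose : Comp (@frame_rose R) pop_cost.
Proof.
have h : Comp (fun f : frame R => (f.1.1, (f.1.2.1, (f.1.2.2.1, (f.1.2.2.2, f.2))))) (fun=> 0) by comp0.
by apply: Comp_le 1 _ (Comp_comp h (Comp_mkrose R)) => f; rewrite /pop_cost /=; lia.
Qed.

Lemma Comp_dpop :
  Comp (fun q : tree (dedge R) * (frame R * (seq (frame R) * seq rose)) => dpop q.1 q.2.1 q.2.2.1 q.2.2.2)
    (fun q => pop_cost q.2.1).
Proof.
have h : Comp (fun q : tree (dedge R) * (frame R * (seq (frame R) * seq rose)) => q.2.1) (fun=> 0) by comp0.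
rewrite /dpop; apply: Comp_le 1 _ _; last first.
  by eapply Comp_bind; [exact: Comp_comp h Comp_frame_rose|comp].
by move=> q /=; lia.
Qed.

Lemma Comp_dpush :
  Comp (fun q : (dedge R * tree (dedge R)) * (frame R * (seq (frame R) * seq rose)) =>
     dpush q.1.1 q.1.2 q.2.1 q.2.2.1 q.2.2.2) (fun q => depth q.1.2).
Proof.
rewrite /dpush; apply: Comp_le 1 _ _; last first.
  by eapply Comp_pair; [eapply Comp_ocase; [eapply (Comp_del Comp_dbefore); comp|comp|comp]|comp].
by move=> q /=; case: (del _ _) => * /=; lia.
Qed.

Lemma Comp_dfs_step : Comp (@dfs_step R) dfs_cost.
Proof.
have h1 : Comp (fun p : dstate R * (frame R * seq (frame R)) =>
   (p.1.1, (p.2.1, (p.2.2, p.1.2.2)))) (fun=> 0) by comp0.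
have h2 : Comp (fun p : (dstate R * (frame R * seq (frame R))) * (dedge R * tree (dedge R)) =>
   (p.2, (p.1.2.1, (p.1.2.2, p.1.1.2.2)))) (fun=> 0) by comp0.
rewrite /dfs_step; apply: Comp_le 4 _ _; last first.
  eapply Comp_lcase; [comp|comp|].
  eapply Comp_ocase; [eapply Comp_ocase; [eapply (Comp_del Comp_dbefore); comp|comp|comp]| |].
  - exact: Comp_comp h1 Comp_dpop.
  - exact: Comp_comp h2 Comp_dpush.
move=> [adj [[|f fs] done]]; rewrite /dfs_cost /dfs_next /=; first lia.
case e : (del _ _) => [[d adj']|] /=; last lia.
by have := depth_del e; case: ifP => _ /=; lia.
Qed.

Definition children_sum (fs : seq (frame R)) : nat := sumn (map (fun f => size f.2) fs).

Section Bound.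
Variables (m : nat) (eg : rel 'I_m) (al : 'I_m -> 'I_m -> R) (ln : 'I_m -> R) (k : nat).
Hypothesis eg_sym : symmetric eg.
Hypothesis eg_irr : irreflexive eg.
Hypothesis eg_acyclic : forall c : seq 'I_m, ucycle eg c -> (size c <= 2)%N.
Hypothesis al_ok : forall u w, eg u w -> (0 < al u w <= one_half)%R.
Hypothesis ln_ok : forall u, (0 <= ln u)%R.
Hypothesis hk : forall v, (#|[set y | eg v y]| <= k)%N.

(** The children of a frame have distinct identifiers by [d_uniq], and all of them are neighbours of
    its vertex by [d_edges]. *)
Lemma children_bound root adj f fs done :
  DInv eg al ln root adj (f :: fs) done -> (size f.2 <= k)%N.
Proof.
move=> I; have hf : (f.1.1, f.1.2.1) \in dnodes (f :: fs) done by rewrite mem_head.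
have [v [ev _]] := d_nodes I hf.
have hc c : List.In c f.2 -> exists2 w, eg v w & rid c = val w.
  move=> hc; have he : (f.1.1, (rid c, (rap c, rbd c))) \in dedges (f :: fs) done.
    by rewrite /dedges /= !mem_cat (In_flatten hc) // mem_head.
  have [u [w [h1 [h2 h3 _ _] _ _]]] := d_edges I he; exists w => //.
  by rewrite (val_inj (etrans (esym ev) h2)).
have u0 : uniq (map (@rid R) f.2).
  have := d_uniq I; rewrite /dnodes /= => /andP[_].
  rewrite map_cat cat_uniq => /and3P[+ _ _]; rewrite map_cat cat_uniq => /and3P[+ _ _].
  apply: subseq_uniq; elim: (f.2) => //= c cs IH.
  rewrite map_cat -cat1s; apply: cat_subseq => //.
  by case: (c) => i cs' /=; rewrite eqxx sub0seq.
rewrite -(size_map (@rid R)).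
have sub : {subset map (@rid R) f.2 <= map val (enum [set y | eg v y])}.
  elim: (f.2) hc => //= c cs IH hc x; rewrite inE => /orP[/eqP ->|].
    have [w ew ->] := hc c (or_introl erefl).
    by apply: map_f; rewrite mem_enum inE.
  by apply: IH => d hd; apply: hc; right.
by apply: leq_trans (uniq_leq_size u0 sub) _; rewrite size_map -cardE.
Qed.

Definition dI root N (st : dstate R) : Prop :=
  dgood eg al ln root st /\ (size (elems st.1) + size st.2.1 <= N)%N.

(** This is the source of the term m k. Closing a node with c children costs (c + 1) c, at most (k +
    1) c, which the potential [k.+1 * children_sum] releases; the parent gains a single child, so
    each step adds at most k + 1 to the potential. *)
Lemma dfs_total_cost root N (T : Type) (fuel : seq T) (st : dstate R) :
  dI root N st -> (fold_cost (fun st _ => dfs_step st) (fun st _ => dfs_cost st) st fuel <=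
    k.+1 * children_sum st.2.1 + (2 * trunc_log 2 N.+1 + k + 3) * size fuel)%N.
Proof.
move=> Ist.
have := @fold_cost_potential _ T (fun st _ => dfs_step st) (fun st _ => dfs_cost st) (dI root N)
  (fun=> 0%N) (fun st => k.+1 * children_sum st.2.1)%N (2 * trunc_log 2 N.+1 + k + 2) st fuel _ Ist.
rewrite !addn0 !add0n => h.
apply: (@leq_trans (fold_cost (fun st _ => dfs_step st) (fun st _ => dfs_cost st) st fuel +
   k.+1 * children_sum (foldl (fun st _ => dfs_step st) st fuel).2.1)%N); first lia.
apply: leq_trans (h _) _; last by rewrite leq_add2l leq_mul2r; apply/orP; right; lia.
move=> {Ist h} {}st _ [g szN]; rewrite !addn0 !add0n.
have [aa sa I] := g.
have dl : (depth st.1 <= 2 * trunc_log 2 N.+1 + 1)%N.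
  apply: leq_trans (avl_depth aa) _; rewrite leq_add2r leq_mul2l /=.
  by apply: leq_trunc_log; lia.
case: (boolP (nilp st.2.1)) => [/nilP e|/nilP ne].
  by rewrite dfs_step_nil //; split; [split|rewrite /dfs_cost e /=; lia].
have ok := dfs_step_inv eg_sym eg_irr eg_acyclic al_ok ln_ok g ne.
have {ok} [g' lt] := ok.
split; first by split=> //; move: lt; rewrite /dpot; lia.
case: st g szN aa sa I dl ne g' lt => adj [[|f fs] done] //= _ _ _ _ I dl _ _ _.
have cb := children_bound I.
rewrite /dfs_cost /dfs_step /=.
rewrite -[ocase (del _ adj) None _]/(dfs_next (adj, (f :: fs, done)) f).
case: (dfs_next _ f) => [q|] /=; last first.
  rewrite /dpop /bind /pop_cost; case: fs {I} => [|f' fs'] /=; rewrite /children_sum /=; nia.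
rewrite /children_sum /=; nia.
Qed.

End Bound.
End DfsCost.

(** * Counting the edges of a forest *)

Section Forest.
Variables (T : finType) (e : rel T).
Hypothesis e_sym : symmetric e.
Hypothesis e_irr : irreflexive e.
Hypothesis e_acyclic : forall c : seq T, ucycle e c -> (size c <= 2)%N.

(** Otherwise each vertex of [V] has two neighbours in [V], and a simple path can be prolonged
    forever: a repeated vertex would close a cycle. *)
Lemma leaf_exists (V : {set T}) : V != set0 ->
  exists2 x, x \in V & (#|[set y in V | e x y]| <= 1)%N.
Proof.
case/set0Pn => x0 x0V.
case: (boolP [exists x in V, (#|[set y in V | e x y]| <= 1)%N]) => [/exists_inP[x xV h]|].
  by exists x.
rewrite negb_exists_in => /forall_inP h; exfalso.
have two x y : x \in V -> exists z, [/\ z \in V, e x z & z != y].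
  move=> /h; rewrite -ltnNge => /card_gt1P[a [b []]]; rewrite !inE => /andP[aV ea] /andP[bV eb] ab.
  case: (eqVneq a y) => [ay|ny]; last by exists a.
  by exists b; split=> //; rewrite -ay eq_sym.
have H n : exists x y p, [/\ path e x (y :: p), uniq [:: x, y & p], all (mem V) [:: x, y & p] & size p = n]; last first.
  have [x [y [p [_ u _ sz]]]] := H #|T|.
  by have := max_card (mem [:: x, y & p]); rewrite (card_uniqP u) /= sz ltnNge leqnSn.
elim: n => [|n [x [y [p [pp up ap sz]]]]].
  have [y [yV exy _]] := two x0 x0 x0V; exists x0, y, [::]; split; rewrite /= ?exy ?x0V ?yV //.
  by rewrite inE andbT; apply: contraTneq exy => ->; rewrite e_irr.
have xV : x \in V by case/andP: ap.
have [z [zV exz zy]] := two x y xV.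
exists z, x, (y :: p); split; [by rewrite /= e_sym exz| |by rewrite /= zV|by rewrite /= sz].
rewrite cons_uniq up andbT !inE !negb_or zy /=.
have -> /= : z != x by apply: contraTneq exz => ->; rewrite e_irr.
apply/negP => /splitPr zp; case: zp pp up => p1 p2 pp up.
have : ucycle e (x :: y :: rcons p1 z).
  rewrite /ucycle; apply/andP; split.
    move: pp; rewrite /= -cat_rcons cat_path => /andP[-> /andP[h1 _]].
    by rewrite rcons_path h1 last_rcons e_sym exz.
  by move: up; rewrite -cat_rcons -!cat_cons cat_uniq => /andP[].
by move=> /e_acyclic; rewrite /= size_rcons.
Qed.

(** Ordered pairs count each edge twice. Removing a vertex with at most one neighbour loses at most
    two pairs; an empty remainder is treated apart. *)
Lemma forest_edges_in (V : {set T}) : V != set0 ->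
  (#|[set p : T * T | [&& p.1 \in V, p.2 \in V & e p.1 p.2]]| + 2 <= 2 * #|V|)%N.
Proof.
have [n] := ubnP #|V|; elim: n V => // n IH V ltn V0.
have [x xV lx] := leaf_exists V0.
pose W := V :\ x; have cV : #|V| = #|W|.+1 by rewrite (cardsD1 x) xV.
set E := [set p : T * T | _].
pose A := [set p : T * T | [&& p.1 \in W, p.2 \in W & e p.1 p.2]].
pose N := [set y in V | e x y].
pose B1 := [set (x, y) | y in N]; pose B2 := [set (y, x) | y in N].
have sub : E \subset A :|: (B1 :|: B2).
  apply/subsetP => -[a b]; rewrite inE /= => /and3P[aV bV eab].
  case: (eqVneq a x) => [ax|nax].
    apply/setUP; right; apply/setUP; left; apply/imsetP.
    by exists b; rewrite ?ax // inE bV -ax eab.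
  case: (eqVneq b x) => [bx|nbx].
    apply/setUP; right; apply/setUP; right; apply/imsetP.
    by exists a; rewrite ?bx // inE aV -bx e_sym eab.
  by apply/setUP; left; rewrite !inE /= nax nbx aV bV eab.
have := subset_leq_card sub.
have [h1 _] := leq_card_setU A (B1 :|: B2); have [h2 _] := leq_card_setU B1 B2.
have h3 : (#|B1| <= 1)%N by apply: leq_trans (leq_imset_card _ _) lx.
have h4 : (#|B2| <= 1)%N by apply: leq_trans (leq_imset_card _ _) lx.
case: (eqVneq W set0) => [W0|W0].
  have A0 : #|A| = 0%N.
    by apply/eqP; rewrite cards_eq0; apply/eqP/setP => p; rewrite inE W0 !inE.
  have : E = set0.
    apply/setP => -[a b]; rewrite !inE /=; apply/negP => /and3P[aV bV eab].
    have ax : a = x by have : a \notin W; [rewrite W0 inE|rewrite !inE aV andbT negbK => /eqP].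
    have bx : b = x by have : b \notin W; [rewrite W0 inE|rewrite !inE bV andbT negbK => /eqP].
    by move: eab; rewrite ax bx e_irr.
  by move=> -> _; rewrite cards0 cV W0 cards0.
have hA : (#|A| + 2 <= 2 * #|W|)%N by apply: IH => //; rewrite -ltnS -cV.
move: h1 h2; rewrite cV; lia.
Qed.

Lemma forest_edges (x0 : T) : (#|[set p : T * T | e p.1 p.2]| + 2 <= 2 * #|T|)%N.
Proof.
have := @forest_edges_in [set: T]; rewrite cardsT => h; have := h _.
have -> : [set p : T * T | [&& p.1 \in [set: T], p.2 \in [set: T] & e p.1 p.2]] =
  [set p : T * T | e p.1 p.2] by apply/setP => p; rewrite !inE.
by apply; apply/set0Pn; exists x0; rewrite inE.
Qed.

End Forest.

(** * The adjacency structure of the reported crossings *)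

Section BuildAdj.
Variable R : realType.

Definition share (s : seg R) (x : R) : R :=
  bind ((x - sxl s) / (sxr s - sxl s))%R (fun t => if (t <= 1 - t)%R then t else (1 - t)%R).

Definition mkde (x : R) (s t : seg R) : dedge R :=
  (sid s, (sid t, (share s x, (share t x, slen t)))).

Definition ins_de (e : dedge R) (T : tree (dedge R)) := ins (dbefore (e.1, e.2.1)) e T.

Definition build_step (T : tree (dedge R)) (p : seg R * seg R) : tree (dedge R) :=
  bind (meet_x p.1 p.2) (fun x => ins_de (mkde x p.1 p.2) (ins_de (mkde x p.2 p.1) T)).

Definition build_adj (out : seq (seg R * seg R)) : tree (dedge R) := foldl build_step Lf out.

Definition dkey (e : dedge R) := (e.1, e.2.1).

Lemma ins_de_spec e (T : tree (dedge R)) : avl T -> sorted (@dlt R) (elems T) ->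
  dkey e \notin map dkey (elems T) ->
  [/\ avl (ins_de e T), sorted (@dlt R) (elems (ins_de e T)) & perm_eq (elems (ins_de e T)) (e :: elems T)].
Proof.
move=> aT sT nk; rewrite /ins_de; set p := dbefore _.
have [a1 _] := ins_avl p e aT.
have m := dbefore_mono (e.1, e.2.1) sT.
rewrite elems_ins //; split=> //; last first.
  rewrite perm_sym -[e :: elems T]/([:: e] ++ elems T) -[e :: filter _ _]/([:: e] ++ filter _ _).
  by rewrite perm_sym perm_catCA perm_cat2l perm_filterC.
move: sT nk; set Q := elems T; rewrite !(sorted_pairwise (@dlt_trans R)) => sT nk.
rewrite pairwise_cat pairwise_filter // pairwise_cons pairwise_filter // !andbT /=.
have a2 : all (dlt e) (filter (predC p) Q).
  apply/allP => x; rewrite mem_filter /p /= dbeforeE /= => /andP[h1 hx].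
  have : dkey x != dkey e by apply: contraNneq nk => <-; apply: map_f.
  rewrite /dkey xpair_eqE /dlt dbeforeE /=; move: h1; lia.
rewrite a2 andbT allrel_consr; apply/andP; split.
  by apply/allP => x; rewrite mem_filter /dlt => /andP[].
apply/allrelP => x y; rewrite !mem_filter => /andP[h1 _] /andP[h2 hy].
have := allP a2 y; rewrite mem_filter h2 hy => /(_ isT) h3.
by apply: dlt_trans h3; exact: h1.
Qed.

Definition both_de (p : seg R * seg R) : seq (dedge R) :=
  [:: mkde (meet_x p.1 p.2) p.1 p.2; mkde (meet_x p.1 p.2) p.2 p.1].

Lemma build_spec (l : seq (seg R * seg R)) (T : tree (dedge R)) : avl T -> sorted (@dlt R) (elems T) ->
  uniq (map dkey (flatten (map both_de l) ++ elems T)) ->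
  [/\ avl (foldl build_step T l), sorted (@dlt R) (elems (foldl build_step T l)) &
    perm_eq (elems (foldl build_step T l)) (flatten (map both_de l) ++ elems T)].
Proof.
elim: l T => //= p l IH T aT sT; rewrite {1}/both_de /=.
set e1 := mkde _ p.1 p.2; set e2 := mkde _ p.2 p.1.
move=> /andP[n1 /andP[n2 u]].
have k2 : dkey e2 \notin map dkey (elems T).
  by apply: contra n2; rewrite map_cat mem_cat => ->; rewrite orbT.
have [a2 s2 p2] := ins_de_spec aT sT k2.
have k1 : dkey e1 \notin map dkey (elems (ins_de e2 T)).
  rewrite (perm_mem (perm_map dkey p2)) /=; move: n1; rewrite /= !inE !negb_or => /andP[-> /=].
  by apply: contra; rewrite map_cat mem_cat => ->; rewrite orbT.
have [a1 s1 p1] := ins_de_spec a2 s2 k1.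
have p12 : perm_eq (elems (ins_de e1 (ins_de e2 T))) ([:: e1; e2] ++ elems T).
  by apply: (perm_trans p1); rewrite perm_cons.
have u' : uniq (map dkey (flatten (map both_de l) ++ elems (ins_de e1 (ins_de e2 T)))).
  rewrite (perm_uniq (_ : perm_eq _ (map dkey [:: e1, e2 & flatten (map both_de l) ++ elems T]))).
    by rewrite /= n1 n2.
  apply: perm_map; rewrite -[X in perm_eq _ X]/([:: e1; e2] ++ (flatten (map both_de l) ++ elems T)).
  by rewrite perm_sym perm_catCA perm_sym perm_cat2l.
have [b1 b2 b3] := IH (build_step T p) a1 s1 u'.
split=> //; apply: (perm_trans b3).
rewrite -[X in perm_eq _ X]/([:: e1; e2] ++ (flatten (map both_de l) ++ elems T)).
by rewrite perm_sym perm_catCA perm_sym perm_cat2l.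
Qed.

Lemma Comp_build :
  Comp build_adj (fun out => fold_cost build_step (fun T _ => depth T) Lf out).
Proof.
have hm : Comp (fun q : seg R * seg R => meet_x q.1 q.2) (fun=> 0).
  by rewrite /meet_x /sb /sa; comp0.
have hs : Comp (fun q : seg R * R => share q.1 q.2) (fun=> 0).
  by rewrite /share /sxl /sxr; comp0.
have hde : Comp (fun q : R * (seg R * seg R) => mkde q.1 q.2.1 q.2.2) (fun=> 0).
  by rewrite /mkde /sid /slen; comp0.
have hins : Comp (fun q : dedge R * tree (dedge R) => ins_de q.1 q.2) (fun q => depth q.2).
  rewrite /ins_de; apply: Comp_le 1 _ _; last (eapply (Comp_ins (@Comp_dbefore R)); comp).
  by move=> q /=; lia.
have h : Comp (fun q : nat * (tree (dedge R) * (seg R * seg R)) => build_step q.2.1 q.2.2) (fun q => depth q.2.1).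
  rewrite /build_step; apply: Comp_le 3 _ _; last first.
    eapply Comp_bind; [comp|].
    eapply (Comp_fun2 hins); [by eapply (Comp_fun3 hde); comp|].
    by eapply (Comp_fun2 hins); [eapply (Comp_fun3 hde); comp|comp].
  move=> [n [T p]] /=; have := depth_ins (dbefore (dkey (mkde (meet_x p.1 p.2) p.2 p.1))) (mkde (meet_x p.1 p.2) p.2 p.1) T.
  rewrite /ins_de /dkey /=; lia.
rewrite /build_adj; apply: Comp_le 1 _ _; last first.
  eapply (Comp_foldl (c := fun=> 0%N) (f := fun _ T p => build_step T p) h); comp.
by move=> out; rewrite mul1n; exact: leqnSn.
Qed.

End BuildAdj.

(** * From drawings to segments *)

Section Shear.
Variable R : realType.
Local Open Scope ring_scope.

Lemma one_half_add : one_half + one_half = 1 :> R.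
Proof. by rewrite /one_half -mulr2n -mulr_natr divfK // gt_eqF // addr_gt0. Qed.

Definition raw_edge : Type := (nat * ((R * R) * (R * R)))%type.

Definition absr (x : R) : R := if 0 <= x then x else 0 - x.

(* A shear x + eps y with eps < |dx| / (|dy| + 1) for all edges with dx != 0
   makes no edge vertical. *)
Definition eps_step (g : R) (e : raw_edge) : R :=
  bind (absr (e.2.2.1 - e.2.1.1)) (fun dx =>
    if dx <= 0 then g else
    bind (dx / (absr (e.2.2.2 - e.2.1.2) + 1)) (fun q => if q <= g then q else g)).

Definition shear (E : seq raw_edge) : R := foldl eps_step 1 E.

Definition shx (eps : R) (p : R * R) : R := p.1 + eps * p.2.

Definition raw_len (e : raw_edge) : R :=
  Num.sqrt ((e.2.2.1 - e.2.1.1) * (e.2.2.1 - e.2.1.1) + (e.2.2.2 - e.2.1.2) * (e.2.2.2 - e.2.1.2)).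

Definition mkseg (eps : R) (e : raw_edge) : seg R :=
  bind (shx eps e.2.1) (fun x1 => bind (shx eps e.2.2) (fun x2 =>
    bind ((e.2.2.2 - e.2.1.2) / (x2 - x1)) (fun a =>
      (e.1, (if x1 <= x2 then x1 else x2, (if x1 <= x2 then x2 else x1,
        (a, (e.2.1.2 - a * x1, raw_len e)))))))).

Lemma absrE x : absr x = `|x|.
Proof.
by rewrite /absr; case: ifP => [/ger0_norm //|/negbT]; rewrite -ltNge => /ltr0_norm ->; rewrite sub0r.
Qed.

Lemma eps_step_spec g e : 0 < g ->
  [/\ 0 < eps_step g e, eps_step g e <= g &
    forall eps, 0 < eps -> eps <= eps_step g e -> e.2.1 <> e.2.2 -> shx eps e.2.1 != shx eps e.2.2].
Proof.
case: e => i [[x1 y1] [x2 y2]] g0; rewrite /eps_step /bind /shx /= !absrE.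
set dx := `|_|; case: ifP => hdx.
  split=> // eps e0 _ ne; have x12 : x2 = x1.
    by apply/eqP; rewrite -subr_eq0 -normr_le0.
  apply/eqP; rewrite x12 => /addrI /(mulfI (lt0r_neq0 e0)) h.
  by apply: ne; rewrite /= x12 h.
have {}hdx : 0 < dx by rewrite ltNge hdx.
set q := dx / _.
have q0 : 0 < q by rewrite divr_gt0 // ltr_wpDl.
have key eps : 0 < eps -> eps <= q -> x1 + eps * y1 != x2 + eps * y2.
  move=> e0 eq; apply/eqP => h.
  have h2 : x2 - x1 = - (eps * (y2 - y1)) by lra.
  have h3 : dx = eps * `|y2 - y1| by rewrite /dx h2 normrN normrM gtr0_norm.
  have h4 : q * (`|y2 - y1| + 1) = dx by rewrite /q divfK // gt_eqF // ltr_wpDl.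
  have : eps * (`|y2 - y1| + 1) <= q * (`|y2 - y1| + 1) by rewrite ler_pM2r // ltr_wpDl.
  by rewrite h4 h3; lra.
case: ifP => hq; split=> //.
- by move=> eps e0 eq _; apply: key.
- move=> eps e0 eq _; apply: key => //; apply: le_trans eq _.
  by rewrite ltW // ltNge hq.
Qed.

Lemma shear_spec (E : seq raw_edge) : 0 < shear E /\ forall e, List.In e E -> e.2.1 <> e.2.2 ->
  shx (shear E) e.2.1 != shx (shear E) e.2.2.
Proof.
suff H g : 0 < g -> [/\ 0 < foldl eps_step g E, foldl eps_step g E <= g &
   forall eps e, 0 < eps -> eps <= foldl eps_step g E -> List.In e E -> e.2.1 <> e.2.2 ->
     shx eps e.2.1 != shx eps e.2.2].
  by have [h1 _ h3] := H 1 ltr01; split=> // e; apply: h3.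
elim: E g => [|e E IH] g g0 /=; first by split.
have [h1 h2 h3] := eps_step_spec e g0; have [k1 k2 k3] := IH _ h1.
split=> //; first exact: le_trans k2 h2.
move=> eps d e0 le [<-|hd]; last exact: k3.
by apply: h3 => //; apply: le_trans le k2.
Qed.

Section OneSegment.
Variables (eps : R) (e : raw_edge).
Hypothesis ne : shx eps e.2.1 != shx eps e.2.2.
Let P := e.2.1.
Let Q := e.2.2.
Let s := mkseg eps e.

Lemma shx_at t : shx eps (pt_at P Q t) = shx eps P + t * (shx eps Q - shx eps P).
Proof. by rewrite /shx /pt_at /=; ring. Qed.

Lemma mkseg_lr : sxl s < sxr s.
Proof.
rewrite /s /mkseg /bind /sxl /sxr /=; case: ifP => h; first by rewrite lt_neqAle ne.
by rewrite ltNge h.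
Qed.

(** The shear keeps ordinates and is affine, so the parameter [t] of a point on the edge is the same
    before and after it. *)
Lemma mkseg_at t : yat s (shx eps (pt_at P Q t)) = (pt_at P Q t).2.
Proof.
have h : shx eps Q - shx eps P != 0 by rewrite subr_eq0 eq_sym.
rewrite shx_at /yat /s /mkseg /bind /sa /sb /pt_at /= -/P -/Q.
by field.
Qed.

Definition param (x : R) : R := (x - shx eps P) / (shx eps Q - shx eps P).

Lemma shx_param x : shx eps (pt_at P Q (param x)) = x.
Proof.
have h : shx eps Q - shx eps P != 0 by rewrite subr_eq0 eq_sym.
by rewrite shx_at /param; field.
Qed.

Lemma param_shx t : param (shx eps (pt_at P Q t)) = t.
Proof.
have h : shx eps Q - shx eps P != 0 by rewrite subr_eq0 eq_sym.
by rewrite shx_at /param; field.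
Qed.

Lemma ends : (sxl s = shx eps P /\ sxr s = shx eps Q) \/ (sxl s = shx eps Q /\ sxr s = shx eps P).
Proof. by rewrite /s /mkseg /bind /sxl /sxr /=; case: ifP; [left|right]. Qed.

Lemma param_in x : (0 <= param x <= 1) = (sxl s <= x <= sxr s).
Proof.
have := mkseg_lr; rewrite /param.
case: ends => -[-> ->] lt.
  have h : 0 < shx eps Q - shx eps P by rewrite subr_gt0.
  by rewrite ler_pdivlMr // ler_pdivrMr // mul0r mul1r subr_ge0 lerD2r.
have h : 0 < shx eps P - shx eps Q by rewrite subr_gt0.
rewrite -opprB -[shx eps Q - _]opprB invrN mulrNN.
by rewrite ler_pdivlMr // ler_pdivrMr // mul0r mul1r subr_ge0 andbC lerD2l lerN2.
Qed.

Lemma param_in_open x : (0 < param x < 1) = (sxl s < x < sxr s).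
Proof.
have := mkseg_lr; rewrite /param.
case: ends => -[-> ->] lt.
  have h : 0 < shx eps Q - shx eps P by rewrite subr_gt0.
  by rewrite ltr_pdivlMr // ltr_pdivrMr // mul0r mul1r subr_gt0 ltrD2r.
have h : 0 < shx eps P - shx eps Q by rewrite subr_gt0.
rewrite -opprB -[shx eps Q - _]opprB invrN mulrNN.
by rewrite ltr_pdivlMr // ltr_pdivrMr // mul0r mul1r subr_gt0 andbC ltrD2l ltrN2.
Qed.

(** [share] measures from the left end and [param] from the tail; the minimum does not depend on the
    orientation. *)
Lemma share_param x : share s x = Num.min (param x) (1 - param x).
Proof.
have h : shx eps Q - shx eps P != 0 by rewrite subr_eq0 eq_sym.
have h' : shx eps P - shx eps Q != 0 by rewrite subr_eq0.
rewrite /share /bind /param; case: ends => -[-> ->].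
  by rewrite minElt; case: ltgtP.
have -> : (x - shx eps Q) / (shx eps P - shx eps Q) = 1 - (x - shx eps P) / (shx eps Q - shx eps P).
  by field; rewrite h h'.
rewrite opprB addrCA subrr addr0 minElt; case: ltgtP => // e'.
Qed.

Lemma share_bound x : sxl s < x < sxr s -> 0 < share s x <= one_half.
Proof.
rewrite share_param -param_in_open => /andP[h0 h1].
rewrite lt_min h0 subr_gt0 h1 ge_min; apply/orP; have e2 := one_half_add.
by case: (lerP (param x) one_half) => h; [left|right; lra].
Qed.

End OneSegment.

Lemma shx_inj eps (p q : R * R) : shx eps p = shx eps q -> p.2 = q.2 -> p = q.
Proof. by case: p q => [x1 y1] [x2 y2]; rewrite /shx /= => + e; rewrite e => /addIr ->. Qed.

End Shear.

(** * The sheared edges of a drawing and their crossings *)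

Section DrawingSegments.
Variables (R : realType) (n m : nat) (G : sgraph n m) (D : drawing R G).
Local Open Scope ring_scope.
Local Notation eg := (intersection_graph D).

Definition raw (s : 'I_m) : raw_edge R := (val s, (ptail D s, phead D s)).

Variable eps : R.
Hypothesis eps_ok : forall s, shx eps (raw s).2.1 != shx eps (raw s).2.2.
Definition sg (s : 'I_m) : seg R := mkseg eps (raw s).
Definition vx (w : 'I_n) : R := shx eps (pos D w).

Lemma sg_at s t : yat (sg s) (shx eps (pt_at (ptail D s) (phead D s) t)) = (pt_at (ptail D s) (phead D s) t).2.
Proof. exact: (mkseg_at (eps_ok s)). Qed.

Lemma sg_lr s : sxl (sg s) < sxr (sg s).
Proof. exact: (mkseg_lr (eps_ok s)). Qed.

Lemma sg_vertex w s : incident G w s ->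
  yat (sg s) (vx w) = (pos D w).2 /\ (vx w = sxl (sg s) \/ vx w = sxr (sg s)).
Proof.
have e0 : pt_at (ptail D s) (phead D s) 0 = ptail D s.
  by rewrite /pt_at !mul0r !addr0 -surjective_pairing.
have e1 : pt_at (ptail D s) (phead D s) 1 = phead D s.
  by rewrite /pt_at !mul1r !subrKC -surjective_pairing.
have h0 := sg_at s 0; have h1 := sg_at s 1; rewrite e0 in h0; rewrite e1 in h1.
have := ends eps (raw s); rewrite -/(sg s) /= => he.
by case/orP => /eqP ->; split=> //; case: he => -[-> ->]; auto.
Qed.

Lemma left_vertex s : exists2 w, incident G w s & sxl (sg s) = vx w.
Proof.
by case: (ends eps (raw s)) => -[e _]; [exists (tail G s)|exists (Defs.head G s)]; rewrite // /incident eqxx ?orbT.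
Qed.

Lemma right_vertex s : exists2 w, incident G w s & sxr (sg s) = vx w.
Proof.
by case: (ends eps (raw s)) => -[_ e]; [exists (Defs.head G s)|exists (tail G s)]; rewrite // /incident eqxx ?orbT.
Qed.

Lemma on_seg s p : sxl (sg s) <= shx eps p <= sxr (sg s) -> yat (sg s) (shx eps p) = p.2 ->
  p = pt_at (ptail D s) (phead D s) (param eps (raw s) (shx eps p)).
Proof.
move=> _ hy; set t := param _ _ _.
have hx : shx eps (pt_at (ptail D s) (phead D s) t) = shx eps p by exact: (shx_param (eps_ok s)).
by have := sg_at s t; rewrite hx hy => e; apply: (shx_inj (esym hx)).
Qed.

Lemma vertex_on w s : sxl (sg s) <= vx w <= sxr (sg s) -> yat (sg s) (vx w) = (pos D w).2 -> incident G w s.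
Proof.
move=> hx hy; have := on_seg hx hy; set t := param _ _ _ => e.
have := hx; rewrite /sg -(param_in (eps_ok s)) -/t => /andP[t0 t1].
case: (boolP (incident G w s)) => // ni; exfalso.
have [z|z] := eqVneq t 0.
  move: e; rewrite z /pt_at !mul0r !addr0 -surjective_pairing => /pos_inj e.
  by move: ni; rewrite /incident e eqxx.
have [o|o] := eqVneq t 1.
  move: e; rewrite o /pt_at !mul1r !subrKC -surjective_pairing => /pos_inj e.
  by move: ni; rewrite /incident e eqxx orbT.
apply: (no_vertex_inside ni); exists t; last exact: e.
by rewrite !lt_neqAle eq_sym z t0 o t1.
Qed.

Lemma two_vertices w w' s t : incident G w s -> incident G w t -> incident G w' s ->
  incident G w' t -> w != w' -> s = t.
Proof.
have H u : incident G w u -> incident G w' u -> w != w' -> [set tail G u; Defs.head G u] = [set w; w'].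
  by rewrite /incident => /orP[] /eqP -> /orP[] /eqP ->; rewrite ?eqxx // setUC.
by move=> h1 h2 h3 h4 ne; apply: (@no_multi_edge _ _ G); rewrite /= (H s) // (H t).
Qed.

Lemma vertex_tie w s t : incident G w s -> sxl (sg t) <= vx w <= sxr (sg t) ->
  yat (sg s) (vx w) = yat (sg t) (vx w) -> incident G w t.
Proof. by move=> /sg_vertex[h _] hx e; apply: vertex_on => //; rewrite -e. Qed.

(** Parallel segments that meet lie on one line. Both ends of their overlap are vertices incident to
    both edges; as the graph is simple these coincide, and the overlap is a point. *)
Lemma parallel_tie s t x : s != t -> sa (sg s) = sa (sg t) ->
  sxl (sg s) <= x <= sxr (sg s) -> sxl (sg t) <= x <= sxr (sg t) -> yat (sg s) x = yat (sg t) x ->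
  (x = sxl (sg s) /\ x = sxr (sg t)) \/ (x = sxr (sg s) /\ x = sxl (sg t)).
Proof.
move=> st es /andP[s1 s2] /andP[t1 t2]; rewrite /yat es => /addrI eb.
have ey y : yat (sg s) y = yat (sg t) y by rewrite /yat es eb.
have ls := sg_lr s; have lt := sg_lr t.
have [w [w1 w2 w3]] : exists w, [/\ incident G w s, incident G w t & vx w = Num.max (sxl (sg s)) (sxl (sg t))].
  rewrite maxEle; case: ifP => h.
    have [w wt e] := left_vertex t; exists w; rewrite e; split=> //.
    by apply: (vertex_tie wt); rewrite -?e // h (le_trans t1).
  have {}h : sxl (sg t) <= sxl (sg s) by rewrite ltW // ltNge h.
  have [w wt e] := left_vertex s; exists w; rewrite e; split=> //.
  by apply: (vertex_tie wt); rewrite -?e // h (le_trans s1).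
have [w' [v1 v2 v3]] : exists w, [/\ incident G w s, incident G w t & vx w = Num.min (sxr (sg s)) (sxr (sg t))].
  rewrite minEle; case: ifP => h.
    have [w' wt e] := right_vertex s; exists w'; rewrite e; split=> //.
    by apply: (vertex_tie wt); rewrite -?e // h (le_trans t1).
  have {}h : sxr (sg t) <= sxr (sg s) by rewrite ltW // ltNge h.
  have [w' wt e] := right_vertex t; exists w'; rewrite e; split=> //.
  by apply: (vertex_tie wt); rewrite -?e // h (le_trans s1).
have [ww|ne] := eqVneq w w'; last by rewrite (two_vertices w1 w2 v1 v2 ne) eqxx in st.
move: w3; rewrite ww v3 maxEle minEle.
by case: ifP => h1; case: ifP => h2 h3; first [by left; split; lra|by right; split; lra].
Qed.

(** An end of one segment that lies on the other is a vertex on that edge, hence an end of both.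
    What remains is a common end or a crossing interior to both. *)
Lemma sg_tie s t x : s != t ->
  sxl (sg s) <= x <= sxr (sg s) -> sxl (sg t) <= x <= sxr (sg t) -> yat (sg s) x = yat (sg t) x ->
  [\/ cross (sg s) (sg t) x, [/\ x = sxl (sg s), x = sxl (sg t) & sa (sg s) != sa (sg t)],
      [/\ x = sxr (sg s), x = sxr (sg t) & sa (sg s) != sa (sg t)] |
      (x = sxl (sg s) /\ x = sxr (sg t)) \/ (x = sxr (sg s) /\ x = sxl (sg t))].
Proof.
move=> st hs ht ey.
have [es|ns] := eqVneq (sa (sg s)) (sa (sg t)).
  by apply: Or44; apply: parallel_tie.
have /andP[s1 s2] := hs; have /andP[t1 t2] := ht.
have [w ws lw] := left_vertex s; have [w' ws' rw] := right_vertex s.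
have [v vt lv] := left_vertex t; have [v' vt' rv] := right_vertex t.
have finS u : incident G u s -> x = vx u -> x = sxl (sg t) \/ x = sxr (sg t).
  move=> hu e; have /sg_vertex[_] : incident G u t by apply: (vertex_tie hu); rewrite -e.
  by rewrite -e.
have finT u : incident G u t -> x = vx u -> x = sxl (sg s) \/ x = sxr (sg s).
  move=> hu e; have /sg_vertex[_] : incident G u s by apply: (vertex_tie hu); rewrite -e.
  by rewrite -e.
have ls := sg_lr s; have lt := sg_lr t.
have [a|na] := eqVneq x (sxl (sg s)).
  by have [b|b] : x = sxl (sg t) \/ x = sxr (sg t); [apply: (finS w); rewrite -?lw|apply: Or42|apply: Or44; left].
have [a'|na'] := eqVneq x (sxr (sg s)).
  by have [b|b] : x = sxl (sg t) \/ x = sxr (sg t); [apply: (finS w'); rewrite -?rw|apply: Or44; right|apply: Or43].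
have [b|nb] := eqVneq x (sxl (sg t)).
  by case: (finT v); rewrite -?lv // => e; rewrite e eqxx in na na'.
have [b|nb'] := eqVneq x (sxr (sg t)).
  by case: (finT v'); rewrite -?rv // => e; rewrite e eqxx in na na'.
by apply: Or41; rewrite /cross ns ey eqxx !lt_neqAle s1 s2 t1 t2 na' nb' ![_ == x]eq_sym na nb.
Qed.

Lemma cross_not_end s t x z : cross (sg s) (sg t) x -> shx eps z = x -> ~ common_end D s t z.
Proof.
case/and5P => l r _ _ _ ez [w [/sg_vertex[_ h] _ e]].
by move: l r; rewrite -ez e; rewrite /vx in h; case: h => ->; rewrite ltxx.
Qed.

Lemma cross_point s t x : cross (sg s) (sg t) x ->
  pt_at (ptail D s) (phead D s) (param eps (raw s) x) = pt_at (ptail D t) (phead D t) (param eps (raw t) x).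
Proof.
case/and5P => _ _ _ _ /andP[/eqP e _].
set p := param _ _ _; set q := param _ _ _.
have hs : shx eps (pt_at (ptail D s) (phead D s) p) = x by exact: (shx_param (eps_ok s)).
have ht : shx eps (pt_at (ptail D t) (phead D t) q) = x by exact: (shx_param (eps_ok t)).
have := sg_at s p; have := sg_at t q; rewrite hs ht => e1 e2.
by apply: (@shx_inj _ eps); rewrite ?hs ?ht // -e1 -e2.
Qed.

Lemma common_point s t z : s != t -> segment D s z -> segment D t z -> ~ common_end D s t z ->
  cross (sg s) (sg t) (shx eps z).
Proof.
move=> st [p p01 ez] [q q01 ez'] nc.
have hs : sxl (sg s) <= shx eps z <= sxr (sg s).
  by rewrite -(param_in (eps_ok s)) ez (param_shx (eps_ok s)).
have ht : sxl (sg t) <= shx eps z <= sxr (sg t).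
  by rewrite -(param_in (eps_ok t)) ez' (param_shx (eps_ok t)).
have ys : yat (sg s) (shx eps z) = z.2 by rewrite ez sg_at.
have yt : yat (sg t) (shx eps z) = z.2 by rewrite ez' sg_at.
have fin w : incident G w s -> vx w = shx eps z -> False.
  move=> hw e; have [y _] := sg_vertex hw.
  have ew : pos D w = z by apply: (@shx_inj _ eps) => //; rewrite -y e ys.
  by apply: nc; exists w; split=> //; apply: (vertex_tie hw); rewrite e // ys yt.
have [w ws lw] := left_vertex s; have [w' ws' rw] := right_vertex s.
case: (sg_tie st hs ht (etrans ys (esym yt))) => //.
- by case=> e _ _; case: (fin w); rewrite // -lw.
- by case=> e _ _; case: (fin w'); rewrite // -rw.
- by case=> -[e _]; [case: (fin w); rewrite // -lw|case: (fin w'); rewrite // -rw].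
Qed.

Lemma crossingE s t : s != t -> crossing D s t <-> exists x, cross (sg s) (sg t) x.
Proof.
move=> st; split=> [[z [hs ht nc]]|[x c]].
  by exists (shx eps z); apply: common_point.
have e := cross_point c.
have hs := shx_param (eps_ok s) x.
exists (pt_at (ptail D s) (phead D s) (param eps (raw s) x)); split.
- exists (param eps (raw s) x) => //; rewrite (param_in (eps_ok s)).
  by case/and5P: c => a b _ _ _; rewrite !ltW.
- rewrite e; exists (param eps (raw t) x) => //; rewrite (param_in (eps_ok t)).
  by case/and5P: c => _ _ a b _; rewrite !ltW.
- exact: cross_not_end c hs.
Qed.

Lemma egE s t : eg s t <-> exists x, cross (sg s) (sg t) x.
Proof.
rewrite /intersection_graph /=; split=> [/andP[st /asboolP]|h].
  by move/(crossingE st).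
have st : s != t by apply/eqP => e; move: h; rewrite e => -[x /and5P[_ _ _ _ /andP[_]]]; rewrite eqxx.
by rewrite st; apply/asboolP/crossingE.
Qed.

(** Strict, because stubs do not contain their inner ends. This is why the constraints in [is_SPEDE]
    are weak inequalities, so that thresholds themselves are admissible ratios. *)
Lemma stub_share f s z : (f s).1 = (f s).2 -> 0 < (f s).1 <= one_half ->
  stub_tail D f s z \/ stub_head D f s z ->
  segment D s z /\ share (sg s) (shx eps z) < (f s).1.
Proof.
have e2 := one_half_add R.
move=> e /andP[g0 g1]; rewrite /stub_head -e => h.
have [p [p0 p1 hp ->]] : exists p, [/\ 0 <= p, p <= 1, Num.min p (1 - p) < (f s).1 &
    z = pt_at (ptail D s) (phead D s) p].
  case: h => -[p /andP[p0 p1] ->].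
    by exists p; split; [|lra|rewrite gt_min p1|].
  exists (1 - p); split; [lra|lra|by rewrite gt_min subKr p1 orbT|].
  by rewrite /pt_at; congr pair; ring.
split; first by exists p; rewrite ?p0.
by rewrite (share_param (eps_ok s)) (param_shx (eps_ok s)).
Qed.

Lemma share_stub f s x : (f s).1 = (f s).2 -> sxl (sg s) < x < sxr (sg s) ->
  share (sg s) x < (f s).1 ->
  let z := pt_at (ptail D s) (phead D s) (param eps (raw s) x) in stub_tail D f s z \/ stub_head D f s z.
Proof.
move=> e; rewrite -(param_in_open (eps_ok s)) (share_param (eps_ok s)) => /andP[p0 p1].
rewrite gt_min => /orP[] h /=; first by left; exists (param eps (raw s) x); rewrite // ltW.
right; exists (1 - param eps (raw s) x); first by rewrite -e h andbT; lra.
by rewrite /pt_at; congr pair; ring.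
Qed.

Lemma is_SPEDE f : is_SPED D f <->
  (forall s, (f s).1 = (f s).2 /\ 0 < (f s).1 <= one_half) /\
  (forall s t x, s != t -> cross (sg s) (sg t) x ->
    (f s).1 <= share (sg s) x \/ (f t).1 <= share (sg t) x).
Proof.
split=> [[[h1 h2] h3]|[h1 h2]].
  split=> [s|s t x st c].
    split=> //; have [a b d] := h1 s; rewrite a /=; rewrite -h3 in d; have := one_half_add R; lra.
  have [h|hs] := lerP (f s).1 (share (sg s) x); first by left.
  have [h|ht] := lerP (f t).1 (share (sg t) x); first by right.
  exfalso; have e := cross_point c; have nc := cross_not_end c (shx_param (eps_ok s) x).
  have /and5P[s1 s2 t1 t2 _] := c.
  have := share_stub (h3 s) _ hs; rewrite s1 s2 => /(_ isT) /= zs.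
  have := share_stub (h3 t) _ ht; rewrite t1 t2 => /(_ isT) /= zt.
  rewrite -e in zt; have [k1 k2 k3 k4] := h2 _ _ st.
  by case: zs zt => zs [] zt; [apply: k1|apply: k2|apply: k3|apply: k4];
    exists (pt_at (ptail D s) (phead D s) (param eps (raw s) x)).
have H s t z : s != t -> stub_tail D f s z \/ stub_head D f s z ->
    stub_tail D f t z \/ stub_head D f t z -> ~ common_end D s t z -> False.
  move=> st zs zt nc; have [es gs] := h1 s; have [et gt] := h1 t.
  have [ss ls] := stub_share es gs zs; have [stt lt] := stub_share et gt zt.
  by case: (h2 s t _ st (common_point st ss stt nc)); rewrite leNgt ?ls ?lt.
split; last by move=> s; have [] := h1 s.
split=> [s|s t st].
  have [e /andP[a b]] := h1 s; rewrite -e; split=> //.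
  by have := one_half_add R; lra.
by split=> -[z [zs zt nc]]; apply: (H s t z st) => //; auto.
Qed.

Lemma slen_sg s : slen (sg s) = len D s.
Proof. by rewrite /slen /sg /mkseg /bind /= /raw_len /len /dist !expr2. Qed.

Lemma len_ge0 s : 0 <= len D s.
Proof. exact: sqrtr_ge0. Qed.

End DrawingSegments.

Lemma uniq_keys (T U : eqType) (l : seq (T * U)) i g g' :
  uniq (map fst l) -> (i, g) \in l -> (i, g') \in l -> g = g'.
Proof.
elim: l => //= p l IH /andP[n u]; rewrite !inE => /orP[/eqP e|h] /orP[/eqP e'|h'].
- by case: (etrans e (esym e')).
- by move: n; rewrite -e (map_f fst h').
- by move: n; rewrite -e' (map_f fst h).
- exact: IH.
Qed.

(** * From the tree of crossings to a maximum SPED *)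

Section SweepTree.
Variables (R : realType) (n m : nat) (G : sgraph n m) (D : drawing R G).
Local Open Scope ring_scope.
Local Notation eg := (intersection_graph D).
Variable eps : R.
Hypothesis eps_ok : forall s, shx eps (raw D s).2.1 != shx eps (raw D s).2.2.
Hypothesis tree_eg : is_tree eg.
Local Notation sg := (sg D eps).
Variable S : seq (seg R).
Hypothesis pS : perm_eq S (map sg (enum 'I_m)).

Lemma sg_inj : injective sg.
Proof. by move=> s t /(congr1 (@sid R)); apply: val_inj. Qed.

Lemma memS s : s \in S -> exists v, s = sg v.
Proof. by rewrite (perm_mem pS) => /mapP[v _ ->]; exists v. Qed.

Lemma sgS v : sg v \in S.
Proof. by rewrite (perm_mem pS) map_f // mem_enum. Qed.

Lemma segs_ok_sg : segs_ok S.
Proof.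
have [_ egs _ _ acyc] := tree_eg.
split.
- by rewrite (perm_uniq pS) (map_inj_uniq sg_inj) enum_uniq.
- by move=> s t /memS[u ->] /memS[v ->] /val_inj ->.
- by move=> s /memS[u ->]; apply: sg_lr.
- move=> s t x /memS[u ->] /memS[v ->] ne; apply: (sg_tie eps_ok).
  by apply: contra_neq ne => ->.
- move=> s t u x /memS[a ->] /memS[b ->] /memS[c ->] ab ac bc cab cac cbc.
  have e1 : eg a b by apply/(egE eps_ok); exists x.
  have e2 : eg b c by apply/(egE eps_ok); exists x.
  have e3 : eg c a by rewrite egs; apply/(egE eps_ok); exists x.
  have ne d d' : sg d != sg d' -> d != d' by apply: contra_neq => ->.
  suff /acyc : ucycle eg [:: a; b; c] by [].
  by rewrite /ucycle [cycle _ _]/= e1 e2 e3 /= !inE negb_or (ne _ _ ab) (ne _ _ ac) (ne _ _ bc).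
Qed.

Definition swap (p : seg R * seg R) := (p.2, p.1).

Lemma out_pairs out : out_ok S out -> uniq (out ++ map swap out) /\
  forall p, p \in out ++ map swap out -> exists u w, [/\ eg u w, p = (sg u, sg w) & meet_x p.1 p.2 = meet_x p.2 p.1].
Proof.
case=> u h; split.
  rewrite cat_uniq u /= map_inj_uniq ?u ?andbT; last by move=> [a b] [c d] [-> ->].
  apply/hasPn => q /mapP[[s t] /h[_ _ lt _] ->]; apply/negP => /h[_ _ lt' _].
  by have := lt_trans lt lt'; rewrite ltxx.
have H p : p \in out -> exists u w, [/\ eg u w, p = (sg u, sg w) & meet_x p.1 p.2 = meet_x p.2 p.1].
  case: p => s t /h[/memS[a ->] /memS[b ->] _ [x c]]; exists a, b; split=> //.
    by apply/(egE eps_ok); exists x.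
  have /and5P[_ _ _ _ /andP[/eqP e ne]] := c.
  by rewrite -(meet_xE ne e) -(@meet_xE _ (sg b) (sg a) x) // eq_sym.
move=> p; rewrite mem_cat => /orP[|/mapP[q hq ->]]; first exact: H.
have [a [b [e -> e']]] := H _ hq; exists b, a; split=> //.
by have [_ egs _ _ _] := tree_eg; rewrite egs.
Qed.

(** The order of the slopes keeps a pair and its reverse from both being reported, so the pairs and
    their reverses are distinct ordered edges of a tree, of which there are at most 2 (m - 1). *)
Lemma out_size out : out_ok S out -> (size out <= m.-1)%N.
Proof.
move=> ho; have [u h] := out_pairs ho.
have [m0 egs egi _ acyc] := tree_eg.
have /existsP[x0 _] : [exists x : 'I_m, true].
  by move: m0; rewrite card_ord => m0; apply/existsP; exists (Ordinal m0).
have := forest_edges egs egi acyc x0; rewrite card_ord.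
set P := [set p | _].
have : (size (out ++ map swap out) <= size (map (fun p => (sg p.1, sg p.2)) (enum P)))%N.
  apply: uniq_leq_size => // p /h[a [b [e -> _]]].
  by apply/mapP; exists (a, b); rewrite // mem_enum inE.
rewrite size_cat !size_map -cardE; lia.
Qed.

Definition al (u w : 'I_m) : R := share (sg u) (meet_x (sg u) (sg w)).

Lemma al_ok u w : eg u w -> 0 < al u w <= one_half.
Proof.
move=> /(egE eps_ok)[x c]; have /and5P[h1 h2 _ _ /andP[/eqP e ne]] := c.
by rewrite /al -(meet_xE ne e); apply: (share_bound (eps_ok u)); rewrite h1 h2.
Qed.

Lemma adj_spec fuel (adj := build_adj (sweep fuel S)) : (7 * size S <= size fuel)%N ->
  [/\ avl adj, sorted (@dlt R) (elems adj),
    forall e, e \in elems adj <-> exists u w, eg u w /\ e = de al (len D) u w &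
    (size (elems adj) <= 2 * m.-1)%N].
Proof.
move=> hf; have sS : size S = m by rewrite (perm_size pS) size_map -cardE card_ord.
have [|ho hcov] := sweep_spec segs_ok_sg out_size (fuel := fuel).
  by move: hf; rewrite sS; lia.
have [u h] := out_pairs ho; have sz := out_size ho.
rewrite /adj; move: ho hcov u h sz; set out := sweep fuel S => ho hcov u h sz {adj}.
pose g (p : seg R * seg R) := mkde (meet_x p.1 p.2) p.1 p.2.
have pf : perm_eq (flatten (map (@both_de R) out)) (map g (out ++ map swap out)).
  have hm p : p \in out -> meet_x p.1 p.2 = meet_x p.2 p.1.
    by move=> hp; have [|a [b [_ _ e]]] := h p; rewrite // mem_cat hp.
  elim: (out) hm => //= p l IH hm.
  have hp : meet_x p.1 p.2 = meet_x p.2 p.1 by apply: hm; rewrite mem_head.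
  have {}IH : perm_eq (flatten (map (@both_de R) l)) (map g (l ++ map swap l)).
    by apply: IH => q hq; apply: hm; rewrite inE hq orbT.
  rewrite !map_cat /= -cat_rcons -[g p :: _]cat1s.
  rewrite perm_sym -!cats1 -!catA perm_sym.
  rewrite {1}/both_de hp -/(g (swap p)) -{1}hp -/(g p).
  rewrite -[[:: g p, _ & _]]/([:: g p] ++ [:: g (swap p)] ++ flatten (map (@both_de R) l)).
  by rewrite perm_cat2l perm_sym perm_catCA perm_cat2l -map_cat perm_sym.
have ug : uniq (map (@dkey R) (map g (out ++ map swap out))).
  rewrite -map_comp map_inj_in_uniq //.
  move=> p q /h[a [b [_ -> _]]] /h[c [d [_ -> _]]].
  by case=> /val_inj -> /val_inj ->.
have [|a1 a2 a3] := @build_spec R out Lf isT isT.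
  by rewrite cats0 (perm_uniq (perm_map (@dkey R) pf)).
rewrite -/(build_adj out) cats0 in a1 a2 a3.
have pa := perm_trans a3 pf.
split=> //; last by rewrite (perm_size pa) size_map size_cat size_map; lia.
have gE v w : eg v w -> g (sg v, sg w) = de al (len D) v w.
  move=> /(egE eps_ok)[x c]; have /and5P[_ _ _ _ /andP[/eqP e ne]] := c.
  rewrite /g /mkde /de /al -(slen_sg D eps w) -(meet_xE ne e).
  by rewrite -(@meet_xE _ (sg w) (sg v) x) // eq_sym.
move=> e; rewrite (perm_mem pa); split=> [/mapP[p /h[v [w [ew -> _]]] ->]|[v [w [ew ->]]]].
  by exists v, w; rewrite gE.
rewrite -gE //; apply/mapP; exists (sg v, sg w) => //.
have /(egE eps_ok)[x c] := ew.
by rewrite mem_cat; case/orP: (hcov _ _ _ (sgS v) (sgS w) c) => hh; rewrite ?hh //;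
   apply/orP; right; apply/mapP; exists (sg w, sg v).
Qed.

Definition value_of (f : 'I_m -> R * R) (i : nat) : R := if insub i is Some s then (f s).1 else 0.

Lemma value_ofE f (s : 'I_m) : value_of f (val s) = (f s).1.
Proof. by rewrite /value_of valK. Qed.

Section Rose.
Variable r : rose R.
Hypothesis rn : perm_eq (rnodes r) (map (fun v : 'I_m => (val v, len D v)) (enum 'I_m)).
Hypothesis re1 : forall e, e \in redges r -> exists u w, eg u w /\ e = te al u w.
Hypothesis re2 : forall u w, eg u w -> (te al u w \in redges r) || (te al w u \in redges r).

Lemma SPED_rose f : is_SPED D f <-> [/\ forall s, (f s).1 = (f s).2,
  nfeas (value_of f) (rnodes r) & efeas (value_of f) (redges r)].
Proof.
split.
  case/(is_SPEDE eps_ok) => h1 h2; split.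
  - by move=> s; case: (h1 s).
  - by move=> p; rewrite (perm_mem rn) => /mapP[s _ ->]; rewrite value_ofE; case: (h1 s).
  - move=> e /re1[u [w [ew ->]]]; rewrite /= !value_ofE /al.
    have ne : u != w by case/andP: ew.
    have /(egE eps_ok)[x c] := ew; have /and5P[_ _ _ _ /andP[/eqP ee nn]] := c.
    by rewrite -(meet_xE nn ee) -(@meet_xE _ (sg w) (sg u) x) ?(esym ee) 1?eq_sym //; apply: h2.
case=> h1 h2 h3; apply/(is_SPEDE eps_ok); split=> s.
  split=> //; rewrite -value_ofE; apply: (h2 (val s, len D s)).
  by rewrite (perm_mem rn); apply/mapP; exists s; rewrite ?mem_enum.
move=> t x ne c; have es : eg s t by apply/(egE eps_ok); exists x.
have /and5P[_ _ _ _ /andP[/eqP ee nn]] := c.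
have x1 := meet_xE nn ee.
have x2 : x = meet_x (sg t) (sg s) by apply: meet_xE; rewrite // eq_sym.
case/orP: (re2 es) => /h3; rewrite /= !value_ofE /al -x1 -x2 //.
by case; [right|left].
Qed.

Lemma ink_rose f : (forall s, (f s).1 = (f s).2) -> PED_ink D f = ink_of (value_of f) (rnodes r).
Proof.
move=> h; rewrite /ink_of (perm_big _ rn) /= big_map big_enum /=.
by apply: eq_bigr => s _; rewrite value_ofE -h mulrDl mulrC.
Qed.

Lemma rasg_keys (q : rose R) b : map fst (rasg q b) = map fst (rnodes q).
Proof.
elim/rose_ind': q b => i cs IH b /=; congr cons.
rewrite !map_flatten -!map_comp; congr flatten.
elim: cs IH => //= c cs IHc IH; rewrite /= IH; last by left.
by rewrite IHc // => d hd; apply: IH; right.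
Qed.

Lemma rose_optimal f : rwf r -> (forall s, (f s).1 = (f s).2) ->
  (forall s, (val s, (f s).1) \in rasg r true) -> is_MaxSPED D f.
Proof.
move=> w fe fr.
have uk : uniq (map fst (rasg r true)).
  by rewrite rasg_keys (perm_uniq (perm_map fst rn)) -map_comp map_inj_uniq ?enum_uniq //; apply: val_inj.
have ag : agrees (value_of f) (rasg r true).
  move=> p hp; have : p.1 \in map fst (rasg r true) by rewrite map_f.
  rewrite rasg_keys (perm_mem (perm_map fst rn)) -map_comp => /mapP[s _ /= e].
  case: p hp e => i g hp /= e; rewrite e value_ofE.
  by move: hp; rewrite e => hp; apply: uniq_keys uk (fr s) hp.
have [h1 h2 h3 _] := rose_attained w ag.
split; first by apply/SPED_rose.
move=> g sg'; have /SPED_rose[g1 g2 g3] := sg'.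
rewrite (ink_rose fe) (ink_rose g1) h3.
by have [] := rose_upper w g2 g3.
Qed.
End Rose.
End SweepTree.

(** * The algorithm *)

Section Solve.
Variable R : realType.
Local Notation seg := (seg R).

Definition segments (E : seq (raw_edge R)) : seq seg :=
  bind (shear E) (fun eps => foldl (fun S e => mkseg eps e :: S) [::] E).

(* The sweep takes at most 5 m + 2 (m - 1) steps, the depth-first search fewer
   than 2 m and the assignment of the ratios m. *)
Definition fuel (S : seq seg) : seq seg :=
  foldl (fun F s => [:: s, s, s, s, s, s, s & F]) [::] S.

Definition dfs_all (F : seq seg) (st : dstate R) : dstate R :=
  foldl (fun st _ => dfs_step st) st F.

Definition asg_loop (F : seq seg) (st : asg_state R) : asg_state R :=
  foldl (fun st _ => asg_step st) st F.

Definition dfs_start (adj : tree (dedge R)) (s : seg) : dstate R :=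
  (adj, ([:: ((sid s, (slen s, (one_half, one_half))), [::])], [::])).

Definition solve_segs (S : seq seg) : seq (nat * R) :=
  bind (fuel S) (fun F => bind (build_adj (sweep F S)) (fun adj =>
    lcase S [::] (fun s _ => lcase (dfs_all F (dfs_start adj s)).2.2 [::] (fun r _ =>
      (asg_loop F ([:: (r, true)], [::])).2)))).

Definition solve (E : seq (raw_edge R)) : seq (nat * R) := solve_segs (segments E).

Lemma size_fuel S : size (fuel S) = (7 * size S)%N.
Proof.
have H (F : seq seg) : size (foldl (fun F s => [:: s, s, s, s, s, s, s & F]) F S) = (size F + 7 * size S)%N.
  by elim: S F => [|s S IH] F /=; rewrite ?IH /=; lia.
by rewrite /fuel H.
Qed.

Definition sweep_cost (F S : seq seg) : nat :=
  fold_cost (fun Q s => enqueue (right_event s) (enqueue (left_event s) Q)) (fun Q s => depth Q) Lf S +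
  fold_cost (fun st (_ : seg) => sweep_step st) (fun st _ => st_depth st) (init_queue S, (Lf, [::])) F.
Definition build_cost (out : seq (seg * seg)) : nat :=
  fold_cost (@build_step R) (fun T _ => depth T) Lf out.
Definition dfs_all_cost (F : seq seg) (st : dstate R) : nat :=
  fold_cost (fun st _ => dfs_step st) (fun st _ => dfs_cost st) st F.
Definition asg_cost (F : seq seg) (st : asg_state R) : nat :=
  fold_cost (fun st _ => asg_step st)
    (fun st _ => lcase st.1 0 (fun rb _ => size (rchildren rb.1)))%N st F.

Definition solve_cost (S : seq seg) : nat :=
  size S + (sweep_cost (fuel S) S + (build_cost (sweep (fuel S) S) +
    lcase S 0 (fun s _ =>
      bind (dfs_start (build_adj (sweep (fuel S) S)) s) (fun st => dfs_all_cost (fuel S) st +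
      lcase (dfs_all (fuel S) st).2.2 0 (fun r _ => asg_cost (fuel S) ([:: (r, true)], [::])))))).

Lemma Comp_shear : Comp (@shear R) (fun E => size E).
Proof.
have h : Comp (fun q : nat * (R * raw_edge R) => eps_step q.2.1 q.2.2) (fun=> 0).
  by rewrite /eps_step /absr; comp0.
rewrite /shear; apply: Comp_le 1 _ _; last first.
  by eapply (Comp_foldl (c := fun=> 0%N) (f := fun _ g e => eps_step g e) h); comp.
move=> E /=; set X := fold_cost _ _ _ _.
have : (X <= 1 * size E)%N by apply: fold_cost_all.
lia.
Qed.

Lemma Comp_segments : Comp segments (fun E => size E).
Proof.
have h : Comp (fun q : R * raw_edge R => mkseg q.1 q.2) (fun=> 0).
  by rewrite /mkseg /raw_len /shx; comp0.
have hs : Comp (fun q : R * (seq seg * raw_edge R) => mkseg q.1 q.2.2 :: q.2.1) (fun=> 0) by comp0.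
rewrite /segments; apply: Comp_le 2 _ _; last first.
  eapply Comp_bind; first exact: Comp_shear.
  by eapply (Comp_foldl (f := fun eps S e => mkseg eps e :: S) hs); comp.
move=> E /=; set X := fold_cost _ _ _ _.
have : (X <= 1 * size E)%N by apply: fold_cost_all.
lia.
Qed.

Lemma Comp_fuel : Comp fuel (fun S => size S).
Proof.
have h : Comp (fun q : nat * (seq seg * seg) =>
   [:: q.2.2, q.2.2, q.2.2, q.2.2, q.2.2, q.2.2, q.2.2 & q.2.1]) (fun=> 0) by comp0.
rewrite /fuel; apply: Comp_le 1 _ _; last first.
  by eapply (Comp_foldl (c := fun=> 0%N) (f := fun _ F s => [:: s, s, s, s, s, s, s & F]) h); comp.
move=> E /=; set X := fold_cost _ _ _ _.
have : (X <= 1 * size E)%N by apply: fold_cost_all.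
lia.
Qed.

Lemma Comp_dfs_all : Comp (fun q : seq seg * dstate R => dfs_all q.1 q.2) (fun q => dfs_all_cost q.1 q.2).
Proof.
have h : Comp (fun q : nat * (dstate R * seg) => dfs_step q.2.1) (fun q => dfs_cost q.2.1).
  have h0 : Comp (fun q : nat * (dstate R * seg) => q.2.1) (fun=> 0) by comp0.
  by apply: Comp_le 1 _ (Comp_comp h0 (@Comp_dfs_step R)) => q /=; lia.
rewrite /dfs_all; apply: Comp_le 1 _ _; last first.
  by eapply (Comp_foldl (c := fun=> 0%N) (f := fun _ st _ => dfs_step st) h); comp.
move=> q /=; rewrite /dfs_all_cost; lia.
Qed.

Lemma Comp_asg_loop : Comp (fun q : seq seg * asg_state R => asg_loop q.1 q.2) (fun q => asg_cost q.1 q.2).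
Proof.
have h : Comp (fun q : nat * (asg_state R * seg) => asg_step q.2.1)
    (fun q => lcase q.2.1.1 0%N (fun rb _ => size (rchildren rb.1))).
  have h0 : Comp (fun q : nat * (asg_state R * seg) => q.2.1) (fun=> 0) by comp0.
  by apply: Comp_le 1 _ (Comp_comp h0 (@Comp_asg_step R)) => q /=; lia.
rewrite /asg_loop; apply: Comp_le 1 _ _; last first.
  by eapply (Comp_foldl (c := fun=> 0%N) (f := fun _ st _ => asg_step st) h); comp.
move=> q /=; rewrite /asg_cost; lia.
Qed.

Lemma Comp_solve_segs : Comp solve_segs solve_cost.
Proof.
have hb : Comp (fun q : seq seg * seq seg => build_adj (sweep q.2 q.1))
    (fun q => sweep_cost q.2 q.1 + build_cost (sweep q.2 q.1)).
  have h0 : Comp (fun q : seq seg * seq seg => (q.2, q.1)) (fun=> 0) by comp0.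
  apply: Comp_le 1 _ (Comp_comp (Comp_comp h0 (@Comp_sweep R)) (@Comp_build R)) => q /=.
  by rewrite /sweep_cost /build_cost; lia.
have hst : Comp (fun q : tree (dedge R) * seg => dfs_start q.1 q.2) (fun=> 0).
  by rewrite /dfs_start /sid /slen /one_half; comp0.
rewrite /solve_segs; apply: Comp_le 2 _ _; last first.
  eapply Comp_bind; first exact: Comp_fuel.
  eapply Comp_bind; first exact: hb.
  eapply Comp_lcase; [comp|comp|].
  eapply Comp_lcase; [|comp|].
    eapply Comp_snd; eapply Comp_snd; eapply (Comp_fun2 Comp_dfs_all); [comp|].
    comp.
  eapply Comp_snd; eapply (Comp_fun2 Comp_asg_loop); comp.
move=> S /=; rewrite /solve_cost; case: S => [|s S] /=; first lia.
rewrite /bind; case: ((dfs_all _ _).2.2) => [|r l] /=; lia.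
Qed.

Lemma Comp_solve : Comp solve (fun E => size E + solve_cost (segments E)).
Proof. exact: Comp_comp Comp_segments Comp_solve_segs. Qed.

End Solve.

Lemma fold_depth_cost (T X : Type) (f : tree T -> X -> tree T) N t (l : seq X) :
  (forall t x, avl t -> avl (f t x) /\ (size (elems (f t x)) <= size (elems t) + 2)%N) -> avl t ->
  (size (elems t) + 2 * size l <= N)%N ->
  (fold_cost f (fun t _ => depth t) t l <= (2 * trunc_log 2 N.+1 + 2) * size l)%N.
Proof.
move=> hf; elim: l t => //= x l IH t avt hN.
have [a1 s1] := hf t x avt.
have le1 : (trunc_log 2 (size (elems t)).+1 <= trunc_log 2 N.+1)%N by apply: leq_trunc_log; lia.
have d1 := avl_depth avt.
have : (fold_cost f (fun t _ => depth t) (f t x) l <= (2 * trunc_log 2 N.+1 + 2) * size l)%N.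
  by apply: IH => //; lia.
rewrite mulnS; lia.
Qed.

Lemma size_elems_ins (T : Type) (p : T -> bool) x t : size (elems (ins p x t)) = (size (elems t)).+1.
Proof.
have hb l v r : size (elems (bal l v r)) = (size (elems l) + (size (elems r)).+1)%N.
  by rewrite elems_bal size_cat.
elim: t => //= h l IHl v r IHr; case: ifP => _; rewrite hb ?IHl ?IHr size_cat /=; lia.
Qed.

(** The size bounds of the trees, each increased by one, are at most [8 * m]; the factor 8 adds 3 to
    the logarithm. *)
Lemma trunc_log_mul8 m N : (0 < m)%N -> (N <= 8 * m)%N -> (trunc_log 2 N <= trunc_log 2 m + 3)%N.
Proof.
move=> m0 hN; apply: leq_trans (leq_trunc_log 2 hN) _.
have -> : (8 * m = 2 * (2 * (2 * m)))%N by lia.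
by rewrite !trunc_logMp ?muln_gt0 //; lia.
Qed.

(** Absorbs linear terms. The logarithm is positive from [m = 2] on; the summand 1 covers [m = 1],
    where it vanishes. *)
Lemma leq_mul_log m : (m <= m * trunc_log 2 m + 1)%N.
Proof.
case: (ltnP 1 m) => [lt|le]; last lia.
have h : (0 < trunc_log 2 m)%N by rewrite trunc_log_gt0.
by rewrite -[X in (X <= _)%N]muln1; apply: leq_trans (leq_mul (leqnn m) h) (leq_addr _ _).
Qed.

(** * Correctness and cost of the whole algorithm *)

Section SolveSpec.
Variables (R : realType) (n m : nat) (G : sgraph n m) (D : drawing R G).
Local Notation eg := (intersection_graph D).
Hypothesis tree_eg : is_tree eg.
Variable E : seq (raw_edge R).
Hypothesis pE : perm_eq E (map (raw D) (enum 'I_m)).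
Local Notation S := (segments E).

Lemma shear_ok s : shx (shear E) (raw D s).2.1 != shx (shear E) (raw D s).2.2.
Proof.
have [_ h] := shear_spec E; apply: h.
  have : raw D s \in E by rewrite (perm_mem pE) map_f ?mem_enum.
  by elim: (E) => //= e l IH; rewrite inE => /orP[/eqP ->|/IH]; [left|right].
by move=> /pos_inj /eqP; rewrite (negbTE (loopless G s)).
Qed.

Lemma segments_perm : perm_eq S (map (sg D (shear E)) (enum 'I_m)).
Proof.
have h (f : raw_edge R -> seg R) l T : perm_eq (foldl (fun S e => f e :: S) T l) (map f l ++ T).
  elim: l T => //= e l IH T; apply: perm_trans (IH _) _.
  by rewrite -[f e :: T]cat1s perm_catCA.
apply: perm_trans (h _ _ _) _; rewrite cats0.
by have := perm_map (mkseg (shear E)) pE; rewrite -map_comp.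
Qed.

Lemma size_segments : size S = m.
Proof. by rewrite (perm_size segments_perm) size_map -cardE card_ord. Qed.

Lemma size_F : (7 * size S <= size (fuel S))%N.
Proof. by rewrite size_fuel. Qed.

Local Notation eps_ok := shear_ok.
Local Notation pS := segments_perm.
Local Notation alE := (al D (shear E)).
Local Notation adj := (build_adj (sweep (fuel S) S)).

Lemma m_gt0 : (0 < m)%N.
Proof. by have [] := tree_eg; rewrite card_ord. Qed.

Lemma first_segment : exists s0 S', S = sg D (shear E) s0 :: S'.
Proof.
have : size S <> 0%N by rewrite size_segments; have := m_gt0; lia.
have := @memS R n m G D (shear E) S pS.
by case: (S) => //= s S' /(_ s (mem_head _ _))[s0 ->] _; exists s0, S'.
Qed.

Lemma dfs_startE s : dfs_start adj (sg D (shear E) s) = (adj, ([:: root_frame (len D) s], [::])).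
Proof. by rewrite /dfs_start slen_sg. Qed.

Lemma dfs_result s :
  exists r, [/\ (dfs_all (fuel S) (dfs_start adj (sg D (shear E) s))).2.2 = [:: r],
   rwf r, perm_eq (rnodes r) (map (fun v : 'I_m => (val v, len D v)) (enum 'I_m)),
   (forall e, e \in redges r -> exists u w, eg u w /\ e = te alE u w) &
   (forall u w, eg u w -> (te alE u w \in redges r) || (te alE w u \in redges r))].
Proof.
have [_ egs egi con acyc] := tree_eg.
have [a1 a2 a3 a4] := adj_spec eps_ok tree_eg pS size_F.
have [|r [h1 h2 h3 h4 h5]] :=
  @dfs_spec R m eg alE (len D) egs egi acyc (al_ok eps_ok) (@len_ge0 R n m G D) con s adj _ (fuel S) a1 a2 a3.
  rewrite size_fuel size_segments; have := m_gt0; lia.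
by exists r; split=> //; rewrite dfs_startE.
Qed.

Lemma asg_result r (a := (asg_loop (fuel S) ([:: (r, true)], [::])).2) :
  perm_eq (rnodes r) (map (fun v : 'I_m => (val v, len D v)) (enum 'I_m)) ->
  perm_eq a (rasg r true) /\ (asg_loop (fuel S) ([:: (r, true)], [::])).1 = [::].
Proof.
move=> hr; have [|e p] := @asg_fold R _ (fuel S) ([:: (r, true)], [::]).
  rewrite /asg_all /= cats0 -(size_map fst) rasg_keys size_map (perm_size hr) size_map -cardE card_ord.
  rewrite size_fuel size_segments; lia.
by split=> //; move: p; rewrite /asg_all /= !cats0.
Qed.

Lemma solve_spec : perm_eq (map fst (solve E)) (map val (enum 'I_m)) /\
  forall f, (forall s, (f s).1 = (f s).2) -> (forall s : 'I_m, (val s, (f s).1) \in solve E) ->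
    is_MaxSPED D f.
Proof.
have [s0 [S' eS]] := first_segment.
have [r [h1 h2 h3 h4 h5]] := dfs_result s0.
have [p _] := asg_result h3.
have e : solve E = (asg_loop (fuel S) ([:: (r, true)], [::])).2.
  have unfold (S0 : seq (seg R)) t S1 : S0 = t :: S1 -> solve_segs S0 =
      lcase (dfs_all (fuel S0) (dfs_start (build_adj (sweep (fuel S0) S0)) t)).2.2 [::]
        (fun r _ => (asg_loop (fuel S0) ([:: (r, true)], [::])).2) by move=> ->.
  by rewrite /solve (@unfold _ _ _ eS) h1.
rewrite e; split.
  by apply: perm_trans (perm_map fst p) _; rewrite rasg_keys; have := perm_map fst h3; rewrite -map_comp.
move=> f f1 f2; apply: (rose_optimal eps_ok h3 h4 h5 h2 f1) => s.
by rewrite -(perm_mem p).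
Qed.

Section Cost.
Variable k : nat.
Hypothesis hk : max_degree eg = k.
Local Notation lg := (trunc_log 2 m).

(** The potential bounds the length of the queue too, so the queue never exceeds [7 * m] events; the
    status is a duplicate-free part of the segments. Hence both trees have logarithmic depth
    throughout. *)
Lemma sweep_cost_bound : (sweep_cost (fuel S) S <= 200 * (m * (lg + 1)))%N.
Proof.
have m0 := m_gt0; have sok := segs_ok_sg eps_ok tree_eg pS.
have hK := out_size eps_ok tree_eg pS.
have c1 : (fold_cost (fun Q s => enqueue (right_event s) (enqueue (left_event s) Q)) (fun Q s => depth Q) Lf S
    <= (2 * trunc_log 2 (2 * m).+1 + 2) * m)%N.
  rewrite -{2}size_segments; apply: fold_depth_cost => //; last by rewrite size_segments.
  move=> Q s aQ; have [a1 _] := ins_avl (ev_before (left_event s)) (left_event s) aQ.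
  have [a2 _] := ins_avl (ev_before (right_event s)) (right_event s) a1.
  by split=> //; rewrite /enqueue !size_elems_ins; lia.
pose I (st : state R) := (exists X, SInv S X st) /\ (spot m.-1 st <= 7 * m)%N.
have I0 : I (init_queue S, (Lf, [::])).
  split; first exact: init_inv sok.
  have := init_spot S m.-1; rewrite size_segments; lia.
have c2 : (fold_cost (fun st (_ : seg R) => sweep_step st) (fun st _ => st_depth st) (init_queue S, (Lf, [::])) (fuel S)
   <= (2 * trunc_log 2 (7 * m).+1 + 1 + (2 * trunc_log 2 m.+1 + 1)).+1 * (7 * m))%N.
  have e7 : (7 * m = size (fuel S))%N by rewrite size_fuel size_segments.
  rewrite [X in (_ <= _ * X)%N]e7; apply: fold_cost_bound I0 => st _ [[X V] hs]; split.
    case: (elems st.1 =P [::]) => [e|ne]; first by rewrite sweep_step_nil //; split=> //; exists X.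
    have [X' [V' lt]] := sweep_step_inv sok hK V ne.
    by split; [exists X'|lia].
  have [a1 a2 V'] := V.
  apply: leq_add; [apply: leq_trans (avl_depth a1) _|apply: leq_trans (avl_depth a2) _]; rewrite leq_add2r leq_mul2l /=.
    by apply: leq_trunc_log; rewrite ltnS; apply: leq_trans hs; rewrite /spot /epot; lia.
  apply: leq_trunc_log; rewrite ltnS -size_segments; apply: uniq_leq_size (l_uniq V') _ => s.
  by rewrite (l_mem V') => /and3P[].
have l1 : (trunc_log 2 (2 * m).+1 <= lg + 3)%N by apply: trunc_log_mul8; lia.
have l2 : (trunc_log 2 (7 * m).+1 <= lg + 3)%N by apply: trunc_log_mul8; lia.
have l3 : (trunc_log 2 m.+1 <= lg + 3)%N by apply: trunc_log_mul8; lia.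
rewrite /sweep_cost; apply: leq_trans (leq_add c1 c2) _.
move: l1 l2 l3; set x := trunc_log 2 _; set y := trunc_log 2 _; set z := trunc_log 2 _ => l1 l2 l3.
apply: (@leq_trans ((2 * (lg + 3) + 2) * m + (4 * (lg + 3) + 3) * (7 * m))); last by lia.
by apply: leq_add; rewrite leq_mul2r; apply/orP; right; lia.
Qed.

Lemma build_cost_bound : (build_cost (sweep (fuel S) S) <= 10 * (m * (lg + 1)))%N.
Proof.
have m0 := m_gt0; have sok := segs_ok_sg eps_ok tree_eg pS.
have hK := out_size eps_ok tree_eg pS.
have [|ho _] := sweep_spec sok hK (fuel := fuel S).
  by rewrite size_fuel size_segments; lia.
have so := hK _ ho.
have c : (build_cost (sweep (fuel S) S) <= (2 * trunc_log 2 (2 * m).+1 + 2) * size (sweep (fuel S) S))%N.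
  apply: fold_depth_cost => //=; last by lia.
  move=> T p aT; rewrite /build_step /bind /ins_de.
  set q := dbefore _; set e := mkde _ _ _; set q' := dbefore _; set e' := mkde _ _ _.
  have [a1 _] := ins_avl q' e' aT; have [a2 _] := ins_avl q e a1.
  by split=> //; rewrite !size_elems_ins; lia.
have l1 : (trunc_log 2 (2 * m).+1 <= lg + 3)%N by apply: trunc_log_mul8; lia.
apply: leq_trans c _; move: so l1; set x := trunc_log 2 _; set y := size _ => so l1.
apply: (@leq_trans ((2 * (lg + 3) + 2) * m)); last by lia.
by apply: leq_mul; lia.
Qed.

Lemma degree_le v : (#|[set y | eg v y]| <= k)%N.
Proof. by rewrite -hk /max_degree; apply: (@leq_bigmax _ (fun x => #|[set y | eg x y]|)). Qed.

Lemma dfs_cost_bound s :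
  (dfs_all_cost (fuel S) (dfs_start adj (sg D (shear E) s)) <= 70 * (m * (lg + 1)) + 7 * (m * k))%N.
Proof.
have m0 := m_gt0; have [_ egs egi con acyc] := tree_eg.
have [a1 a2 a3 a4] := adj_spec eps_ok tree_eg pS size_F.
have d0 := dfs_init egs (@len_ge0 R n m G D) s a1 a2 a3.
rewrite dfs_startE.
have := @dfs_total_cost R m eg alE (len D) k egs egi acyc (al_ok eps_ok) (@len_ge0 R n m G D) degree_le
  s (2 * m)%N _ (fuel S) (adj, ([:: root_frame (len D) s], [::])).
move=> /(_ _)/leq_trans; apply; first by split=> //=; lia.
rewrite size_fuel size_segments.
have l1 : (trunc_log 2 (2 * m).+1 <= lg + 3)%N by apply: trunc_log_mul8; lia.
rewrite [children_sum _]/= muln0.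
move: l1; set x := trunc_log 2 _ => l1.
apply: (@leq_trans ((2 * (lg + 3) + k + 3) * (7 * m))); last by lia.
by rewrite add0n leq_mul2r; apply/orP; right; lia.
Qed.

(** A step costs the number of children it pushes, which is the growth of the list of pending
    subtrees plus one; that list is empty in the end. *)
Lemma asg_cost_bound r : perm_eq (rnodes r) (map (fun v : 'I_m => (val v, len D v)) (enum 'I_m)) ->
  (asg_cost (fuel S) ([:: (r, true)], [::]) <= 14 * m)%N.
Proof.
move=> /asg_result[_ e].
have := @fold_cost_potential _ _ (fun (st : asg_state R) (_ : seg R) => asg_step st)
    (fun st _ => lcase st.1 0 (fun rb _ => size (rchildren rb.1)))%N (fun=> True)
    (fun st => size st.1) (fun=> 0%N) 1 ([:: (r, true)], [::]) (fuel S).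
rewrite -/(asg_cost _ _) -/(asg_loop _ _) e size_fuel size_segments => h.
have : (asg_cost (fuel S) ([:: (r, true)], [::]) + 1 + 0 <= 0 + 0 + 2 * (7 * m))%N.
  apply: h => // st _ _; split=> //; case: st => -[|[q b] w] out /=; first lia.
  have hsz (g : R) cs l : size (foldl (fun w c => (c, (g <= rap c)%R) :: w) l cs) = (size l + size cs)%N.
    by elim: cs l => [|c cs IH] l /=; rewrite ?IH /=; lia.
  by rewrite /asg_step /= /bind /= hsz; lia.
lia.
Qed.

Lemma solve_cost_bound : (size E + solve_cost S <= 700 * (m * k + m * lg + 1))%N.
Proof.
have [s0 [S' eS]] := first_segment; have m0 := m_gt0.
have [r [h1 h2 h3 h4 h5]] := dfs_result s0.
have c1 := sweep_cost_bound; have c2 := build_cost_bound; have c3 := dfs_cost_bound s0.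
have c4 := asg_cost_bound h3.
have sE : size E = m by rewrite (perm_size pE) size_map -cardE card_ord.
have unfold (S0 : seq (seg R)) t S1 : S0 = t :: S1 -> solve_cost S0 =
    size S0 + (sweep_cost (fuel S0) S0 + (build_cost (sweep (fuel S0) S0) +
      (dfs_all_cost (fuel S0) (dfs_start (build_adj (sweep (fuel S0) S0)) t) +
      lcase (dfs_all (fuel S0) (dfs_start (build_adj (sweep (fuel S0) S0)) t)).2.2 0
        (fun r _ => asg_cost (fuel S0) ([:: (r, true)], [::])))))%N by move=> ->.
rewrite (@unfold _ _ _ eS) h1 [lcase _ _ _]/= sE size_segments.
have m1 := leq_mul_log m.
move: c1 c2 c3 c4; set a := sweep_cost _ _; set b := build_cost _; set c := dfs_all_cost _ _; set d := asg_cost _ _.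
lia.
Qed.

End Cost.
End SolveSpec.

(** * Input and output *)

Section Loops.
Variable R : realType.
Local Notation mem := (memory R).
Implicit Types (M : mem) (v w : value R).

Lemma same_outside_trans M1 M2 M3 :
  same_outside M1 M2 -> same_outside M2 M3 -> same_outside M1 M3.
Proof. by move=> [a b] [c d]; split=> x i h; rewrite ?c ?d ?a ?b. Qed.

Lemma runs_from_seq M0 M p q v w T1 T2 : heap_only p -> same_outside M0 M ->
  runs_from M p v T1 -> (forall M', top M' v -> same_outside M0 M' -> runs_from M' q w T2) ->
  runs_from M (Seq p q) w (T1 + T2).
Proof.
move=> hp0 so [M1 [t1 [s1 [e1 r1 l1 b1 c1]]]] hq.
have so1 := same_outside_trans so (heap_only_outside e1 hp0).
have [M2 [t2 [s2 [e2 r2 l2 b2 c2]]]] := hq _ r1 so1.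
exists M2, (t1 + t2)%N, (maxn s1 s2); split=> //; try lia.
exact: ExecSeq e1 e2.
Qed.

Lemma pushN M v e n : top M v -> (forall M', same_outside M M' -> neval M' e = n) ->
  runs_from M (newN e ACC) (VP (VN R n) v) (ncost e + 62).
Proof.
move=> tM h; have := @newN_spec R M e ACC v n v path_acc tM.
by rewrite -addnA; apply=> // M' _; apply: h.
Qed.

Lemma pushR M v e x : top M v -> (forall M', same_outside M M' -> reval M' e = x) ->
  runs_from M (newR e ACC) (VP (VR x) v) (rcost e + 62).
Proof.
move=> tM h; have := @newR_spec R M e ACC v x v path_acc tM.
by rewrite -addnA; apply=> // M' _; apply: h.
Qed.

Definition make_pair : prog := consl (FST (SND ACC)) (FST ACC) (SND (SND ACC)).

Lemma make_pair_runs v w r : runs make_pair (VP w (VP v r)) (VP (VP v w) r) 81.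
Proof.
apply: consl_runs; last reflexivity; try by repeat constructor.
all: by move=> M; rewrite /top /=; intuition.
Qed.

Definition raw_at M (i : nat) : raw_edge R :=
  (i, ((rmem M 0 (nmem M 1 i), rmem M 1 (nmem M 1 i)),
       (rmem M 0 (nmem M 2 i), rmem M 1 (nmem M 2 i)))).

Definition COUNTER := NGet 6 (NConst 0).

(** Stack code for one edge record. The final push of 1 is the tag that turns the pair of the edge
    and the list into a list cell. *)
Definition read_edge : prog :=
  Seq (newN COUNTER ACC)
  (Seq (newR (RGet 0 (NGet 1 COUNTER)) ACC) (Seq (newR (RGet 1 (NGet 1 COUNTER)) ACC) (Seq make_pair
  (Seq (newR (RGet 0 (NGet 2 COUNTER)) ACC) (Seq (newR (RGet 1 (NGet 2 COUNTER)) ACC) (Seq make_pair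
  (Seq make_pair (Seq make_pair (newN (NConst 1) ACC))))))))).

Lemma read_edge_spec M (l : seq (raw_edge R)) : top M (enc l) ->
  runs_from M read_edge (enc (raw_at M (nmem M 6 0) :: l)) 1000.
Proof.
move=> tM; have so0 : same_outside M M by [].
have h T : runs_from M read_edge (enc (raw_at M (nmem M 6 0) :: l)) T -> (T <= 1000)%N ->
    runs_from M read_edge (enc (raw_at M (nmem M 6 0) :: l)) 1000.
  by move=> [M' [t [s [e r b c d]]]] le; exists M', t, s; split=> //; lia.
apply: h.
apply: (runs_from_seq _ so0 (pushN tM _)) => //.
  by move=> M' [h _]; rewrite /= h.
move=> M1 tM1 so1; apply: (runs_from_seq _ so1 (pushR tM1 _)) => //.
  by move=> M' /(same_outside_trans so1)[h1 h2]; rewrite /= h2 // !h1.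
move=> M2 tM2 so2; apply: (runs_from_seq _ so2 (pushR tM2 _)) => //.
  by move=> M' /(same_outside_trans so2)[h1 h2]; rewrite /= h2 // !h1.
move=> M3 tM3 so3; apply: (runs_from_seq _ so3 (make_pair_runs tM3)) => //.
move=> M4 tM4 so4; apply: (runs_from_seq _ so4 (pushR tM4 _)) => //.
  by move=> M' /(same_outside_trans so4)[h1 h2]; rewrite /= h2 // !h1.
move=> M5 tM5 so5; apply: (runs_from_seq _ so5 (pushR tM5 _)) => //.
  by move=> M' /(same_outside_trans so5)[h1 h2]; rewrite /= h2 // !h1.
move=> M6 tM6 so6; apply: (runs_from_seq _ so6 (make_pair_runs tM6)) => //.
move=> M7 tM7 so7; apply: (runs_from_seq _ so7 (make_pair_runs tM7)) => //.
move=> M8 tM8 so8; apply: (runs_from_seq _ so8 (make_pair_runs tM8)) => //.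
  by move=> M9 tM9 so9; exact: (@pushN M9 _ (NConst 1) 1 tM9 (fun _ _ => erefl)).
by [].
Qed.

Definition read_loop : prog :=
  While (NLe (NAdd COUNTER (NConst 1)) (NGet 0 (NConst 1)))
    (Seq read_edge (NSet 6 (NConst 0) (NAdd COUNTER (NConst 1)))).

Lemma read_loop_spec (f : nat -> raw_edge R) d M i l :
  nmem M 0 1 = (i + d)%N -> nmem M 6 0 = i -> (forall j, raw_at M j = f j) -> top M (enc l) ->
  runs_from M read_loop (enc (rev (map f (iota i d)) ++ l)) (1020 * d.+1).
Proof.
elim: d M i l => [|d IH] M i l h0 h6 hf tM.
  exists M; do 2 eexists; split.
  - by apply: ExecWhileFalse; rewrite /= h0 h6; lia.
  - exact: tM.
  - by [].
  - by [].
  - by rewrite leqnn leq_addr.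
have [M1 [t1 [s1 [e1 r1 l1 b1 c1]]]] := read_edge_spec tM.
have [k1 k2] := heap_only_outside e1 isT.
pose M2 := Memory (write (nmem M1) 6 0 i.+1) (rmem M1).
have x2 : exec (NSet 6 (NConst 0) (NAdd COUNTER (NConst 1))) M1 M2 6 1.
  have -> : M2 = Memory (write (nmem M1) 6 (neval M1 (NConst 0)) (neval M1 (NAdd COUNTER (NConst 1)))) (rmem M1).
    by rewrite /M2 /= k1 // h6 addn1.
  exact: ExecNSet.
have tM2 : top M2 (enc (f i :: l)) by rewrite -hf -h6; apply: rep_ext r1.
have [||M3 [t3 [s3 [e3 r3 l3 b3 c3]]]] := IH M2 i.+1 (f i :: l) _ erefl _ tM2.
- by rewrite /= /write /= k1 // h0 addnS.
- by move=> j; rewrite -hf /raw_at /= /write /= !k1 // !k2.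
exists M3; do 2 eexists; split.
- apply: (ExecWhileTrue _ (ExecSeq e1 x2) e3).
  by rewrite /= h0 h6; lia.
- by move: r3; rewrite /= rev_cons cat_rcons.
- by rewrite /=; lia.
- by move: b1 b3 c1 c3; rewrite /hp /= /write /=; lia.
- by move: c1 c3; rewrite /hp /= /write /=; lia.
Qed.

(** The memory outside the input is zero: once heap cell 0 counts as allocated, address 0 represents
    the number 0, and its pair with itself is the empty list. *)
Definition init_list : prog := Seq (NSet 5 (NConst 0) (NConst 1)) (cons2 ACC ACC).

Lemma init_list_spec M : nmem M 5 1 = 0%N -> nmem M 3 0 = 0%N -> nmem M 5 0 = 0%N ->
  runs_from M init_list (enc ([::] : seq (raw_edge R))) 40.
Proof.
move=> h1 h3 h0; pose M1 := Memory (write (nmem M) 5 0 1) (rmem M).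
have tM : top M1 (VN R 0) by rewrite /top /= /acc /hp /= /write /= h1 h3.
have := @cons2_runs R ACC ACC (VN R 0) _ (VN R 0) (VN R 0) stable_acc stable_acc (fun _ h => h) (fun _ h => h) erefl M1 tM.
move=> [M' [t [s [e r l b c]]]]; exists M', (3 + t)%N, (maxn 1 s); split=> //.
- exact: (ExecSeq (ExecNSet M 5 (NConst 0) (NConst 1)) e).
- by move: l => /=; lia.
- by move: b c; rewrite /hp /= /write /=; lia.
- by move: c; rewrite /hp /= /write /= h0; lia.
Qed.

Definition NODE := FST (SND ACC).

Definition write_loop : prog :=
  While (NLe (NConst 1) (NGet 3 (FST ACC)))
    (Seq (RSet 2 (NGet 3 (FST NODE)) (RGet 4 (SND NODE)))
    (Seq (RSet 3 (NGet 3 (FST NODE)) (RGet 4 (SND NODE)))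
      (NSet 5 (NConst 1) (SND (SND ACC))))).

(** Distinct keys ensure that a ratio, once written, is not overwritten by a later entry. *)
Lemma write_loop_spec (l : seq (nat * R)) M N : top M (enc l) -> uniq (map fst l) ->
  (forall p, p \in l -> (p.1 < N)%N) ->
  exists M' t s, [/\ exec write_loop M M' t s, (t <= 50 * (size l).+1)%N, (s <= N + 2)%N &
    (forall i, i \notin map fst l -> rmem M' 2 i = rmem M 2 i /\ rmem M' 3 i = rmem M 3 i) /\
    (forall p, p \in l -> rmem M' 2 p.1 = p.2 /\ rmem M' 3 p.1 = p.2)].
Proof.
elim: l M => [|[i g] l IH] M tM u hN.
  exists M; do 2 eexists; split.
  - apply: ExecWhileFalse; move: tM; rewrite /top /= => -[_ [[_ ->] _]]; lia.
  - by [].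
  - by [].
  - by [].
have [_ [[_ e1] [_ [[_ [[_ ei] [_ eg]]] rl]]]] := tM.
pose M1 := Memory (write (nmem M) 5 1 (nmem M 4 (nmem M 4 (acc M))))
  (write (write (rmem M) 2 i g) 3 i g).
have tM1 : top M1 (enc l) by apply: rep_ext rl.
have x1 : exec (Seq (RSet 2 (NGet 3 (FST NODE)) (RGet 4 (SND NODE)))
    (Seq (RSet 3 (NGet 3 (FST NODE)) (RGet 4 (SND NODE)))
      (NSet 5 (NConst 1) (SND (SND ACC))))) M M1 32 (maxn i.+1 (maxn i.+1 2)).
  have wr M' a : neval M' (NGet 3 (FST NODE)) = i -> reval M' (RGet 4 (SND NODE)) = g ->
    exec (RSet a (NGet 3 (FST NODE)) (RGet 4 (SND NODE))) M'
      (Memory (nmem M') (write (rmem M') a i g)) 13 i.+1.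
    by move=> h1 h2; have := ExecRSet M' a (NGet 3 (FST NODE)) (RGet 4 (SND NODE)); rewrite h1 h2.
  have xa := wr M 2 ei eg.
  have xb := wr (Memory (nmem M) (write (rmem M) 2 i g)) 3 ei eg.
  exact: ExecSeq xa (ExecSeq xb (ExecNSet _ 5 (NConst 1) (SND (SND ACC)))).
have /andP[ni ul] := u.
have [|M' [t [s [e2 t2 s2 [k1 k2]]]]] := IH M1 tM1 ul.
  by move=> p hp; apply: hN; rewrite inE hp orbT.
have iN : (i < N)%N by apply: (hN (i, g)); rewrite mem_head.
exists M'; do 2 eexists; split.
- apply: (ExecWhileTrue _ x1 e2); by rewrite /= -/(acc M) e1.
- by rewrite /=; lia.
- by lia.
- split.
    move=> j; rewrite map_cons inE negb_or => /andP[ji jl]; have [-> ->] := k1 _ jl.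
    by rewrite /= /write /= (negbTE ji).
  move=> p; rewrite inE => /orP[/eqP ->|]; last exact: k2.
  by have [-> ->] := k1 _ ni; rewrite /= /write /= eqxx.
Qed.

End Loops.

Lemma read_input_perm (R : realType) n m (G : sgraph n m) (D : drawing R G) :
  perm_eq (rev (map (raw_at (input_memory D)) (iota 0 m)) ++ [::]) (map (raw D) (enum 'I_m)).
Proof.
rewrite cats0 perm_rev -val_enum_ord -map_comp; apply/permP => a; congr count.
apply: eq_map => s; rewrite /= /raw_at /= /tabulate !valK /=.
by rewrite /raw /ptail /phead -!surjective_pairing.
Qed.

Theorem theorem3 (R : realType) :
  exists (p : prog) (c : nat),
  forall (n m : nat) (G : sgraph n m) (D : drawing R G) (k : nat),
    is_tree (intersection_graph D) ->
    max_degree (intersection_graph D) = k ->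
    exists (M : memory R) (t s : nat),
      [/\ exec p (input_memory D) M t s,
          is_MaxSPED D (@output_stubs R m M),
          t <= c * (m * k + m * trunc_log 2 m + 1) &
          s <= c * (m * k + m * trunc_log 2 m + 1)].
Proof.
have [p [C runs_p]] := Comp_solve R.
(* A compiled program expects its argument on top of a stack; a second reference to the list serves
   as the rest of the stack and is dropped afterwards. *)
exists (Seq init_list (Seq read_loop (Seq (cons2 ACC ACC) (Seq p
  (Seq (NSet 5 (NConst 1) (FST ACC)) write_loop))))), (5000 + 1000 * C)%N.
move=> n m G D k tr hk; set M0 := input_memory D.
have pE := read_input_perm D; set E := rev _ ++ _ in pE.
have bound := solve_cost_bound tr pE hk; set W := (m * k + _ + 1)%N in bound *.
have [keys opt] := solve_spec tr pE.
have [M1 [t1 [s1 [e1 r1 l1 b1 c1]]]] := @init_list_spec R M0 erefl erefl erefl.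
have [k1 k2] := heap_only_outside e1 isT.
have [|||M2 [t2 [s2 [e2 r2 l2 b2 c2]]]] := @read_loop_spec R (raw_at M0) m M1 0 [::] _ _ _ r1.
- by rewrite k1.
- by rewrite k1.
- by move=> j; rewrite /raw_at !k1 // !k2.
have [M3 [t3 [s3 [e3 r3 l3 b3 c3]]]] := @cons2_runs R ACC ACC (enc E) _ (enc E) (enc E)
  stable_acc stable_acc (fun _ h => h) (fun _ h => h) erefl M2 r2.
have [M4 [t4 [s4 [e4 r4 l4 b4 c4]]]] := runs_p E (enc E) M3 r3.
pose M5 := Memory (write (nmem M4) 5 1 (nmem M4 3 (acc M4))) (rmem M4).
have r5 : top M5 (enc (solve E)) by have [_ [h _]] := r4; apply: rep_ext h.
have uk : uniq (map fst (solve E)).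
  by rewrite (perm_uniq keys) map_inj_uniq ?enum_uniq //; apply: val_inj.
have keysm q : q \in solve E -> q.1 < m.
  move=> hq; have : q.1 \in map fst (solve E) by rewrite map_f.
  by rewrite (perm_mem keys) => /mapP[s _ ->]; apply: ltn_ord.
have [M6 [t6 [s6 [e6 l6 b6 [_ out]]]]] := write_loop_spec r5 uk keysm.
have mW : m <= W by have := leq_mul_log m; rewrite /W; lia.
have W0 : 0 < W by rewrite /W addn1.
(* The running time is at most [C] times the cost plus one; the cost is at most [700 * W], and [W]
   is positive. *)
have {}l4 : t4 <= 1000 * (C * W).
  apply: leq_trans l4 _; rewrite mulnCA leq_mul2l; apply/orP; right; lia.
have {}l6 : t6 <= 50 * m.+1.
  by move: l6; rewrite -(size_map fst) (perm_size keys) size_map -cardE card_ord.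
have h0 : hp M0 = 0 by [].
have h5 : hp M5 = hp M4 by [].
have aW : (5000 + 1000 * C) * W = 5000 * W + 1000 * (C * W) by rewrite mulnDl mulnA.
exists M6; do 2 eexists; split.
- exact: ExecSeq e1 (ExecSeq e2 (ExecSeq e3 (ExecSeq e4 (ExecSeq (ExecNSet M4 5 (NConst 1) (FST ACC)) e6)))).
- have val_out (s : 'I_m) : exists2 g, (val s, g) \in solve E & output_stubs M6 s = (g, g).
    have : val s \in map fst (solve E) by rewrite (perm_mem keys) map_f ?mem_enum.
    case/mapP => -[i g] hq /= e; exists g; first by rewrite e.
    by have [h1 h2] := out _ hq; rewrite /output_stubs; move: h1 h2; rewrite /= -e => -> ->.
  apply: opt => s; have [g hg ->] := val_out s; [by []|exact: hg].
- move: l3; rewrite aW /=; lia.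
- move: l3; rewrite aW /=; lia.
Qed.
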